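(* Let $\mu_0,\mu_1$ have full support on the finite sets $\mathcal X_0,\mathcal X_1$, assume $\mu_0$ is not a point mass, that $\kappa_0(x,\cdot)\ne\kappa_0(x',\cdot)$ as functions on $\mathcal X_0$ for all $x\neq x'$ in $\mathcal X_0$, and that $\kappa_1(y,\cdot)\neq\kappa_1(y',\cdot)$ as functions on $\mathcal X_1$ for all $y\ne y'$ in $\mathcal X_1$. Let $(\mu_{0,n},\mu_{1,n})$ be random probability measures on $\mathcal X_0,\mathcal X_1$ with $\sqrt n((w_{\mu_{0,n}},w_{\mu_{1,n}})-(w_{\mu_0},w_{\mu_1}))\stackrel d\to(G_{\mu_0},G_{\mu_1})$, let $q\in\mathbb R^{N_0}$ be a simplex vector with $\Sigma_q\neq0$, and assume conditions (A1)–(A4) of the context. Let $\alpha\in(0,1)$. Then: (a) Given almost every realization of the samples, the test which rejects the null hypothesis $\mathsf{GW}_p(\mu_0,\mu_1)=0$ if $\sqrt n\,\mathsf{GW}_p(\mu_{0,n},\mu_{1,n})^p$ exceeds the $(1-\alpha)$-quantile of $\hat L_n$ (conditional on $Y_1,\dots,Y_n$) is of asymptotic level $\alpha$, i.e. its asymptotic size under the null hypothesis is no more than $\alpha$. (b) If (under the null hypothesis $\mathsf{GW}_p(\mu_0,\mu_1)=0$) the set $\{S\in\mathcal S:\mu_1=S_\sharp\mu_0\}$ is a singleton, then $\hat L_n$ consistently estimates the distribution of $L_*$: for almost every realization of $Y_1,Y_2,\dots$, $\lim_{n\to\infty}\sup_{t\ge0}|\mathbb P(\hat L_n\le t\,|\,Y_1,\dots,Y_n)-\mathbb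 P(L_*\le t)|=0$. (c) Otherwise, if $\mathsf{GW}_p(\mu_0,\mu_1)>0$, the asymptotic power of the test in (a) is $1$ given almost every realization of the samples, i.e. the probability that the test rejects the null hypothesis converges to $1$.
   Context: $\mathcal X_i=\{x_i^{(1)},\dots,x_i^{(N_i)}\}$, $p>0$, $\kappa_i:\mathcal X_i\times\mathcal X_i\to\mathbb R$; it is assumed (without loss of generality, by symmetrization) that $\Delta(x,y,x',y')=|\kappa_0(x,x')-\kappa_1(y,y')|^p$ satisfies $\Delta(x,y,x',y')=\Delta(x',y',x,y)$. $\mathsf{GW}_p(\mu_0,\mu_1)^p=\inf_{\pi\in\Pi(\mu_0,\mu_1)}\int\Delta\,d\pi\otimes\pi$, with $\Pi(\mu_0,\mu_1)$ the set of couplings. $w_\eta$ is the vector of weights of a measure $\eta$, $v_h$ the vector of values of a function $h$. $T_\sharp\mu$ denotes pushforward. $\mathcal S$ is the set of bijections $S:\mathcal X_0\to\mathcal X_1$ with $\kappa_0(x,x')=\kappa_1(S(x),S(x'))$ for all $x,x'\in\mathcal X_0$. $\mathcal H_{\mu_0}=\{h:\mathcal X_0\to\mathbb R\ |\ h(x)-h(\tilde x)\le2\int|\kappa_0(x,x')-\kappa_0(\tilde x,x')|^pd\mu_0(x')\ \forall x,\tilde x\in\mathcal X_0\}$. $L_*=\inf_{S\in\mathcal S,\ \mu_1=S_\sharp\mu_0}\ \sup_{h\in\mathcal H_{\mu_0}}\{v_h^{\intercal}G_{\mu_0}+v_{-h\circ S^{-1}}^{\intercal}G_{\mu_1}\}$,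 which is the limit in distribution of $\sqrt n\,\mathsf{GW}_p(\mu_{0,n},\mu_{1,n})^p$ under the null hypothesis. For a simplex vector $q$ (nonnegative entries summing to one), $\Sigma_q=\mathrm{diag}(q)-qq^{\intercal}$. For $l\in\{1,\dots,N_0^2\}$ put $i(l)=\lfloor(l-1)/N_0\rfloor+1$, $j(l)=((l-1)\bmod N_0)+1$, and $(u_{\mu_0})_l=2\int|\kappa_0(x_0^{(i(l))},x')-\kappa_0(x_0^{(j(l))},x')|^pd\mu_0(x')$. Assumptions. Under the null hypothesis $\mathsf{GW}_p(\mu_0,\mu_1)=0$: (A1) $G_{\mu_0}\sim N(0,\Sigma_q)$; (A2) for any $S\in\mathcal S$ with $\mu_1=S_\sharp\mu_0$, $T_S(G_{\mu_1})$ is an independent copy of $G_{\mu_0}$, where $(T_S(x))_i=x_{\sigma_S(i)}$ and $\sigma_S(i)=j$ iff $S(x_0^{(i)})=x_1^{(j)}$. Furthermore, there are estimators $\hat\Sigma_n\in\mathbb R^{N_0\times N_0}$ and $\hat u_n\in\mathbb R^{N_0^2}$ based on samples $Y_1,\dots,Y_n$ from an auxiliary distribution (on some, perhaps distinct, space) such that: (A3) given almost every realization of $Y_1,Y_2,\dots$, $\hat\Sigma_n\to\Sigma_q$ and $\hat u_n\to u_{\mu_0}$ conditionally on the data; (A4) if $Z\sim N(0,\hat\Sigma_n)$, then $\mathbb P(Z^{\intercal}\mathbf 1=0)=1$ for all $n$ sufficiently large. $\hat L_n=\max\{\sqrt2\,Z^{\intercal}w:\ w\in\mathbb R^{N_0},\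 w_{i(l)}-w_{j(l)}\le(\hat u_n)_l\ \text{for all } l \text{ with } i(l)\ne j(l)\}$ where, conditionally on $Y_1,\dots,Y_n$, $Z\sim N(0,\hat\Sigma_n)$. ''The samples'' in the claim are the data $Y_1,Y_2,\dots$ from which $\hat\Sigma_n,\hat u_n$, and hence the law of $\hat L_n$, are computed. *)

(* Defs.v *)
From HB Require Import structures.
From mathcomp Require Import all_boot all_order all_algebra.
From mathcomp Require Import all_classical all_reals all_analysis.

Set Implicit Arguments.
Unset Strict Implicit.
Unset Printing Implicit Defensive.

Import Order.TTheory GRing.Theory Num.Theory.
Import numFieldNormedType.Exports.

Local Open Scope classical_set_scope.
Local Open Scope ring_scope.

(* Conventions.  The k-th point of a finite set X_i = {x_i^(1), ..., x_i^(N_i)}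
   is represented by the ordinal k-1 : 'I_(N_i).  A (probability) measure on X_i
   is represented by its row vector of weights w : 'rV[R]_(N_i), and a function
   h on X_i by a function on 'I_(N_i).  Vectors are row vectors, so that the
   textbook  u^T v  is [dot u v] and  u v^T  is [u^T *m v]. *)

(* Real matrices (hence vectors) carry the Borel sigma-algebra. *)
Section borel_matrix.
Context (R : realType) (m n : nat).
Let borel : set (set 'M[R]_(m, n)) := <<s (@open 'M[R]_(m, n)) >>.
Let borel0 : borel set0. Proof. exact: sigma_algebra0. Qed.
Let borelC A : borel A -> borel (~` A).
Proof. by move=> /sigma_algebraCD; rewrite setTD. Qed.
Let borel_bigcup (F : (set 'M[R]_(m, n))^nat) :
  (forall i, borel (F i)) -> borel (\bigcup_i F i).
Proof. exact: sigma_algebra_bigcup. Qed.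

HB.instance Definition _ := @isMeasurable.Build
  (sigma_display (@open 'M[R]_(m, n))) 'M[R]_(m, n) borel borel0 borelC
  borel_bigcup.
End borel_matrix.

Section finite_measures.
Context {R : realType}.

Definition dot N (u v : 'rV[R]_N) : R := \sum_i u 0 i * v 0 i.

Definition simplex N (w : 'rV[R]_N) : Prop :=
  (forall i, 0 <= w 0 i) /\ \sum_i w 0 i = 1.

Definition full_support N (w : 'rV[R]_N) : Prop := forall i, 0 < w 0 i.

Definition point_mass N (w : 'rV[R]_N) : Prop := exists i, w = delta_mx 0 i.

Definition push N0 N1 (S : 'I_N0 -> 'I_N1) (w : 'rV[R]_N0) : 'rV[R]_N1 :=
  \row_y \sum_(x | S x == y) w 0 x.

Definition Sigma N (q : 'rV[R]_N) : 'M[R]_N := diag_mx q - q^T *m q.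

End finite_measures.

Section gromov_wasserstein.
Context {R : realType} (p : R) {N0 N1 : nat}.
Variables (k0 : 'I_N0 -> 'I_N0 -> R) (k1 : 'I_N1 -> 'I_N1 -> R).

Definition Delta (x : 'I_N0) (y : 'I_N1) (x' : 'I_N0) (y' : 'I_N1) : R :=
  `|k0 x x' - k1 y y'| `^ p.

Definition couplings (w0 : 'rV[R]_N0) (w1 : 'rV[R]_N1) : set 'M[R]_(N0, N1) :=
  [set pi | [/\ forall x y, 0 <= pi x y,
                forall x, \sum_y pi x y = w0 0 x &
                forall y, \sum_x pi x y = w1 0 y]].

Definition GW (w0 : 'rV[R]_N0) (w1 : 'rV[R]_N1) : R :=
  (inf [set \sum_x \sum_y \sum_x' \sum_y' Delta x y x' y' * pi x y * pi x' y'
       | pi in couplings w0 w1]) `^ p^-1.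

Definition isos : set ('I_N0 -> 'I_N1) :=
  [set S | bijective S /\ forall x x', k0 x x' = k1 (S x) (S x')].

Definition null_isos (w0 : 'rV[R]_N0) (w1 : 'rV[R]_N1) : set ('I_N0 -> 'I_N1) :=
  [set S | isos S /\ w1 = push S w0].

Definition cost (w0 : 'rV[R]_N0) (x1 x2 : 'I_N0) : R :=
  2 * \sum_x' `|k0 x1 x' - k0 x2 x'| `^ p * w0 0 x'.

Definition potentials (w0 : 'rV[R]_N0) : set ('I_N0 -> R) :=
  [set h | forall x1 x2, h x1 - h x2 <= cost w0 x1 x2].

(* The value of L_* at (G_{mu_0}, G_{mu_1}) = (g0, g1); T is the inverse of S.
   Extended-valued, since the supremum is +oo when g0 - T_S g1 does not sum
   to zero. *)
Definition Lstar (w0 : 'rV[R]_N0) (w1 : 'rV[R]_N1)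
    (g0 : 'rV[R]_N0) (g1 : 'rV[R]_N1) : \bar R :=
  ereal_inf [set s | exists S T,
    [/\ null_isos w0 w1 S, cancel S T, cancel T S &
        s = ereal_sup [set (dot (\row_x h x) g0
                            + dot (\row_y - h (T y)) g1)%:E
                      | h in potentials w0]]].

End gromov_wasserstein.

Section program.
Context {R : realType} {N : nat}.

Lemma idx_i_subproof (l : 'I_(N * N)) : (l %/ N < N)%N.
Proof.
case: (posnP N) => [N0|N_gt0]; first by case: l => l /=; rewrite N0.
by rewrite ltn_divLR.
Qed.

Lemma idx_j_subproof (l : 'I_(N * N)) : (l %% N < N)%N.
Proof.
case: (posnP N) => [N0|]; first by case: l => l /=; rewrite N0.
exact: ltn_pmod.
Qed.

Definition idx_i (l : 'I_(N * N)) : 'I_N := Ordinal (idx_i_subproof l).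
Definition idx_j (l : 'I_(N * N)) : 'I_N := Ordinal (idx_j_subproof l).

Definition u_vec (p : R) (k0 : 'I_N -> 'I_N -> R) (w0 : 'rV[R]_N) :
    'rV[R]_(N * N) :=
  \row_l cost p k0 w0 (idx_i l) (idx_j l).

(* The value of the linear program defining \hat L_n at Z = z and
   \hat u_n = u; it is -oo if the program is infeasible, +oo if it is
   unbounded, and otherwise its maximum. *)
Definition Lhat (u : 'rV[R]_(N * N)) (z : 'rV[R]_N) : \bar R :=
  ereal_sup [set (Num.sqrt 2 * dot z w)%:E
            | w in [set w : 'rV[R]_N | forall l, idx_i l != idx_j l ->
                          w 0 (idx_i l) - w 0 (idx_j l) <= u 0 l]].

End program.

Section random_vectors.
Context {R : realType}.

(* N(0, v) on the line.  The Dirac mass for v = 0 is needed because the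
   library's [normal_prob m 0] is a uniform distribution. *)
Definition normal1 (v : R) : set R -> \bar R :=
  if v == 0 then (\d_(0 : R) : set R -> \bar R) else normal_prob 0 (Num.sqrt v).

(* X ~ N(0, V), with V possibly singular. *)
Definition gaussian (d : measure_display) (T : measurableType d)
    (P : probability T R) (N : nat) (X : T -> 'rV[R]_N) (V : 'M[R]_N) : Prop :=
  [/\ V^T = V,
      forall a : 'rV[R]_N, 0 <= (a *m V *m a^T) 0 0 &
      forall (a : 'rV[R]_N) (B : set R), measurable B ->
        P [set t | B (dot a (X t))] = normal1 ((a *m V *m a^T) 0 0) B].

Definition indep_copy (d : measure_display) (T : measurableType d)
    (P : probability T R) (N : nat) (X X0 : T -> 'rV[R]_N) : Prop :=
  (forall A : set 'rV[R]_N, measurable A -> P (X @^-1` A) = P (X0 @^-1` A)) /\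
  (forall A B : set 'rV[R]_N, measurable A -> measurable B ->
     P (X @^-1` A `&` X0 @^-1` B) = (P (X @^-1` A) * P (X0 @^-1` B))%E).

Definition cvg_in_distribution (d d' : measure_display)
    (T : measurableType d) (P : probability T R)
    (T' : measurableType d') (P' : probability T' R) (N : nat)
    (X : nat -> T -> 'rV[R]_N) (Y : T' -> 'rV[R]_N) : Prop :=
  forall f : 'rV[R]_N -> R, continuous f ->
    (exists M, forall x, `|f x| <= M) ->
    ('E_P[f \o X n] @[n --> \oo] --> 'E_P'[f \o Y])%E.

Definition quantile (d : measure_display) (T : measurableType d)
    (P : probability T R) (X : T -> \bar R) (b : R) : \bar R :=
  ereal_inf [set t%:E | t in [set t : R |
                                (b%:E <= P [set z | (X z <= t%:E)%E])%E]].

(* T_S; under the indexing convention, S itself is sigma_S. *)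
Definition permute N0 N1 (S : 'I_N0 -> 'I_N1) (x : 'rV[R]_N1) : 'rV[R]_N0 :=
  \row_i x 0 (S i).

Definition sample (d d' : measure_display) (T : measurableType d)
    (P : probability T R) (E : measurableType d')
    (Y : nat -> {RV P >-> E}) (n : nat) (t : T) : n.-tuple E :=
  [tuple Y i t | i < n].

End random_vectors.

(* Main.v *)
Require Import Defs.
From HB Require Import structures.
From mathcomp Require Import all_boot all_order all_algebra.
From mathcomp Require Import all_classical all_reals all_analysis.
From mathcomp Require Import measurable_realfun lra.

Set Implicit Arguments.
Unset Strict Implicit.
Unset Printing Implicit Defensive.

Import Order.TTheory GRing.Theory Num.Theory.
Import numFieldNormedType.Exports.

Local Open Scope classical_set_scope.
Local Open Scope ring_scope.

(* Under the null hypothesis an isometry S transports mu_0 to mu_1, and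
   GW_p^p = inf of a quadratic form over couplings.  Let a, b be weights close to
   mu_0, mu_1.  Displacing the mass of the coupling induced by S along a flow rho
   on X_0 with divergence a - T_S b costs sum_(x, x') cost(x, x') rho(x, x') up
   to a second-order term, so by min-cost-flow duality sqrt(n) GW_p^p is at most
   psi(sqrt(n) (a - T_S b)) + o(1), where psi(z) is the maximum of <h, z> over
   the potentials h of H_{mu_0}.  In the limit its argument becomes
   W = G_0 - T_S G_1, which by (A1) and (A2) has the characteristic function of
   sqrt(2) Z with Z ~ N(0, Sigma_q), hence its law.  On vectors of zero sum the
   linear program is squeezed between (1 - e) psi(sqrt(2) Z) and
   (1 + e) psi(sqrt(2) Z) as soon as u_n is e-close to u, so its conditional
   distribution functions converge to that of psi(W) on [0, oo): psi is a maximum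
   of finitely many linear forms, so the limit has no atoms except possibly at 0,
   and none at 0 because psi vanishes only at 0 among vectors of zero sum while
   Sigma_q <> 0.  Polya's argument makes the convergence uniform.  Under the
   alternative GW_p^p is Lipschitz in the weights, so the statistic grows like
   sqrt(n) while the quantiles stay bounded.

   Convergence in distribution is derived from convergence of the expectations of
   cos(<a, X> + b): on a large cube, trigonometric polynomials approximate any
   continuous cut-off function (Stone-Weierstrass), and tightness does the rest. *)

(** * Borel measurability of vectors *)

(** [gaussian] describes a vector through its one-dimensional projections, and (A2) is an
    independence statement. What both yield at once is the expectation of cos(<a, W> + b), which is
    why laws are compared through such expectations; the phase b carries sine and cosine together,
    so everything stays real. For the level a single isomorphism S is enough: rejection is one-sided
    and psi bounds the statistic from above. In (b), uniqueness of S is what turns the infimum in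
    [Lstar] into psi(W). The constant 2 in [cost] counts the two orders in which displaced and
    undisplaced mass meet in the quadratic form. Adding constants to potentials is invisible to
    zero-sum vectors but makes the supremum infinite at all others. Fixing one coordinate gives a
    compact polytope, so that psi is finite and continuous everywhere; zero sums are then restored
    almost surely. Off-diagonal costs are bounded below. Hence flows of small cost carry small mass,
    estimated constraints are within a factor 1 ± e of the true ones, and psi vanishes only at 0
    among zero-sum vectors. *)

Section borel_vectors.
Context {R : realType} {N : nat}.

Lemma open_measurable_rV (A : set 'rV[R]_N) : open A -> measurable A.
Proof. by move=> oA; apply: sub_sigma_algebra. Qed.

Lemma closed_measurable_rV (A : set 'rV[R]_N) : closed A -> measurable A.
Proof.
move=> cA; rewrite -(setCK A); apply: measurableC.
by apply: open_measurable_rV; exact: closed_openC.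
Qed.

Lemma continuous_measurable_rV (f : 'rV[R]_N -> R) :
  continuous f -> measurable_fun setT f.
Proof.
move=> cf; apply: (measurability _ (measurable_realfun.RGenOpens.measurableE R)).
move=> _ [_ [a [b ->]] <-]; rewrite setTI; apply: open_measurable_rV.
by apply: open_comp => [x _|]; [exact: cf|exact: interval_open].
Qed.

Lemma ball_rVP (x y : 'rV[R]_N) (e : R) : 0 < e ->
  ball x e y <-> forall i, `|x 0 i - y 0 i| < e.
Proof.
move=> e0; split => [[_ xy] i|xy]; first exact: xy.
by split => // i j; rewrite ord1; exact: xy.
Qed.

(** Rational cubes form a countable base, so every open set is a countable union of boxes; this
    reduces measurability of a vector-valued map to its coordinates. *)
Lemma rational_box_nbhs (A : set 'rV[R]_N) x : open A -> A x ->
  exists c : 'rV[rat]_N * rat,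
    [/\ 0 < c.2, ball (map_mx (@ratr R) c.1) (ratr c.2 : R) x &
        ball (map_mx (@ratr R) c.1) (ratr c.2 : R) `<=` A].
Proof.
move=> oA Ax; have /nbhs_ballP[e /= e0 eA] : nbhs x A by exact: open_nbhs_nbhs.
have /rat_in_itvoo[r] : 0 < e / 2 by rewrite divr_gt0.
rewrite in_itv/= => /andP[r0 re].
have r0' : 0 < r by rewrite -(ltr0q R).
have /choice[c cx] : forall i, exists c : rat, `|x 0 i - ratr c| < ratr r.
  move=> i; have /rat_in_itvoo[c] : x 0 i - ratr r < x 0 i + ratr r.
    by rewrite ltrD2l gtrN.
  rewrite in_itv/= => xc; exists c; rewrite distrC ltr_norml; lra.
exists (\row_i c i, r); split => //=.
  by apply/ball_rVP => // i; rewrite !mxE distrC.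
move=> y /(ball_rVP _ _ r0) yc; apply: eA; apply/ball_rVP => // i.
have := yc i; rewrite !mxE; have := cx i; rewrite !ltr_norml; lra.
Qed.

Lemma measurable_rV d (T : measurableType d) (X : T -> 'rV[R]_N) :
  (forall i, measurable_fun setT (fun t => X t 0 i)) -> measurable_fun setT X.
Proof.
move=> mX.
have mbox (x : 'rV[R]_N) e : measurable (X @^-1` ball x e).
  have [e0|e0] := ltP 0 e; last first.
    rewrite (_ : _ @^-1` _ = set0)// -subset0 => t [e0'].
    by rewrite ltNge e0 in e0'.
  rewrite (_ : _ @^-1` _ =
      \bigcap_(i in [set: 'I_N]) ((fun t => X t 0 i) @^-1` ball (x 0 i) e)).
    apply: fin_bigcap_measurable => // i _; rewrite -[X in measurable X]setTI.
    by apply: mX => //; apply: open_measurable; exact: ball_open.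
  apply/seteqP; split => t /=.
    by move=> /(ball_rVP _ _ e0) xt i _; exact: xt.
  by move=> xt; apply/ball_rVP => // i; apply: (xt i).
apply: (measurability (@open 'rV[R]_N)) => // _ [A oA <-]; rewrite setTI.
pose I := [set c : 'rV[rat]_N * rat |
  0 < c.2 /\ ball (map_mx (@ratr R) c.1) (ratr c.2 : R) `<=` A].
rewrite (_ : X @^-1` A =
  \bigcup_(c in I) (X @^-1` ball (map_mx (@ratr R) c.1) (ratr c.2 : R))).
  rewrite bigcup_mkcond; apply: countable_bigcupT_measurable => // c.
  by case: ifP.
apply/seteqP; split => t.
  by move=> /(rational_box_nbhs oA)[c [c0 ct cA]]; exists c.
by move=> [c [_ cA] ct]; exact: cA.
Qed.

End borel_vectors.

(** * The Stone-Weierstrass theorem *)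

Section abs_polynomials.
Context {R : realType}.

(* The classical recursion whose iterates increase to [`|t|] on [-1, 1]. *)
Fixpoint abs_poly (k : nat) (t : R) : R :=
  if k is k'.+1 then abs_poly k' t + 2^-1 * (t * t + - 1 * (abs_poly k' t * abs_poly k' t))
  else 0.

(** With s = |t| and q the current iterate, the next error is (s - q)(1 - (s + q)/2), at most d -
    d^2/2 for d = s - q. This expression increases on [0, 1], so the bound 2/(k+2) propagates to
    2/(k+3). *)
Lemma abs_poly_bounds k t : `|t| <= 1 ->
  0 <= abs_poly k t <= `|t| /\ `|t| - abs_poly k t <= 2 / k.+2%:R.
Proof.
move=> t1; have t0 := normr_ge0 t.
have tt : t * t = `|t| * `|t| by rewrite -normrM ger0_norm// -expr2 sqr_ge0.
elim: k => [|k [/andP[q0 qt] qk]] /=; first by split; lra.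
rewrite tt; set q := abs_poly k t in q0 qt qk *; set s := `|t| in t1 t0 qt qk *.
have m0 : 0 < k.+2%:R :> R by [].
have m2 : 2 <= k.+2%:R :> R by rewrite ler_nat.
have m3 : k.+3%:R = k.+2%:R + 1 :> R by rewrite -natr1.
set m := k.+2%:R in m0 m2 m3 qk *.
split; first by apply/andP; split; nra.
rewrite m3; set a := 2 / m in qk.
have am : a * m = 2 by rewrite /a divfK// gt_eqF.
have a0 : 0 < a by rewrite divr_gt0.
have a1 : a <= 1 by rewrite ler_pdivrMr// mul1r.
have : (s - q) - (s - q) ^+ 2 / 2 <= a - a ^+ 2 / 2.
  rewrite -subr_ge0 (_ : _ - _ = (a - (s - q)) * (1 - (a + (s - q)) / 2)); last by lra.
  by apply: mulr_ge0; lra.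
have : a - a ^+ 2 / 2 <= 2 / (m + 1).
  by rewrite ler_pdivlMr; nra.
nra.
Qed.

End abs_polynomials.

Section stone_weierstrass.
Context {R : realType} {X : ptopologicalType}.
Variables (K : set X) (A : set (X -> R)).
Hypothesis cK : compact K.
Hypothesis contA : forall g, A g -> continuous g.
Hypothesis cstA : forall c, A (fun=> c).
Hypothesis addA : forall f g, A f -> A g -> A (fun x => f x + g x).
Hypothesis mulA : forall f g, A f -> A g -> A (fun x => f x * g x).

(** Approximation is measured on [K] only, but members are continuous on all of [X]: the sets that
    cover [K] in [compact_min_cover] must be open in [X]. *)
Definition uclosure : set (X -> R) := [set f | continuous f /\
  forall e, 0 < e -> exists2 g, A g & forall x, K x -> `|f x - g x| <= e].

Lemma compact_bounded_fun (f : X -> R) : continuous f ->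
  exists2 M, 0 < M & forall x, K x -> `|f x| <= M.
Proof.
move=> cf; have : compact (f @` K).
  by apply: continuous_compact => //; exact: continuous_subspaceT.
move=> /compact_bounded[M [_ /(_ (Num.max M 0 + 1))]] H.
exists (Num.max M 0 + 1) => [|x Kx]; first by rewrite ltr_wpDl// le_max lexx orbT.
by apply: H; [rewrite ltr_pwDr// le_max lexx|exists x].
Qed.

Lemma abs_poly_closed k g : A g -> A (fun x => abs_poly k (g x)).
Proof.
move=> Ag; elim: k => [|k IH] /=; first exact: cstA.
apply: addA => //; apply: (mulA (cstA _)); apply: addA; first exact: mulA.
by apply: (mulA (cstA _)); exact: mulA.
Qed.

(** On [K] the approximant [g] is rescaled by a bound [B] into [-1, 1], where [abs_poly] converges
    uniformly to the absolute value. *)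
Lemma uclosure_norm f : uclosure f -> uclosure (fun x => `|f x|).
Proof.
move=> [cf Af]; split=> [x|e e0].
  by apply: (cvg_comp f (fun y : R => `|y|)); [exact: cf|exact: norm_continuous].
have [g Ag fg] := Af (e / 2) ltac:(by rewrite divr_gt0).
have [B B0 gB] := compact_bounded_fun (contA Ag).
have [k kB] : exists k, B * (2 / k.+2%:R) <= e / 2.
  pose k := Num.truncn (4 * B / e); exists k.
  have kb : 4 * B / e < k.+1%:R by exact: truncnS_gt.
  rewrite mulrA ler_pdivrMr//.
  have : 4 * B < k.+1%:R * e by rewrite -ltr_pdivrMr.
  by rewrite -[k.+2%:R]natr1; nra.
exists (fun x => B * abs_poly k (B^-1 * g x)) => [|x Kx].
  apply: (mulA (cstA _)).
  by apply: (@abs_poly_closed k (fun x => B^-1 * g x)); exact: (mulA (cstA _)).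
have gx1 : `|B^-1 * g x| <= 1.
  by rewrite normrM gtr0_norm ?invr_gt0// ler_pdivrMl// mulr1 gB.
have [/andP[_ q1] q2] := abs_poly_bounds k gx1.
set q := abs_poly k _ in q1 q2 *.
have gE : `|g x| = B * `|B^-1 * g x|.
  by rewrite normrM gtr0_norm ?invr_gt0// mulVKf ?gt_eqF.
have h1 : `| `|f x| - `|g x| | <= e / 2.
  by apply: le_trans (fg _ Kx); exact: ler_dist_dist.
have h2 : 0 <= `|g x| - B * q <= e / 2.
  rewrite gE -mulrBr; apply/andP; split.
    by apply: mulr_ge0; [exact: ltW|rewrite subr_ge0].
  by apply: le_trans kB; rewrite ler_wpM2l// ltW.
by move: h1 h2; rewrite !ler_norml; lra.
Qed.

Lemma uclosure_comb (a b : R) f g : uclosure f -> uclosure g ->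
  uclosure (fun x => a * f x + b * g x).
Proof.
move=> [cf Af] [cg Ag]; split=> [x|e e0].
  by apply: cvgD; apply: cvgM; [exact: cvg_cst|exact: cf|exact: cvg_cst|exact: cg].
pose c := `|a| + `|b| + 1.
have c0 : 0 < c by rewrite ltr_wpDl// addr_ge0.
have ec0 : 0 < e / c by rewrite divr_gt0.
have [f' Af' ff'] := Af _ ec0; have [g' Ag' gg'] := Ag _ ec0.
exists (fun x => a * f' x + b * g' x) => [|x Kx].
  by apply: addA; apply: (mulA (cstA _)).
rewrite (_ : _ - _ = a * (f x - f' x) + b * (g x - g' x)); last by lra.
apply: (le_trans (ler_normD _ _)); rewrite !normrM.
have h1 : `|a| * `|f x - f' x| <= `|a| * (e / c) by rewrite ler_wpM2l// ff'.
have h2 : `|b| * `|g x - g' x| <= `|b| * (e / c) by rewrite ler_wpM2l// gg'.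
apply: (le_trans (lerD h1 h2)); rewrite -mulrDl mulrA ler_pdivrMr// [leRHS]mulrC.
by apply: ler_wpM2r; [exact: ltW|rewrite /c; lra].
Qed.

Lemma uclosure_sub f : A f -> uclosure f.
Proof.
move=> Af; split; first exact: contA.
by move=> e e0; exists f => // x _; rewrite subrr normr0 ltW.
Qed.

Lemma uclosure_max f g : uclosure f -> uclosure g ->
  uclosure (fun x => Num.max (f x) (g x)).
Proof.
move=> Uf Ug.
have := uclosure_comb (2^-1) 1 (uclosure_comb 1 1 Uf Ug)
  (uclosure_comb 2^-1 0 (uclosure_norm (uclosure_comb 1 (-1) Uf Ug)) Uf).
congr uclosure; apply/funext => x; have [fg|gf] := leP (f x) (g x).
  by rewrite ler0_norm; lra.
by rewrite ger0_norm; lra.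
Qed.

Lemma uclosure_opp f : uclosure f -> uclosure (fun x => - f x).
Proof.
move=> Uf; have := uclosure_comb (-1) 0 Uf Uf.
by congr uclosure; apply/funext => x; lra.
Qed.

Lemma uclosure_min f g : uclosure f -> uclosure g ->
  uclosure (fun x => Num.min (f x) (g x)).
Proof.
move=> Uf Ug.
have := uclosure_opp (uclosure_max (uclosure_opp Uf) (uclosure_opp Ug)).
by congr uclosure; apply/funext => x; rewrite -oppr_min opprK.
Qed.

(* Local upper approximations of [f] are glued with finitely many minima. *)
Lemma compact_min_cover (L : set (X -> R)) (f : X -> R) :
  K !=set0 -> continuous f -> (forall g, L g -> continuous g) ->
  (forall g h, L g -> L h -> L (fun x => Num.min (g x) (h x))) ->
  (forall y, K y -> exists2 g, L g & g y < f y) ->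
  exists2 g, L g & forall z, K z -> g z < f z.
Proof.
move=> [y0 Ky0] cf cL minL Lf.
have /choice[G GP] : forall y, exists g, K y -> L g /\ g y < f y.
  move=> y; have [Ky|nKy] := pselect (K y); last by exists f.
  by have [g Lg gy] := Lf _ Ky; exists g.
have oG y : K y -> open [set z | G y z < f z].
  move=> /GP[Ly _]; rewrite (_ : mkset _ = (f - G y) @^-1` [set r | 0 < r]).
    apply: open_comp; last exact: open_gt.
    by move=> z _; apply: cvgB; [exact: cf|exact: cL].
  by apply/seteqP; split=> z /=; rewrite fctE subr_gt0.
have := cK; rewrite compact_cover => /(_ _ K (fun y => [set z | G y z < f z]) oG).
have cov : K `<=` cover K (fun y => [set z | G y z < f z]).
  by move=> z Kz; exists z => //; have [] := GP _ Kz.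
move=> /(_ cov)[D DK Dcov].
have : {in finmap.enum_fset D, forall y, K y} by move=> y /DK; rewrite inE.
suff H : forall s : seq X, {in s, forall y, K y} -> exists2 g, L g &
    forall z, K z -> (exists2 y, y \in s & G y z < f z) -> g z < f z.
  move=> /H[g Lg gP]; exists g => // z Kz; apply: gP => //.
  by have [y yD yz] := Dcov _ Kz; exists y.
elim=> [_|y s IH ys].
  by have [? _] := GP _ Ky0; exists (G y0) => // z _ [].
have [z zs|g Lg gP] := IH; first by apply: ys; rewrite inE zs orbT.
have [Ly _] := GP _ (ys y (mem_head _ _)).
exists (fun x => Num.min (G y x) (g x)); first exact: minL.
move=> z Kz [y']; rewrite inE => /predU1P[->|y's] y'z; rewrite gt_min ?y'z//.
by rewrite (gP z)// ?orbT//; exists y'.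
Qed.

(** For fixed [x], minima of functions interpolating [f] at [x] and [y] give a function equal to [f]
    at [x] and below f + e/2 on [K]; maxima of these over [x] also stay above f - e/2. *)
Theorem stone_weierstrass (f : X -> R) : continuous f ->
  (forall x y, K x -> K y -> exists2 g, A g & g x = f x /\ g y = f y) ->
  uclosure f.
Proof.
move=> cf inter; split=> // e e0.
have [K0|nK] := pselect (K !=set0); last first.
  by exists (fun=> 0) => // x Kx; exfalso; apply: nK; exists x.
have cfe c : continuous (fun z => f z + c).
  by move=> z; apply: cvgD; [exact: cf|exact: cvg_cst].
have cU g : uclosure g -> continuous g by case.
have e2 : 0 < e / 2 by rewrite divr_gt0.
have upper x : K x -> exists2 g, uclosure g &
    g x = f x /\ forall z, K z -> g z < f z + e / 2.
  move=> Kx; have [|g h [? ?] [? ?]|y Ky|g [? ?] ?] :=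
      @compact_min_cover [set g | uclosure g /\ g x = f x] _ K0 (cfe (e / 2)).
  - by move=> g [/cU].
  - by split; [exact: uclosure_min|apply/eqP; rewrite /Num.min; case: ifP => _; apply/eqP].
  - have [g Ag [gx gy]] := inter x y Kx Ky; exists g; last by rewrite gy ltrDl.
    by split=> //; exact: uclosure_sub.
  - by exists g.
have cfo : continuous (fun z => - f z + e / 2).
  by move=> z; apply: cvgD; [apply: cvgN; exact: cf|exact: cvg_cst].
(* The second pass works with negatives: minima of [g] are maxima of [- g], and the upper bound of
   the first pass is carried along. *)
have [|g h [gU gf] [hU hf]|y Ky|g [gU gf] fg] := @compact_min_cover
    [set g | uclosure (fun x => - g x) /\ forall z, K z -> - g z < f z + e / 2]
    _ K0 cfo.
- move=> g [/cU cg _]; rewrite (_ : g = fun z => - - g z).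
    by move=> x; apply: cvgN; exact: cg.
  by apply/funext => z; rewrite opprK.
- split; last by move=> z Kz; rewrite oppr_min gt_max gf// hf.
  by have := uclosure_max gU hU; congr uclosure; apply/funext => z; rewrite oppr_min.
- have [g Ug [gy gf]] := upper y Ky; exists (fun z => - g z).
    split; last by move=> z Kz; rewrite opprK gf.
    by rewrite (_ : (fun x => - - g x) = g)//; apply/funext => z; rewrite opprK.
  by rewrite gy ltrDl.
have [_ /(_ _ e2)[h Ah gh]] := gU.
exists h => // x Kx; have := gh _ Kx; have := gf _ Kx; have := fg _ Kx.
by rewrite !ler_norml; lra.
Qed.

End stone_weierstrass.

(** * Expectations of bounded random variables *)

Definition mean {d} {T : measurableType d} {R : realType}
  (P : probability T R) (f : T -> R) : R := \int[P]_t f t.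

Definition bounded_measurable {d} {T : measurableType d} {R : realType}
    (f : T -> R) : Prop :=
  measurable_fun setT f /\ exists M, forall t, `|f t| <= M.

Section mean.
Context d (T : measurableType d) (R : realType) (P : probability T R).
Implicit Types (f g : T -> R) (A : set T).

Lemma bounded_measurable_cst (c : R) : bounded_measurable (fun _ : T => c).
Proof. by split=> //; exists `|c|. Qed.

Lemma bounded_measurableD f g : bounded_measurable f -> bounded_measurable g ->
  bounded_measurable (fun t => f t + g t).
Proof.
move=> [mf [M fM]] [mg [M' gM]]; split; first exact: measurable_funD.
by exists (M + M') => t; apply: (le_trans (ler_normD _ _)); exact: lerD.
Qed.

Lemma bounded_measurableM f g : bounded_measurable f -> bounded_measurable g ->
  bounded_measurable (fun t => f t * g t).
Proof.
move=> [mf [M fM]] [mg [M' gM]]; split; first exact: measurable_funM.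
by exists (M * M') => t; rewrite normrM; apply: ler_pM.
Qed.

Lemma bounded_measurable_indic A : measurable A ->
  bounded_measurable (\1_A : T -> R).
Proof.
move=> mA; split; first exact: measurable_indic.
by exists 1 => t; rewrite indicE; case: (t \in A); rewrite ?normr1 ?normr0.
Qed.

Lemma bounded_measurable_int f : bounded_measurable f ->
  P.-integrable setT (EFin \o f).
Proof.
move=> [mf [M fM]]; apply: measurable_bounded_integrable => //.
  by apply: (le_lt_trans (probability_le1 P _)) => //; rewrite ltry.
by exists M; split; [exact: num_real|move=> x Mx t _; exact: le_trans (ltW Mx)].
Qed.

Lemma expectation_mean f : bounded_measurable f -> 'E_P[f]%E = (mean P f)%:E.
Proof.
move=> /bounded_measurable_int fi; rewrite unlock /mean /Rintegral fineK//.
exact: integrable_fin_num.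
Qed.

Lemma mean_cst c : mean P (fun=> c) = c.
Proof.
by rewrite /mean Rintegral_cst//= probability_setT mulr1.
Qed.

Lemma meanD f g : bounded_measurable f -> bounded_measurable g ->
  mean P (fun t => f t + g t) = mean P f + mean P g.
Proof. by move=> bf bg; apply: RintegralD => //; exact: bounded_measurable_int. Qed.

Lemma meanZ c f : bounded_measurable f ->
  mean P (fun t => c * f t) = c * mean P f.
Proof. by move=> bf; apply: RintegralZl => //; exact: bounded_measurable_int. Qed.

Lemma le_mean f g : bounded_measurable f -> bounded_measurable g ->
  (forall t, f t <= g t) -> mean P f <= mean P g.
Proof.
by move=> bf bg fg; apply: le_Rintegral => //; exact: bounded_measurable_int.
Qed.

Lemma mean_indic A : measurable A -> (mean P \1_A)%:E = P A.
Proof.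
move=> mA; rewrite -expectation_mean; first exact: expectation_indic.
exact: bounded_measurable_indic.
Qed.

(** Serves to compare functions that are [c]-close outside an unlikely event [A] and merely bounded
    on it. *)
Lemma mean_dist f g A c C :
  bounded_measurable f -> bounded_measurable g -> measurable A ->
  (forall t, `|f t - g t| <= c + C * \1_A t) ->
  `|mean P f - mean P g| <= c + C * fine (P A).
Proof.
move=> bf bg mA fg.
have bA := bounded_measurable_indic mA.
have bc := bounded_measurable_cst.
have bCA := bounded_measurableD (bc c) (bounded_measurableM (bc C) bA).
have mB : mean P (fun t => c + C * \1_A t) = c + C * fine (P A).
  rewrite meanD//; last exact: (bounded_measurableM (bc C)).
  by rewrite mean_cst meanZ// -mean_indic.
have fB : mean P f <= mean P g + (c + C * fine (P A)).
  rewrite -mB -meanD//; apply: le_mean => //; first exact: bounded_measurableD.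
  by move=> t; have := fg t; rewrite ler_norml; lra.
have gB : mean P g <= mean P f + (c + C * fine (P A)).
  rewrite -mB -meanD//; apply: le_mean => //; first exact: bounded_measurableD.
  by move=> t; have := fg t; rewrite ler_norml; lra.
by rewrite ler_norml; lra.
Qed.

End mean.

Section continuous_real_functions.
Context {R : realType} {T : topologicalType}.
Implicit Types f g : T -> R.

Lemma continuous_add f g : continuous f -> continuous g ->
  continuous (fun x => f x + g x).
Proof. by move=> cf cg x; exact: (cvgD (cf x) (cg x)). Qed.

Lemma continuous_mul f g : continuous f -> continuous g ->
  continuous (fun x => f x * g x).
Proof. by move=> cf cg x; exact: (cvgM (cf x) (cg x)). Qed.

Lemma continuous_cst (c : R) : continuous (fun _ : T => c).
Proof. by move=> x; exact: cvg_cst. Qed.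

Lemma continuous_compR f (h : R -> R) : continuous f -> continuous h ->
  continuous (fun x => h (f x)).
Proof. by move=> cf ch x; apply: (cvg_comp f h); [exact: cf|exact: ch]. Qed.

Lemma continuous_sum (I : finType) (F : I -> T -> R) :
  (forall i, continuous (F i)) -> continuous (fun x => \sum_i F i x).
Proof.
move=> cF; rewrite (_ : (fun _ => _) = \sum_i F i); last first.
  by apply/funext => x; rewrite fct_sumE.
by apply: (big_ind (fun f : T -> R => continuous f)) => // [|f g];
  [exact: continuous_cst|exact: continuous_add].
Qed.

End continuous_real_functions.

(** * Trigonometric polynomials and Levy's continuity theorem *)

Section trigonometric_polynomials.
Context {R : realType} {N : nat}.
Implicit Types (x y a : 'rV[R]_N).

Lemma dotDl a b x : dot (a + b) x = dot a x + dot b x.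
Proof. by rewrite /dot -big_split; apply: eq_bigr => i _; rewrite mxE mulrDl. Qed.

Lemma dotNl a x : dot (- a) x = - dot a x.
Proof. by rewrite /dot -sumrN; apply: eq_bigr => i _; rewrite mxE mulNr. Qed.

Lemma dotZl c a x : dot (c *: a) x = c * dot a x.
Proof. by rewrite /dot mulr_sumr; apply: eq_bigr => i _; rewrite mxE mulrA. Qed.

Lemma dotC a x : dot a x = dot x a.
Proof. by apply: eq_bigr => i _; rewrite mulrC. Qed.

Lemma dotDr a x y : dot a (x + y) = dot a x + dot a y.
Proof. by rewrite dotC dotDl -!(dotC a). Qed.

Lemma dotNr a x : dot a (- x) = - dot a x.
Proof. by rewrite dotC dotNl -(dotC a). Qed.

Lemma dotZr c a x : dot a (c *: x) = c * dot a x.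
Proof. by rewrite dotC dotZl -(dotC a). Qed.

Lemma dot0l x : dot 0 x = 0.
Proof. by rewrite /dot big1// => i _; rewrite mxE mul0r. Qed.

Lemma dot_delta i x : dot (delta_mx 0 i) x = x 0 i.
Proof.
rewrite /dot (bigD1 i)//= mxE !eqxx mul1r big1 ?addr0// => j ji.
by rewrite mxE (negbTE ji) andbF mul0r.
Qed.

Lemma continuous_dot a : continuous (dot a).
Proof.
apply: continuous_sum => i; apply: continuous_mul; first exact: continuous_cst.
exact: coord_continuous.
Qed.

(** With w = pi / K, all members have period 2 K in each coordinate. The phase [b] covers sines, and
    m = 0 covers constants; products come from [trig_mul]. *)
Inductive trig (w : R) : set ('rV[R]_N -> R) :=
| trig_cos c (m : 'rV[int]_N) b :
    trig w (fun x => c * cos (w * dot (map_mx intr m) x + b))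
| trig_add f g : trig w f -> trig w g -> trig w (fun x => f x + g x).

Lemma trig_cst w c : trig w (fun=> c).
Proof.
rewrite (_ : (fun=> c) = fun x => c * cos (w * dot (map_mx intr 0) x + 0)).
  exact: trig_cos.
by apply/funext => x; rewrite map_mx0 dot0l mulr0 add0r cos0 mulr1.
Qed.

Lemma cosM_sum (u v : R) : cos u * cos v = (cos (u + v) + cos (u - v)) / 2.
Proof. by rewrite cosB cosD; lra. Qed.

Lemma trig_mul w f g : trig w f -> trig w g -> trig w (fun x => f x * g x).
Proof.
move=> tf; elim=> [c m b|{}g h _ tg _ th]; last first.
  by under eq_fun do rewrite mulrDr; exact: trig_add.
elim: tf => [c' m' b'|{}f h _ tf _ th]; last first.
  by under eq_fun do rewrite mulrDl; exact: trig_add.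
rewrite (_ : (fun _ => _) = fun x =>
    (c' * c / 2) * cos (w * dot (map_mx intr (m' + m)) x + (b' + b)) +
    (c' * c / 2) * cos (w * dot (map_mx intr (m' - m)) x + (b' - b))).
  by apply: trig_add; exact: trig_cos.
apply/funext => x; rewrite map_mxD map_mxB dotDl (dotDl _ (- _)) dotNl.
set u := dot _ x; set v := dot _ x.
rewrite (_ : w * (u + v) + (b' + b) = (w * u + b') + (w * v + b)); last by lra.
rewrite (_ : w * (u - v) + (b' - b) = (w * u + b') - (w * v + b)); last by lra.
by rewrite mulrACA cosM_sum; lra.
Qed.

Lemma continuous_cos_dot a b : continuous (fun x => cos (dot a x + b)).
Proof.
apply: continuous_compR; last exact: continuous_cos.
by apply: continuous_add; [exact: continuous_dot|exact: continuous_cst].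
Qed.

Lemma trig_continuous w f : trig w f -> continuous f.
Proof.
elim=> [c m b|{}f g _ cf _ cg]; last exact: continuous_add.
apply: continuous_mul; first exact: continuous_cst.
under eq_fun do rewrite -dotZl; exact: continuous_cos_dot.
Qed.

Lemma cosD2pi_int (u : R) (k : int) : cos (u + k%:~R * (pi *+ 2)) = cos u.
Proof.
have cn (v : R) (n : nat) : cos (v + n%:R * (pi *+ 2)) = cos v.
  by rewrite mulr_natl (periodicn (@cosD2pi R)).
case: k => n; first exact: cn.
by rewrite NegzE rmorphN/= mulNr -(cn (_ - _) n.+1) subrK.
Qed.

Lemma dot_int (m k : 'rV[int]_N) : exists z : int,
  dot (map_mx intr m) (map_mx intr k) = z%:~R :> R.
Proof.
exists (\sum_i m 0 i * k 0 i); rewrite rmorph_sum/=; apply: eq_bigr => i _.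
by rewrite !mxE intrM.
Qed.

Lemma trig_periodic K f x (k : 'rV[int]_N) : K != 0 -> trig (pi / K) f ->
  f (x + (2 * K) *: map_mx intr k) = f x.
Proof.
move=> K0; elim=> [c m b|{}f g _ -> _ ->]//.
have [z zE] := dot_int m k.
have piE : pi = pi / K * K :> R by rewrite divfK.
rewrite dotDr dotZr zE (_ : _ + b =
  (pi / K * dot (map_mx intr m) x + b) + z%:~R * (pi *+ 2)) ?cosD2pi_int//.
by rewrite mulr2n; move: piE; set e := pi / K => ->; lra.
Qed.

Lemma cos_eq1 (t : R) : `|t| <= pi *+ 2 -> cos t = 1 -> t = 0 \/ `|t| = pi *+ 2.
Proof.
move=> t2 ct; have [->|t0] := eqVneq t 0; [by left|right].
apply/eqP; rewrite eq_le t2 leNgt; apply/negP => lt2.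
have s0 : 0 < sin (`|t| / 2).
  apply: sin_gt0_pi; rewrite divr_gt0 ?normr_gt0//= ltr_pdivrMr//.
  by rewrite mulr_natr.
have : cos (`|t| / 2 *+ 2) = 1 by rewrite -mulr_natr divfK// cos_norm.
rewrite cos_mulr2n cos2sin2 => h.
suff h0 : sin (`|t| / 2) ^+ 2 = 0.
  by move/eqP: h0; rewrite expf_eq0/= gt_eqF.
by move: h; rewrite mulr2n; lra.
Qed.

(* The torus obtained by identifying opposite faces of the cube is separated
   by the trigonometric polynomials; on the faces themselves [g] vanishes. *)
Lemma trig_separate (K : R) (g : 'rV[R]_N -> R) x y : 0 < K ->
  (forall z : 'rV[R]_N, (exists i, `|z 0 i| = K) -> g z = 0) ->
  (forall i, `|x 0 i| <= K) -> (forall i, `|y 0 i| <= K) ->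
  exists2 f, trig (pi / K) f & f x = g x /\ f y = g y.
Proof.
move=> K0 g0 xK yK.
have [gxy|gxy] := eqVneq (g x) (g y).
  by exists (fun=> g x); [exact: trig_cst|rewrite -gxy].
suff [f tf fxy] : exists2 f, trig (pi / K) f & f x != f y.
  (* An affine function of a separating [f] takes the prescribed values at both points. *)
  pose s := (g y - g x) / (f y - f x).
  exists (fun z => g x + s * (f z + - f x)).
    apply: trig_add; first exact: trig_cst.
    by apply: trig_mul; [|apply: trig_add => //]; exact: trig_cst.
  by rewrite subrr mulr0 addr0 divfK ?subr_eq0 1?eq_sym// addrC subrK.
apply: contrapT => nf.
have ff f : trig (pi / K) f -> f x = f y.
  by move=> tf; apply/eqP; apply/negPn/negP => fxy; apply: nf; exists f.
(* The phases 0 and -pi/2 give equal cosines and equal sines, so the angles agree modulo 2 pi;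
   within the cube this leaves equal coordinates, or opposite ones on two faces. *)
have xy i : x 0 i = y 0 i \/ `|x 0 i| = K /\ `|y 0 i| = K.
  have cE b : cos (pi / K * x 0 i + b) = cos (pi / K * y 0 i + b).
    have := ff _ (trig_cos (pi / K) 1 (delta_mx 0 i) b).
    by rewrite !mul1r map_delta_mx !dot_delta.
  have c1 : cos (pi / K * x 0 i - pi / K * y 0 i) = 1.
    have c0 := cE 0; rewrite !addr0 in c0.
    have := cE (- (pi / 2)); rewrite !cosBpihalf => s0.
    by rewrite cosB c0 s0 -!expr2 cos2Dsin2.
  have pK : 0 < pi / K by rewrite divr_gt0// pi_gt0.
  have := cos_eq1 _ c1.
  rewrite -mulrBr normrM gtr0_norm// => /(_ _)[||].
  - have : `|x 0 i - y 0 i| <= K + K.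
      by apply: (le_trans (ler_normB _ _)); exact: lerD.
    move=> /(ler_wpM2l (ltW pK)) /le_trans; apply.
    by rewrite -mulr2n mulrnAr divfK// gt_eqF.
  - move=> /eqP; rewrite mulf_eq0 gt_eqF//= subr_eq0 => /eqP; by left.
  - move=> h; right; have {h} : `|x 0 i - y 0 i| = K + K.
      apply: (mulfI (lt0r_neq0 pK)); rewrite h mulrDr divfK ?gt_eqF//.
    by move: (xK i) (yK i); case: (ler0P (x 0 i)) => ?; case: (ler0P (y 0 i)) => ?;
      case: (ler0P (x 0 i - y 0 i)) => ? ? ? ?; lra.
(* A differing coordinate puts both points on faces, where [g] vanishes, against the assumption that
   [g] separates them. *)
have [ex|nex] := pselect (exists i, x 0 i != y 0 i).
  have [i xi] := ex; have [xyi|[xi' yi']] := xy i; first by rewrite xyi eqxx in xi.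
  by move/eqP: gxy; apply; rewrite !g0//; exists i.
suff : x = y by move=> xey; rewrite xey eqxx in gxy.
apply/rowP => i; apply/eqP/negPn/negP => xi; apply: nex; by exists i.
Qed.

Lemma trig_reduce (K : R) x : 0 < K -> exists k : 'rV[int]_N,
  forall i, `|(x + (2 * K) *: map_mx intr k) 0 i| <= K.
Proof.
move=> K0; exists (\row_i - Num.floor ((x 0 i + K) / (2 * K))) => i.
rewrite !mxE; set u := (x 0 i + K) / (2 * K).
have K2 : 0 < 2 * K by rewrite mulr_gt0.
have xE : x 0 i = 2 * K * u - K by rewrite /u mulrC divfK ?addrK// gt_eqF.
have := Num.Theory.floor_itv u; rewrite intrD => /andP[lo hi].
rewrite rmorphN/= xE ler_norml; nra.
Qed.

End trigonometric_polynomials.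

Section norm_rV.
Context {R : realType} {N : nat}.

Lemma norm_rVP (x : 'rV[R]_N) M : 0 <= M ->
  `|x| <= M <-> forall i, `|x 0 i| <= M.
Proof.
move=> M0; rewrite {1}/Num.Def.normr/= mx_normrE; split=> [/bigmax_leP[_ xM] i|xM].
  exact: (xM (0, i)).
by apply/bigmax_leP; split=> // -[i j] _ /=; rewrite ord1.
Qed.

Lemma ler_coord_norm (x : 'rV[R]_N) i : `|x 0 i| <= `|x|.
Proof. by move: i; apply/norm_rVP. Qed.

Lemma compact_cube (K : R) : compact [set x : 'rV[R]_N | forall i, `|x 0 i| <= K].
Proof.
have := @rV_compact _ N (fun=> `[- K, K]%classic) (fun=> @segment_compact R _ _).
congr compact; apply/seteqP; split=> x /= xK i; have := xK i;
  by rewrite in_itv/= ler_norml.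
Qed.

End norm_rV.

Section clamp.
Context {R : realType}.
Implicit Type r : R.

(** Truncation of [r] to [0, 1], written with absolute values so that continuity follows by
    composition. *)
Definition clamp r : R := (1 + `|r| - `|r - 1|) / 2.

Lemma clamp_le0 r : r <= 0 -> clamp r = 0.
Proof. by move=> r0; rewrite /clamp !ler0_norm; lra. Qed.

Lemma clamp_ge1 r : 1 <= r -> clamp r = 1.
Proof. by move=> r1; rewrite /clamp !ger0_norm; lra. Qed.

Lemma clamp_itv r : 0 <= clamp r <= 1.
Proof.
have [r0|r0] := leP r 0; first by rewrite clamp_le0// lexx ler01.
have [r1|r1] := leP 1 r; first by rewrite clamp_ge1// lexx ler01.
by rewrite /clamp gtr0_norm// ler0_norm; lra.
Qed.

Lemma continuous_clamp : continuous clamp.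
Proof.
apply: continuous_mul; last exact: continuous_cst.
apply: continuous_add.
  by apply: continuous_add; [exact: continuous_cst|exact: norm_continuous].
apply: (@continuous_compR _ _ _ -%R); last by move=> x; apply: cvgN; exact: cvg_id.
apply: (@continuous_compR _ _ (fun r : R => r - 1) (fun r => `|r|)); last exact: norm_continuous.
by apply: continuous_add; [move=> x; exact: cvg_id|exact: continuous_cst].
Qed.

End clamp.

Section random_vector_functions.
Context d (T : measurableType d) (R : realType) (N : nat).
Variables (X : T -> 'rV[R]_N) (mX : measurable_fun setT X).

Lemma continuous_rV_measurable (f : 'rV[R]_N -> R) :
  continuous f -> measurable_fun setT (fun t => f (X t)).
Proof. by move=> cf; apply: measurableT_comp => //; exact: continuous_measurable_rV. Qed.

Lemma continuous_rV_bounded_measurable (f : 'rV[R]_N -> R) M :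
  continuous f -> (forall x, `|f x| <= M) -> bounded_measurable (fun t => f (X t)).
Proof.
by move=> cf fM; split; [exact: continuous_rV_measurable|exists M => t].
Qed.

Lemma measurable_le_fun (f g : T -> R) : measurable_fun setT f ->
  measurable_fun setT g -> measurable [set t | f t <= g t].
Proof.
move=> mf mg; have := measurable_fun_ler mf mg.
by move=> /(_ measurableT [set true]); rewrite setTI; apply.
Qed.

Lemma measurable_lt_fun (f g : T -> R) : measurable_fun setT f ->
  measurable_fun setT g -> measurable [set t | f t < g t].
Proof.
move=> mf mg; have := measurable_fun_ltr mf mg.
by move=> /(_ measurableT [set true]); rewrite setTI; apply.
Qed.

Lemma measurable_tail M : measurable [set t | M < `|X t|].
Proof.
apply: measurable_lt_fun => //; apply: continuous_rV_measurable.
by move=> x; exact: norm_continuous.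
Qed.

Lemma random_vector_tight (P : probability T R) e : 0 < e ->
  exists M, fine (P [set t | M < `|X t|]) <= e.
Proof.
move=> e0.
have : P [set t | n%:R < `|X t|] @[n --> \oo] --> P (\bigcap_n [set t | n%:R < `|X t|]).
  apply: nonincreasing_cvg_mu => //.
  - by apply: (le_lt_trans (probability_le1 P _)); rewrite ?ltry//; exact: measurable_tail.
  - by move=> n; exact: measurable_tail.
  - by apply: bigcapT_measurable => n; exact: measurable_tail.
  - move=> m n mn; apply/subsetPset => t /=; apply: le_lt_trans; by rewrite ler_nat.
rewrite (_ : \bigcap_n _ = set0).
  rewrite measure0 => /fine_cvgP[_ /cvgr0Pnorm_le/(_ _ e0)[n _ nP]].
  exists n%:R; apply: le_trans (nP n (leqnn n)).
  exact: ler_norm.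
rewrite -subset0 => t /(_ (Num.truncn `|X t|).+1 I)/=.
by rewrite ltNge ltW// truncnS_gt.
Qed.

End random_vector_functions.

Section levy_continuity.
Context d (T : measurableType d) d' (T' : measurableType d') (R : realType) (N : nat).
Variables (P : probability T R) (Q : probability T' R).
Variables (X : nat -> T -> 'rV[R]_N) (Y : T' -> 'rV[R]_N).
Hypothesis mX : forall n, measurable_fun setT (X n).
Hypothesis mY : measurable_fun setT Y.
Hypothesis cosXY : forall a b,
  mean P (fun t => cos (dot a (X n t) + b)) @[n --> \oo] -->
  mean Q (fun t => cos (dot a (Y t) + b)).
Hypothesis tightX : forall e, 0 < e ->
  exists M, \forall n \near \oo, fine (P [set t | M < `|X n t|]) <= e.

Lemma trig_bounded w f : trig w f -> exists M, forall x : 'rV[R]_N, `|f x| <= M.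
Proof.
elim=> [c m b|{}f g _ [M fM] _ [M' gM]].
  exists `|c| => x; rewrite normrM ler_piMr//; exact: cos_max.
by exists (M + M') => x; apply: (le_trans (ler_normD _ _)); exact: lerD.
Qed.

Lemma trig_mean_cvg w f : trig w f ->
  mean P (fun t => f (X n t)) @[n --> \oo] --> mean Q (fun t => f (Y t)).
Proof.
have bm d0 (T0 : measurableType d0) (Z : T0 -> 'rV[R]_N) (h : 'rV[R]_N -> R) :
    measurable_fun setT Z -> trig w h -> bounded_measurable (fun t => h (Z t)).
  move=> mZ th; have [M hM] := trig_bounded th.
  exact: (continuous_rV_bounded_measurable mZ (trig_continuous th) hM).
elim=> [c m b|{}f g tf cf tg cg].
  have t1 := trig_cos w 1 m b.
  have mc d0 (T0 : measurableType d0) (P0 : probability T0 R) (Z : T0 -> 'rV[R]_N) :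
      measurable_fun setT Z ->
      mean P0 (fun t => c * cos (w * dot (map_mx intr m) (Z t) + b)) =
      c * mean P0 (fun t => cos (dot (w *: map_mx intr m) (Z t) + b)).
    move=> mZ; rewrite -meanZ; first by congr mean; apply/funext => t; rewrite dotZl.
    have := bm _ _ _ _ mZ t1.
    by congr bounded_measurable; apply/funext => t; rewrite mul1r dotZl.
  rewrite mc//; under eq_fun do rewrite mc//.
  by apply: cvgM; [exact: cvg_cst|exact: cosXY].
rewrite meanD; [|exact: bm..].
under eq_fun do (rewrite meanD; [|exact: bm..]).
exact: cvgD.
Qed.

(** The approximant [T0] is periodic, hence bounded on the whole space by its values on the cube.
    Algebraic polynomials would not be; this is what lets tightness control the region outside the
    cube. *)
Theorem cvg_in_distribution_charfun : cvg_in_distribution P Q X Y.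
Proof.
move=> f cf [M' fM'].
pose M := `|M'| + 1; have M0 : 0 < M by rewrite ltr_wpDl.
have fM x : `|f x| <= M.
  by apply: (le_trans (fM' x)); rewrite /M; have := ler_norm M'; lra.
have bf d0 (T0 : measurableType d0) (Z : T0 -> 'rV[R]_N) :
    measurable_fun setT Z -> bounded_measurable (f \o Z).
  by move=> mZ; exact: (continuous_rV_bounded_measurable mZ cf fM).
rewrite expectation_mean; last exact: bf.
under eq_fun do (rewrite expectation_mean; last exact: bf).
apply: cvg_EFin; first exact: nearW.
apply/cvgrPdist_le => e e0.
pose e1 := e / 8; have e10 : 0 < e1 by rewrite divr_gt0.
(* [C] bounds |f - T0| everywhere, as |f| <= M and |T0| <= M + e1; the tails are then chosen so that
   C times their probability is at most [e1]. *)
pose C := 2 * M + e1; have C0 : 0 < C by rewrite addr_gt0// mulr_gt0.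
have [MX tX] := tightX (divr_gt0 e10 C0).
have [MY tY] := random_vector_tight mY Q (divr_gt0 e10 C0).
pose K0 := Num.max 0 (Num.max MX MY).
pose K := K0 + 1.
have K00 : 0 <= K0 by rewrite le_max lexx.
have K_gt0 : 0 < K by rewrite ltr_wpDl.
have Kn0 : K != 0 by rewrite gt_eqF.
(* Equal to [f] where |x| <= K0, and zero on the faces |x| = K because K = K0 + 1, so that [g] is
   well defined on the torus. *)
pose g (x : 'rV[R]_N) := f x * clamp (K - `|x|).
have cg : continuous g.
  apply: continuous_mul => //; apply: (@continuous_compR _ _ (fun x : 'rV[R]_N => K - `|x|)); last exact: continuous_clamp.
  apply: continuous_add; first exact: continuous_cst.
  apply: (@continuous_compR _ _ (fun x : 'rV[R]_N => `|x|) -%R); first by move=> x; exact: norm_continuous.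
  by move=> x; apply: cvgN; exact: cvg_id.
have g_faces (z : 'rV[R]_N) : (exists i, `|z 0 i| = K) -> g z = 0.
  move=> [i zi]; rewrite /g clamp_le0 ?mulr0// subr_le0 -zi.
  exact: ler_coord_norm.
have [_ /(_ _ e10)[T0 tT0 gT0]] := stone_weierstrass
  (@compact_cube R N K) (@trig_continuous R N (pi / K)) (@trig_cst R N (pi / K))
  (@trig_add R N (pi / K)) (@trig_mul R N (pi / K)) cg
  (fun x y xK yK => trig_separate K_gt0 g_faces xK yK).
have gM x : `|g x| <= M.
  rewrite /g normrM; have /andP[c0 c1] := clamp_itv (K - `|x|).
  rewrite [X in _ * X]ger0_norm//; apply: le_trans (fM x).
  by rewrite ler_piMr.
have T0M x : `|T0 x| <= M + e1.
  have [k kK] := trig_reduce x K_gt0.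
  rewrite -(trig_periodic x k Kn0 tT0).
  have := gT0 _ kK; have := gM (x + 2 * K *: map_mx intr k).
  by rewrite !ler_norml; lra.
have approx d0 (S : measurableType d0) (P0 : probability S R) (Z : S -> 'rV[R]_N) :
    measurable_fun setT Z -> fine (P0 [set t | K0 < `|Z t|]) <= e1 / C ->
    `|mean P0 (f \o Z) - mean P0 (fun t => T0 (Z t))| <= e / 4.
  move=> mZ tZ.
  have bT : bounded_measurable (fun t => T0 (Z t)).
    exact: (continuous_rV_bounded_measurable mZ (trig_continuous tT0) T0M).
  have mA := measurable_tail mZ K0.
  have := @mean_dist _ _ _ P0 _ _ _ e1 C (bf _ _ _ mZ) bT mA.
  move=> /(_ _)/le_trans; apply.
    move=> t /=; rewrite indicE; have [Zt|Zt] := leP `|Z t| K0.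
      have Ztf : f (Z t) = g (Z t) by rewrite /g clamp_ge1 ?mulr1// /K; lra.
      rewrite Ztf memNset ?mulr0 ?addr0; last by rewrite /= ltNge Zt.
      apply: gT0 => i; apply: (le_trans _ (_ : K0 <= K)); last by rewrite lerDl.
      exact: le_trans (ler_coord_norm _ _) Zt.
    rewrite mem_set//= mulr1; have := fM (Z t); have := T0M (Z t).
    by rewrite /C !ler_norml; lra.
  have : C * fine (P0 [set t | K0 < `|Z t|]) <= e1.
    by rewrite -ler_pdivlMl// mulrC.
  by rewrite /e1; lra.
have tail_mono d0 (S : measurableType d0) (P0 : probability S R) (Z : S -> 'rV[R]_N) L :
    measurable_fun setT Z -> L <= K0 -> fine (P0 [set t | L < `|Z t|]) <= e1 / C ->
    fine (P0 [set t | K0 < `|Z t|]) <= e1 / C.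
  move=> mZ LK; apply: le_trans; apply: fine_le.
  - by apply: fin_num_measure; exact: measurable_tail.
  - by apply: fin_num_measure; exact: measurable_tail.
  - apply: le_measure; rewrite ?inE; [exact: measurable_tail..|].
    by move=> t /=; exact: le_lt_trans.
have MXK : MX <= K0 by rewrite !le_max lexx orbT.
have MYK : MY <= K0 by rewrite !le_max lexx !orbT.
have aY := approx _ _ _ _ mY (tail_mono _ _ _ _ _ mY MYK tY).
have e40 : 0 < e / 4 by rewrite divr_gt0.
have /cvgrPdist_le/(_ _ e40) cT := trig_mean_cvg tT0.
near=> n.
have aX : `|mean P (f \o X n) - mean P (fun t => T0 (X n t))| <= e / 4.
  apply: approx => //; apply: (tail_mono _ _ _ _ MX) => //; by near: n.
have aT : `|mean Q (fun t => T0 (Y t)) - mean P (fun t => T0 (X n t))| <= e / 4.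
  by near: n.
move: aX aT aY; rewrite /= !ler_norml; lra.
Unshelve. all: by end_near. Qed.

End levy_continuity.

(** * Gaussian vectors *)

Section normal_moments.
Context {R : realType}.
Local Notation mu := (@lebesgue_measure R).
Implicit Types s x t b : R.

(** The Radon-Nikodym derivative is determined only almost everywhere; equality of integrals over
    all measurable sets identifies it with [normal_pdf]. *)
Lemma integral_normal_prob m s (f : R -> R) :
  measurable_fun setT f -> (normal_prob m s).-integrable setT (EFin \o f) ->
  (\int[normal_prob m s]_x (f x)%:E = \int[mu]_x (f x * normal_pdf m s x)%:E)%E.
Proof.
move=> mf intf.
rewrite -(Radon_Nikodym_change_of_variables (normal_prob_dominates m s))//=.
apply: ae_eq_integral => //.
- apply: emeasurable_funM; first exact/measurable_EFinP.
  apply: (measurable_int mu).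
  by apply: Radon_Nikodym_integrable; exact: normal_prob_dominates.
- by apply/measurable_EFinP; apply: measurable_funM => //; exact: measurable_normal_pdf.
under [X in ae_eq _ _ _ X]eq_fun do rewrite EFinM.
apply: ae_eqe_mul2l => /=.
rewrite Radon_NikodymE//=; first exact: normal_prob_dominates.
move=> dom; case: cid => /= h [h1 h2 h3].
apply: integral_ae_eq => //=.
- by apply/measurable_EFinP; exact: measurable_normal_pdf.
- by move=> E _ mE; rewrite -h3.
Qed.

Lemma normal_pdf0E s x : s != 0 ->
  normal_pdf 0 s x = normal_peak s * expR (- x ^+ 2 / (s ^+ 2 *+ 2)).
Proof. by move=> s0; rewrite normal_pdfE// /normal_fun subr0. Qed.

(* Half of the Gaussian exponent absorbs the polynomial factor. *)
Lemma sqr_normal_pdf_le s x : s != 0 ->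
  x ^+ 2 * normal_pdf 0 s x <= 8 * s ^+ 2 * normal_pdf 0 (Num.sqrt 2 * s) x.
Proof.
move=> s0; have s20 : Num.sqrt 2 * s != 0 by rewrite mulf_neq0// gt_eqF// sqrtr_gt0.
have ss0 : 0 < s ^+ 2 by rewrite exprn_even_gt0.
rewrite !normal_pdf0E// exprMn sqr_sqrtr//.
set u := x ^+ 2 / (4 * s ^+ 2).
have u0 : 0 <= u by rewrite divr_ge0 ?sqr_ge0// mulr_ge0// ltW.
have -> : - x ^+ 2 / (2 * s ^+ 2 *+ 2) = - u.
  by rewrite mulNr /u; congr (- (_ / _)); lra.
have -> : - x ^+ 2 / (s ^+ 2 *+ 2) = - u + - u.
  by rewrite /u -[s ^+ 2 *+ 2]mulr_natl !invfM; lra.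
have xu : x ^+ 2 = 4 * s ^+ 2 * u by rewrite /u mulrC divfK// gt_eqF// mulr_gt0.
have peak2 : normal_peak s <= 2 * normal_peak (Num.sqrt 2 * s).
  rewrite /normal_peak exprMn sqr_sqrtr//.
  set a := s ^+ 2 * pi *+ 2; have a0 : 0 < a by rewrite pmulrn_lgt0// mulr_gt0// pi_gt0.
  have -> : 2 * s ^+ 2 * pi *+ 2 = 2 * a by rewrite /a; lra.
  rewrite sqrtrM// invfM mulrA ler_peMl ?invr_ge0 ?sqrtr_ge0//.
  rewrite ler_pdivlMr ?sqrtr_gt0// mul1r.
  rewrite -[leRHS]ger0_norm// -sqrtr_sqr ler_sqrt//; lra.
have e1 : u * expR (- u) <= 1.
  rewrite expRN ler_pdivrMr ?expR_gt0// mul1r.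
  by apply: le_trans (expR_ge1Dx u); lra.
have eu0 := expR_ge0 (- u); have p0 := normal_peak_ge0 s.
rewrite expRD xu; set e := expR (- u) in e1 eu0 *.
have h1 : s ^+ 2 * (u * e) <= s ^+ 2 by rewrite ler_piMr// ltW.
have pe0 : 0 <= normal_peak s * e by rewrite mulr_ge0.
have h2 : (normal_peak s * e) * (s ^+ 2 * (u * e)) <= (normal_peak s * e) * s ^+ 2.
  by rewrite ler_wpM2l.
have h3 : normal_peak s * (e * s ^+ 2) <= 2 * normal_peak (Num.sqrt 2 * s) * (e * s ^+ 2).
  by rewrite ler_wpM2r// mulr_ge0// ltW.
lra.
Qed.

Lemma measurable_sqr_pdf s : measurable_fun setT (fun x => x ^+ 2 * normal_pdf 0 s x).
Proof. by apply: measurable_funM => //; exact: measurable_normal_pdf. Qed.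

(** The exact constant is 1. The value 8 comes from the comparison with the density of standard
    deviation sqrt 2 * s, and suffices for tightness and for domination under the integral. *)
Lemma integral_sqr_normal_pdf s : s != 0 ->
  (\int[mu]_x (x ^+ 2 * normal_pdf 0 s x)%:E <= (8 * s ^+ 2)%:E)%E.
Proof.
move=> s0; apply: (@le_trans _ _
    (\int[mu]_x (8 * s ^+ 2 * normal_pdf 0 (Num.sqrt 2 * s) x)%:E)%E).
  apply: ge0_le_integral => //.
  - by move=> x _; rewrite lee_fin mulr_ge0 ?sqr_ge0 ?normal_pdf_ge0.
  - by apply/measurable_EFinP; exact: measurable_sqr_pdf.
  - by apply/measurable_EFinP; apply: measurable_funM => //; exact: measurable_normal_pdf.
  - by move=> x _; rewrite lee_fin sqr_normal_pdf_le.
under eq_integral do rewrite EFinM.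
rewrite integralZl//; last exact: integrable_normal_pdf.
by rewrite integral_normal_pdf mule1.
Qed.

Lemma integrable_sqr_normal_pdf s : s != 0 ->
  mu.-integrable setT (fun x => (x ^+ 2 * normal_pdf 0 s x)%:E).
Proof.
move=> s0; apply/integrableP; split.
  by apply/measurable_EFinP; exact: measurable_sqr_pdf.
under eq_integral => x _.
  rewrite gee0_abs; last by rewrite lee_fin mulr_ge0 ?sqr_ge0 ?normal_pdf_ge0.
  over.
by apply: (le_lt_trans (integral_sqr_normal_pdf s0)); rewrite ltry.
Qed.

Lemma integrable_norm_normal_pdf s : s != 0 ->
  mu.-integrable setT (fun x => (`|x| * normal_pdf 0 s x)%:E).
Proof.
move=> s0; apply: (le_integrable _ _ _
  (integrableD measurableT (integrable_sqr_normal_pdf s0) (integrable_normal_pdf 0 s))) => //.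
  apply/measurable_EFinP; apply: measurable_funM; last exact: measurable_normal_pdf.
  by apply: continuous_measurable_fun; exact: norm_continuous.
move=> x _; rewrite -EFinD !abse_EFin !lee_fin.
have g0 := normal_pdf_ge0 0 s x; have a0 := normr_ge0 x; have c0 := sqr_ge0 x.
have ac : `|x| <= x ^+ 2 + 1.
  by rewrite -[x ^+ 2]ger0_norm ?sqr_ge0// normrX; have := sqr_ge0 (`|x| - 1); nra.
rewrite ger0_norm ?mulr_ge0// ger0_norm; last by rewrite addr_ge0// mulr_ge0.
by have := ler_wpM2r g0 ac; lra.
Qed.

Lemma normal_prob_tail s M : 0 < M -> s != 0 ->
  (normal_prob 0 s [set x | (M < `|x|)%R] <= (8 * s ^+ 2 / M ^+ 2)%:E)%E.
Proof.
move=> M0 s0; rewrite /normal_prob.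
have mA : measurable [set x : R | (M < `|x|)%R].
  apply: (@measurable_lt_fun _ (measurableTypeR R) R (fun=> M) (fun x => `|x|)) => //.
  by apply: continuous_measurable_fun; exact: norm_continuous.
have MM : 0 < M ^+ 2 by rewrite exprn_gt0.
apply: (@le_trans _ _ (\int[mu]_(x in [set x : R | (M < `|x|)%R])
    ((M ^+ 2)^-1 * (x ^+ 2 * normal_pdf 0 s x))%:E)%E).
  apply: ge0_le_integral => //.
  - by move=> x _; rewrite lee_fin normal_pdf_ge0.
  - by apply/measurable_EFinP; apply: measurable_funTS; exact: measurable_normal_pdf.
  - apply/measurable_EFinP; apply: measurable_funTS; apply: measurable_funM => //.
    exact: measurable_sqr_pdf.
  - move=> x /= Mx; rewrite lee_fin mulrA ler_peMl ?normal_pdf_ge0//.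
    rewrite ler_pdivlMl// mulr1 -[leRHS]ger0_norm ?sqr_ge0// normrX.
    by apply: lerXn2r; rewrite ?nnegrE ?normr_ge0// ltW.
apply: (@le_trans _ _ (\int[mu]_x ((M ^+ 2)^-1 * (x ^+ 2 * normal_pdf 0 s x))%:E)%E).
  apply: ge0_subset_integral => //.
  - apply/measurable_EFinP; apply: measurable_funM => //; exact: measurable_sqr_pdf.
  - by move=> x _; rewrite lee_fin mulr_ge0 ?invr_ge0 ?sqr_ge0// mulr_ge0 ?sqr_ge0 ?normal_pdf_ge0.
under eq_integral do rewrite EFinM.
rewrite integralZl//; last exact: integrable_sqr_normal_pdf.
rewrite [X in (_ <= X%:E)%E]mulrC EFinM lee_pmul2l ?lte_fin ?invr_gt0//.
exact: integral_sqr_normal_pdf.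
Qed.

End normal_moments.

(** * The characteristic function of the normal law *)

Section integral_of_derivative.
Context {R : realType}.
Local Notation mu := (@lebesgue_measure R).

Lemma is_derive_ext (f h : R -> R) (x a b : R) :
  is_derive x 1 f a -> f =1 h -> a = b -> is_derive x 1 h b.
Proof. by move=> df /funext <- <-. Qed.

(** The fundamental theorem of calculus on [-n, n] gives h(n) - h(-n), and dominated convergence
    passes to the whole line. *)
Lemma Rintegral_derivative_eq0 (h h' : R -> R) :
  continuous h' -> (forall x : R, is_derive x 1 h (h' x)) ->
  mu.-integrable setT (EFin \o h') ->
  h n%:R @[n --> \oo] --> 0 -> h (- n%:R) @[n --> \oo] --> 0 ->
  \int[mu]_x h' x = 0.
Proof.
move=> ch' dh ih' hy hNy.
pose I n : set R := `[- n%:R, n%:R]%classic.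
have FTC (n : nat) : (0 < n)%N ->
    (\int[mu]_(x in I n) (h' x)%:E = (h n%:R - h (- n%:R))%:E)%E.
  move=> n0; rewrite EFinB (@continuous_FTC2 _ h' h)//.
  - by rewrite gtrN// ltr0n.
  - exact: continuous_subspaceT.
  - have ch : continuous h.
      by move=> x; apply/differentiable_continuous/derivable1_diffP; have [] := dh x.
    by split=> [x _||]; [have [] := dh x
      |exact: cvg_at_right_filter (ch _)|exact: cvg_at_left_filter (ch _)].
  - by move=> x _; rewrite derive1E; have [_] := dh x.
pose J n := (\int[mu]_x ((h' \_ (I n)) x)%:E)%E.
have cv : J @ \oo --> (\int[mu]_x (h' x)%:E)%E.
  apply: (@dominated_cvg _ _ _ mu _ measurableT
      (fun n x => ((h' \_ (I n)) x)%:E) _ (abse \o (EFin \o h'))) => //=.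
  - move=> n; apply/measurable_EFinP.
    have mI : measurable (I n) by exact: measurable_itv.
    apply: (@measurable_restrictT _ _ _ _ (I n) h' mI).1.
    by apply: measurable_funTS; exact: continuous_measurable_fun.
  - move=> x _; apply: cvg_near_cst; near=> n.
    rewrite patchE mem_set//= /I/= in_itv/= -ler_norml.
    by near: n; exact: nbhs_infty_ger.
  - exact: integrable_abse.
  - move=> n x _; rewrite patchE; case: ifPn => _ //.
    by rewrite normr0 lee_fin.
have /cvg_lim lim0 : J @ \oo --> 0%E.
  have : (h n%:R - h (- n%:R))%:E @[n --> \oo] --> 0%E.
    apply: cvg_EFin; first exact: nearW.
    rewrite -[0]subr0; exact: (cvgB hy hNy).
  apply: cvg_trans; apply: near_eq_cvg; near=> n.
  rewrite -FTC; last by near: n; exact: nbhs_infty_gt.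
  by rewrite integral_mkcond; apply: eq_integral => x _; rewrite restrict_EFin.
by rewrite /Rintegral -(cvg_lim _ cv)// lim0.
Unshelve. all: by end_near. Qed.

End integral_of_derivative.

Section normal_charfun.
Context {R : realType}.
Local Notation mu := (@lebesgue_measure R).
Variables (s : R) (s0 : s != 0).
Local Notation g := (normal_pdf 0 s).

Let integrable_bounded_mul (f w : R -> R) (w0 : forall x, 0 <= w x) :
  measurable_fun setT f -> (forall x, `|f x| <= 1) ->
  mu.-integrable setT (EFin \o w) ->
  mu.-integrable setT (EFin \o (fun x => f x * w x)).
Proof.
move=> mf f1 iw; apply: (le_integrable _ _ _ iw) => //.
  apply/measurable_EFinP; apply: measurable_funM => //.
  by apply/measurable_EFinP; exact: (measurable_int mu).
move=> x _; rewrite lee_fin normrM ler_piMl//.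
Qed.

Lemma is_derive_normal_pdf (x : R) : is_derive x 1 g (- (x / s ^+ 2) * g x).
Proof.
have ss0 : s ^+ 2 != 0 by rewrite expf_neq0.
rewrite (_ : g = fun x => normal_peak s * expR (- x ^+ 2 / (s ^+ 2 *+ 2))); last first.
  by apply/funext => y; rewrite normal_pdf0E.
pose c := (s ^+ 2 *+ 2)^-1.
have dq : is_derive x 1 (fun x => - x ^+ 2 * c) (- (x / s ^+ 2)).
  rewrite (_ : (fun x => _) = (- c) \*: ((@id R) ^+ 2)); last first.
    apply/funext => y; rewrite /GRing.scale/= (_ : ((@id R) ^+ 2) y = y ^+ 2)//.
    by rewrite mulNr mulrC -mulNr.
  apply: trigger_derive; rewrite /GRing.scale/= expr1 /c -mulr_natl invfM; lra.
apply: (is_derive_ext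
  (is_deriveZ (normal_peak s) (is_derive1_comp (is_derive_expR _) dq))) => //.
by rewrite /GRing.scale/= /c; lra.
Qed.

Let F b t := \int[mu]_x (cos (t * x + b) * g x).

Let is_derive_lin (a b x : R) : is_derive x 1 (fun x => a * x + b) a.
Proof.
rewrite (_ : (fun x => _) = a \*: (@id R) + cst b); last exact/funext.
by apply: trigger_derive; rewrite /GRing.scale/= mulr1 addr0.
Qed.

Let measurable_cos_lin a b : measurable_fun setT (fun x : R => cos (a * x + b)).
Proof.
apply: measurableT_comp; first exact: (continuous_measurable_fun (@continuous_cos R)).
exact: measurable_funD.
Qed.

Let measurable_sin_lin a b : measurable_fun setT (fun x : R => sin (a * x + b)).
Proof.
apply: measurableT_comp; first exact: (continuous_measurable_fun (@continuous_sin R)).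
exact: measurable_funD.
Qed.

Let int_cos b t : mu.-integrable setT (EFin \o (fun x => cos (t * x + b) * g x)).
Proof.
apply: integrable_bounded_mul.
- by move=> x; exact: normal_pdf_ge0.
- exact: measurable_cos_lin.
- by move=> x; exact: cos_max.
- exact: integrable_normal_pdf.
Qed.

Let int_xsin b t :
  mu.-integrable setT (EFin \o (fun x => x * sin (t * x + b) * g x)).
Proof.
apply: (le_integrable _ _ _ (integrable_norm_normal_pdf s0)) => //.
  apply/measurable_EFinP; apply: measurable_funM; last exact: measurable_normal_pdf.
  by apply: measurable_funM => //; exact: measurable_sin_lin.
move=> x _; rewrite !abse_EFin lee_fin !normrM normr_id.
rewrite ler_wpM2r//; rewrite ler_piMr//; exact: sin_max.
Qed.

Let d1cos b (t x : R) : partial1of2 (fun t x => cos (t * x + b) * g x) t x =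
  - (x * sin (t * x + b) * g x).
Proof.
rewrite partial1of2E.
have d : is_derive t 1 (fun t => cos (t * x + b) * g x) (- (x * sin (t * x + b) * g x)).
  rewrite (_ : (fun t => _) = g x \*: (cos \o (fun t => x * t + b))); last first.
    by apply/funext => u; rewrite mulrC [u * x]mulrC.
  apply: trigger_derive; rewrite /GRing.scale/= [t * x]mulrC; lra.
by have [_] := d.
Qed.

Let is_derive_F b (t : R) :
  is_derive t 1 (F b) (- \int[mu]_x (x * sin (t * x + b) * g x)).
Proof.
pose f (t x : R) := cos (t * x + b) * g x.
have It : `]t - 1, t + 1[%classic t by rewrite /= in_itv/=; apply/andP; split; lra.
have intf (y : R) : `]t - 1, t + 1[%classic y -> mu.-integrable setT (EFin \o f y).
  by move=> _; exact: int_cos.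
have derf (y x : R) : `]t - 1, t + 1[%classic y -> setT x -> derivable (f ^~ x) y 1.
  move=> _ _; rewrite (_ : f ^~ x = g x \*: (cos \o (fun t => x * t + b))).
    by have [] := is_deriveZ (g x)
      (@is_derive1_comp _ _ (fun t => x * t + b) y _ _ (is_derive_cos _)
        (is_derive_lin x b y)).
  by apply/funext => u; rewrite /f mulrC [u * x]mulrC.
have Gub (y x : R) : `]t - 1, t + 1[%classic y -> setT x ->
    `|partial1of2 f y x| <= `|x| * g x.
  move=> _ _; rewrite d1cos normrN !normrM [`|g x|]ger0_norm ?normal_pdf_ge0//.
  by rewrite ler_wpM2r ?normal_pdf_ge0// ler_piMr//; exact: sin_max.
have G0 (x : R) : 0 <= `|x| * g x by rewrite mulr_ge0// normal_pdf_ge0.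
have iG := integrable_norm_normal_pdf s0.
apply: DeriveDef.
  exact: (derivable_under_integral measurableT It intf derf G0 iG Gub).
rewrite -derive1E (differentiation_under_integral measurableT It intf derf G0 iG Gub).
rewrite -mulN1r -(@RintegralZl _ _ _ mu setT _ (-1) measurableT (int_xsin b t)).
by apply: eq_Rintegral => x _; rewrite -/(partial1of2 f t x) d1cos mulN1r.
Qed.

Let cvg_pdf : g n%:R @[n --> \oo] --> 0.
Proof.
pose C := 8 * s ^+ 2 * normal_peak (Num.sqrt 2 * s).
have s20 : Num.sqrt 2 * s != 0 by rewrite mulf_neq0// gt_eqF// sqrtr_gt0.
apply: (@squeeze_cvgr _ _ _ _ (cst 0) (fun n => C * n%:R^-1)).
- near=> n; rewrite normal_pdf_ge0/=.
  have n1 : 1 <= n%:R :> R by near: n; exact: nbhs_infty_ger.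
  have n0 : 0 < n%:R :> R by exact: lt_le_trans n1.
  rewrite ler_pdivlMr//; apply: le_trans (_ : n%:R ^+ 2 * g n%:R <= _).
    rewrite mulrC expr2 -mulrA ler_peMl// mulr_ge0 ?normal_pdf_ge0// ltW//.
  apply: (le_trans (sqr_normal_pdf_le n%:R s0)).
  by rewrite ler_wpM2l ?normal_pdf_ub// mulr_ge0// sqr_ge0.
- exact: cvg_cst.
- rewrite -[X in _ --> X](mulr0 C); apply: cvgM; first exact: cvg_cst.
  by apply/gtr0_cvgV0; [near=> n; rewrite ltr0n; near: n; exact: nbhs_infty_gt|exact: cvgr_idn].
Unshelve. all: by end_near. Qed.

Let pdfN x : g (- x) = g x.
Proof. by rewrite !normal_pdf0E// sqrrN. Qed.

(** Stein's identity: sin(t x + b) g(x) vanishes at infinity, so its derivative, which contains g' =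
    -(x/s^2) g, integrates to 0. *)
Let stein b t : \int[mu]_x (x * sin (t * x + b) * g x) = s ^+ 2 * t * F b t.
Proof.
have ss0 : s ^+ 2 != 0 by rewrite expf_neq0.
pose h' x := t * (cos (t * x + b) * g x) + (- (s ^+ 2)^-1) * (x * sin (t * x + b) * g x).
have dh (x : R) : is_derive x 1 (fun x => sin (t * x + b) * g x) (h' x).
  apply: (is_derive_ext (is_deriveM
    (@is_derive1_comp _ _ (fun x => t * x + b) x _ _ (is_derive_sin _)
      (is_derive_lin t b x))
    (is_derive_normal_pdf x))) => //.
  by rewrite /GRing.scale/= /h'; lra.
have cg : continuous g by exact: continuous_normal_pdf.
have cl : continuous (fun x => t * x + b).
  apply: continuous_add; last exact: continuous_cst.
  by apply: continuous_mul; [exact: continuous_cst|move=> x; exact: cvg_id].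
have ch' : continuous h'.
  apply: continuous_add; apply: continuous_mul; try exact: continuous_cst.
    by apply: continuous_mul => //; apply: continuous_compR => //; exact: continuous_cos.
  apply: continuous_mul => //; apply: continuous_mul; first by move=> x; exact: cvg_id.
  by apply: continuous_compR => //; exact: continuous_sin.
have ih' : mu.-integrable setT (EFin \o h').
  have -> : EFin \o h' = (fun x => (t%:E * (cos (t * x + b) * g x)%:E +
    (- (s ^+ 2)^-1)%:E * (x * sin (t * x + b) * g x)%:E)%E) by exact/funext.
  by apply: integrableD => //; apply: integrableZl => //; [exact: int_cos|exact: int_xsin].
have bd (u : nat -> R) : g (u n) @[n --> \oo] --> 0 ->
    sin (t * u n + b) * g (u n) @[n --> \oo] --> 0.
  move=> gu; apply/cvgr0Pnorm_le => e e0.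
  move/cvgr0Pnorm_le : gu => /(_ _ e0); apply: filterS => n; apply: le_trans.
  by rewrite normrM ler_piMl//; exact: sin_max.
have := Rintegral_derivative_eq0 ch' dh ih' (bd _ cvg_pdf) _.
move=> /(_ _)H; have {}H := H ltac:(by apply: bd; under eq_fun do rewrite pdfN; exact: cvg_pdf).
move: H; rewrite /h' RintegralD//; last 2 first.
- by apply: (integrableZl measurableT t (int_cos b t)).
- by apply: (integrableZl measurableT (- (s ^+ 2)^-1) (int_xsin b t)).
rewrite (@RintegralZl _ _ _ mu setT _ t measurableT (int_cos b t)).
rewrite (@RintegralZl _ _ _ mu setT _ (- (s ^+ 2)^-1) measurableT (int_xsin b t)).
rewrite -/(F b t); set I := \int[mu]_x _ => H.
have : s ^+ 2 * (t * F b t + - (s ^+ 2)^-1 * I) = 0 by rewrite H mulr0.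
rewrite mulrDr mulNr mulrN mulrA mulrA mulfV// mul1r => /eqP.
by rewrite subr_eq0 => /eqP <-.
Qed.

(** Differentiating [F] under the integral and applying [stein] gives F' = -s^2 t F, so F(t) exp((s
    t)^2/2) is constant; at t = 0 it equals cos b. *)
Lemma mean_cos_normal_prob t b :
  mean (normal_prob 0 s) (fun x => cos (t * x + b)) = cos b * expR (- (s * t) ^+ 2 / 2).
Proof.
have mE : mean (normal_prob 0 s) (fun x => cos (t * x + b)) = F b t.
  rewrite /mean /Rintegral integral_normal_prob//.
  apply: bounded_measurable_int; split; first exact: measurable_cos_lin.
  by exists 1 => x; exact: cos_max.
rewrite mE.
have F0 : F b 0 = cos b.
  rewrite /F; under eq_Rintegral do rewrite mul0r add0r.
  rewrite RintegralZl//; last exact: integrable_normal_pdf.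
  by rewrite /Rintegral integral_normal_pdf mulr1.
pose H (u : R) := F b u * expR ((s * u) ^+ 2 / 2).
have dH (u : R) : is_derive u 1 H 0.
  have dF := is_derive_F b u; rewrite stein in dF.
  have dq : is_derive u 1 (fun u => (s * u) ^+ 2 / 2) (s ^+ 2 * u).
    rewrite (_ : (fun u => _) = (s ^+ 2 / 2) \*: ((@id R) ^+ 2)); last first.
      apply/funext => y; rewrite /GRing.scale/= (_ : ((@id R) ^+ 2) y = y ^+ 2)//.
      by rewrite exprMn mulrAC.
    by apply: trigger_derive; rewrite /GRing.scale/= expr1; lra.
  apply: (is_derive_ext (is_deriveM dF (is_derive1_comp (is_derive_expR _) dq))) => //.
  by rewrite /GRing.scale/=; lra.
have := is_derive_0_is_cst t 0 dH.
rewrite /H mulr0 expr0n/= mul0r expR0 mulr1 F0 => <-.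
by rewrite -mulrA -expRD mulNr subrr expR0 mulr1.
Qed.

End normal_charfun.

(** * Laws, independence and Gaussian vectors *)

Section laws.
Context d (T : measurableType d) (R : realType) (P : probability T R).

Definition mfun_of d' (U : measurableType d') (f : T -> U)
    (mf : measurable_fun setT f) : {mfun T >-> U} :=
  MeasurableFun.Pack (MeasurableFun.Class (isMeasurableFun.Build _ _ _ _ f mf)).

Lemma mean_distribution d' (U : measurableType d') (X : {mfun T >-> U}) (f : U -> R) :
  bounded_measurable f -> mean P (f \o X) = mean (distribution P X) f.
Proof.
move=> [mf [M fM]]; rewrite /mean /Rintegral (@integral_distribution _ _ _ _ _ P X (EFin \o f))//.
  exact/measurable_EFinP.
apply: (@bounded_measurable_int _ _ _ P (f \o X)); split; first exact: measurableT_comp.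
by exists M => t; exact: fM.
Qed.

Lemma eq_mean d' (U : measurableType d') (P1 P2 : probability U R) (f : U -> R) :
  (forall A, measurable A -> P1 A = P2 A) -> mean P1 f = mean P2 f.
Proof.
move=> P12; rewrite /mean /Rintegral; congr fine.
by apply: eq_measure_integral => A mA _; exact: P12.
Qed.

(** Independence on rectangles determines the joint law of the pair as a product measure; Fubini's
    theorem then factors the expectation. *)
Lemma mean_mul_indep (f g : T -> R) :
  bounded_measurable f -> bounded_measurable g ->
  (forall A B : set R, measurable A -> measurable B ->
    P (f @^-1` A `&` g @^-1` B) = (P (f @^-1` A) * P (g @^-1` B))%E) ->
  mean P (fun t => f t * g t) = mean P f * mean P g.
Proof.
move=> bf bg ind; have [mf [M fM]] := bf; have [mg [M' gM]] := bg.
pose Df := distribution P (mfun_of mf); pose Dg := distribution P (mfun_of mg).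
have mfg : measurable_fun setT (fun t => (f t, g t)) by exact: measurable_fun_pair.
pose m := distribution P (mfun_of mfg).
have prodE X : measurable X -> (Df \x Dg)%E X = m X.
  by apply: product_measure_unique => A B mA mB; rewrite -ind.
pose h (z : R * R) : \bar R := (z.1 * z.2)%:E.
have mh : measurable_fun setT h.
  by apply/measurable_EFinP; apply: measurable_funM; [exact: measurable_fst|exact: measurable_snd].
have ih : m.-integrable setT h.
  apply: (integrable_pushforward mfg) => //.
  exact: (bounded_measurable_int P (bounded_measurableM bf bg)).
have ih' : (Df \x Dg)%E.-integrable setT h.
  apply/integrableP; split => //; move/integrableP : ih => [_].
  rewrite (_ : \int[m]_x _ = \int[Df \x Dg]_x `|h x|)%E//.
  by apply: eq_measure_integral => A mA _; exact: (esym (prodE A mA)).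
have Efg : (\int[P]_t (f t * g t)%:E = \int[Df]_x \int[Dg]_y (x * y)%:E)%E.
  transitivity (\int[m]_z h z)%E.
    rewrite (@integral_distribution _ _ _ _ _ P (mfun_of mfg) h)//.
    exact: (bounded_measurable_int P (bounded_measurableM bf bg)).
  rewrite (_ : \int[m]_z h z = \int[Df \x Dg]_z h z)%E.
    by rewrite -(integral12_prod_meas1 ih').
  by apply: eq_measure_integral => A mA _; exact: (esym (prodE A mA)).
have iid d' (k : T -> R) (mk : measurable_fun setT k) : bounded_measurable k ->
    (distribution P (mfun_of mk)).-integrable setT (@EFin R).
  move=> bk; apply: (integrable_pushforward mk) => //.
  exact: (bounded_measurable_int P bk).
have Ek (k : T -> R) (mk : measurable_fun setT k) : bounded_measurable k ->
    (\int[distribution P (mfun_of mk)]_x x%:E = (mean P k)%:E)%E.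
  move=> bk; rewrite (@integral_distribution _ _ _ _ _ P (mfun_of mk) (@EFin R))//.
    by rewrite -expectation_mean// unlock.
  exact: (bounded_measurable_int P bk).
rewrite {1}/mean /Rintegral Efg.
under eq_integral => x _.
  under eq_integral do rewrite EFinM.
  rewrite integralZl//; last exact: iid.
  rewrite Ek// muleC.
  over.
rewrite integralZl//; last exact: iid.
by rewrite Ek//= mulrC.
Qed.

End laws.

Section gaussian_vectors.
Context d (T : measurableType d) (R : realType) (P : probability T R) (N : nat).
Implicit Types (X : T -> 'rV[R]_N) (V : 'M[R]_N) (a : 'rV[R]_N).

Definition qform V a : R := (a *m V *m a^T) 0 0.

Lemma qform_delta V i : qform V (delta_mx 0 i) = V i i.
Proof. by rewrite /qform -rowE trmx_delta -colE !mxE. Qed.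

Lemma measurable_dot X a : measurable_fun setT X ->
  measurable_fun setT (fun t => dot a (X t)).
Proof. by move=> mX; apply: continuous_rV_measurable => //; exact: continuous_dot. Qed.

Lemma gaussian_charfun X V a b : measurable_fun setT X -> gaussian P X V ->
  mean P (fun t => cos (dot a (X t) + b)) = cos b * expR (- qform V a / 2).
Proof.
move=> mX [_ V0 law]; have mY := measurable_dot a mX.
have bf : bounded_measurable (fun u : R => cos (u + b)).
  split; last by exists 1 => u; exact: cos_max.
  apply: measurableT_comp; last exact: measurable_funD.
  by apply: continuous_measurable_fun; exact: continuous_cos.
rewrite (mean_distribution P (@mfun_of _ T _ (measurableTypeR R) _ mY) bf).
have := law a; rewrite /normal1 -/(qform V a); case: eqP => [-> lawE|/eqP v0 lawE].
  transitivity (mean (\d_(0 : measurableTypeR R)) (fun u => cos (u + b))).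
    by apply: (@eq_mean _ _ (measurableTypeR R)) => A mA; exact: lawE.
  rewrite /mean /Rintegral integral_dirac//; last first.
    by apply/measurable_EFinP; exact: bf.1.
  by rewrite diracT mul1e/= add0r oppr0 mul0r expR0 mulr1.
have v_gt0 : 0 < qform V a by rewrite lt_neqAle eq_sym v0 V0.
have s0 : Num.sqrt (qform V a) != 0 by rewrite gt_eqF// sqrtr_gt0.
transitivity (mean (normal_prob 0 (Num.sqrt (qform V a))) (fun u => cos (u + b))).
  apply: (@eq_mean _ _ (measurableTypeR R)) => A mA; exact: lawE.
have := mean_cos_normal_prob s0 1 b.
under eq_fun do rewrite mul1r.
by move=> ->; rewrite mulr1 sqr_sqrtr// ltW.
Qed.

Lemma gaussian_tail X V a M : 0 < M -> gaussian P X V ->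
  (P [set t | (M < `|dot a (X t)|)%R] <= (8 * qform V a / M ^+ 2)%:E)%E.
Proof.
move=> M0 [_ V0 law].
have mA : measurable [set x : R | (M < `|x|)%R].
  apply: (@measurable_lt_fun _ (measurableTypeR R) R (fun=> M) (fun x => `|x|)) => //.
  by apply: continuous_measurable_fun; exact: norm_continuous.
have := law a _ mA; rewrite /= => ->; rewrite /normal1 -/(qform V a).
case: eqP => [->|/eqP v0].
  by rewrite diracE memNset/= ?normr0 ?mulr0 ?mul0r//; apply/negP; rewrite -leNgt ltW.
have v_gt0 : 0 < qform V a by rewrite lt_neqAle eq_sym v0 V0.
have s0 : Num.sqrt (qform V a) != 0 by rewrite gt_eqF// sqrtr_gt0.
by have := normal_prob_tail M0 s0; rewrite sqr_sqrtr// ltW.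
Qed.

Lemma gaussian_atom X V a c : gaussian P X V -> (qform V a != 0) || (c != 0) ->
  P [set t | dot a (X t) = c] = 0%E.
Proof.
move=> [_ V0 law] vc; have := law a [set c] (measurable_set1 c); rewrite /= => ->.
rewrite /normal1 -/(qform V a); case: eqP vc => [_|/eqP v0 _].
  rewrite /= => c0; rewrite diracE memNset//= => /esym/eqP; exact/negP.
by rewrite /normal_prob integral_set1.
Qed.

(* A vanishing variance makes the projection vanish almost surely. *)
Lemma gaussian_degenerate X V a : gaussian P X V -> qform V a = 0 ->
  P [set t | dot a (X t) = 0] = 1%E.
Proof.
move=> [_ V0 law] v0; have := law a [set 0] (measurable_set1 0); rewrite /= => ->.
by rewrite /normal1 -/(qform V a) v0 eqxx diracE mem_set.
Qed.

Lemma union_bound (I : finType) (A : I -> set T) (B : set T) :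
  (forall i, measurable (A i)) -> measurable B -> B `<=` \bigcup_i A i ->
  (P B <= \sum_i P (A i))%E.
Proof.
move=> mA mB BA.
have mU (s : seq I) : measurable (\big[setU/set0]_(i <- s) A i).
  exact: bigsetU_measurable.
have H (s : seq I) : (P (\big[setU/set0]_(i <- s) A i) <= \sum_(i <- s) P (A i))%E.
  elim: s => [|i s IH]; first by rewrite !big_nil measure0.
  by rewrite !big_cons; apply: (le_trans (measureU2 _ _ _)) => //; exact: leeD2l.
apply: le_trans (H _); apply: le_measure; rewrite ?inE// => t /BA[i _ Ai].
by rewrite -bigcup_seq; exists i => //=; rewrite mem_index_enum.
Qed.

Lemma vector_tail_le X M : 0 <= M -> measurable_fun setT X ->
  (P [set t | (M < `|X t|)%R] <= \sum_i P [set t | (M < `|X t 0 i|)%R])%E.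
Proof.
move=> M0 mX; apply: union_bound => [i||t /=].
- apply: measurable_lt_fun => //.
  apply: (continuous_rV_measurable mX (f := fun x => `|x 0 i|)).
  exact: (@continuous_compR _ _ (fun x : 'rV[R]_N => x 0 i) (fun r => `|r|)
    (@coord_continuous R 1 N 0 i) (@norm_continuous R R)).
- exact: measurable_tail.
- rewrite ltNge => /negP nMX; apply: contrapT => nex; apply: nMX.
  apply/norm_rVP => // i; rewrite leNgt; apply/negP => Mi.
  by apply: nex; exists i.
Qed.

End gaussian_vectors.

(** A union bound over the coordinates: converging covariances eventually have diagonal entries
    below |V0 i i| + 1, and each coordinate tail is at most 8 times its variance over M^2. *)
Lemma gaussian_tight d (T : measurableType d) (R : realType) (P : probability T R)
    N (X : nat -> T -> 'rV[R]_N) (V : nat -> 'M[R]_N) (V0 : 'M[R]_N) e :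
  (forall n, measurable_fun setT (X n)) -> (forall n, gaussian P (X n) (V n)) ->
  V @ \oo --> V0 -> 0 < e ->
  exists M, \forall n \near \oo, fine (P [set t | M < `|X n t|]) <= e.
Proof.
move=> mX gX VV e0.
pose S := \sum_i (`|V0 i i| + 1).
have S0 : 0 <= S by apply: sumr_ge0 => i _; rewrite addr_ge0.
(* Gives M >= 1 and 8 S <= e M <= e M^2, so the summed tails 8 S / M^2 are at most [e]. *)
pose M := 8 * S / e + 1.
have M1 : 1 <= M by rewrite lerDr divr_ge0 ?(ltW e0)// mulr_ge0.
have M0 : 0 < M by exact: lt_le_trans M1.
exists M.
have near_V i : \forall n \near \oo, V n i i <= `|V0 i i| + 1.
  have : V n i i @[n --> \oo] --> V0 i i.
    exact: (cvg_comp V (fun A : 'M[R]_N => A i i) VV (@coord_continuous R N N i i V0)).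
  move=> /cvgrPdist_le/(_ _ ltr01); apply: filterS => n.
  by rewrite ler_norml; have := ler_norm (V0 i i); lra.
have : \forall n \near \oo, forall i, V n i i <= `|V0 i i| + 1.
  exact: filter_forall.
apply: filterS => n Vn.
have fin A : measurable A -> P A \is a fin_num by move=> mA; exact: fin_num_measure.
have mt : measurable [set t | M < `|X n t|] by exact: measurable_tail.
rewrite -lee_fin fineK ?fin//.
apply: (le_trans (vector_tail_le P (ltW M0) (mX n))).
apply: (@le_trans _ _ (\sum_i (8 * (`|V0 i i| + 1) / M ^+ 2)%:E)%E).
  apply: lee_sum => i _.
  have := gaussian_tail (delta_mx 0 i) M0 (gX n).
  rewrite qform_delta; under [X in P X]eq_set do rewrite dot_delta.
  move=> /le_trans; apply; rewrite lee_fin ler_wpM2r ?invr_ge0 ?sqr_ge0//.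
  by rewrite ler_wpM2l.
rewrite sumEFin lee_fin -mulr_suml -mulr_sumr -/S.
rewrite ler_pdivrMr ?exprn_gt0//.
have : 8 * S <= e * M by rewrite /M mulrDr mulr1 [e * _]mulrC divfK ?gt_eqF//; lra.
move=> /le_trans; apply; apply: ler_wpM2l; first exact: ltW.
by rewrite expr2 ler_peMl// ltW.
Qed.

Section gaussian_difference.
Context d (T : measurableType d) (R : realType) (P : probability T R) (N : nat).
Variables (X X0 : T -> 'rV[R]_N) (V : 'M[R]_N).
Hypotheses (mX : measurable_fun setT X) (mX0 : measurable_fun setT X0).
Hypotheses (gX0 : gaussian P X0 V) (iX : indep_copy P X X0).

Lemma indep_copy_gaussian : gaussian P X V.
Proof.
have [VT V0 law] := gX0; split=> // a B mB; rewrite -law//.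
have mA : measurable (dot a @^-1` B).
  by rewrite -[X in measurable X]setTI; apply: continuous_measurable_rV => //; exact: continuous_dot.
exact: (iX.1 _ mA).
Qed.

(** The cosine of a difference is cos cos + sin sin, with sines written as cosines shifted by pi/2.
    Independence factors both products, and the sine term has mean 0 by symmetry. *)
Lemma gaussian_difference_charfun a b :
  mean P (fun t => cos (dot a (X0 t - X t) + b)) = cos b * expR (- qform V a).
Proof.
pose c0 b' t := cos (dot a (X0 t) + b'); pose c1 b' t := cos (dot a (X t) + b').
have bc (Z : T -> 'rV[R]_N) b' : measurable_fun setT Z ->
    bounded_measurable (fun t => cos (dot a (Z t) + b')).
  move=> mZ; apply: (continuous_rV_bounded_measurable mZ (@continuous_cos_dot R N a b') (M := 1)).
  by move=> x; exact: cos_max.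
have ind b1 b2 : mean P (fun t => c1 b1 t * c0 b2 t) = mean P (c1 b1) * mean P (c0 b2).
  apply: mean_mul_indep; [exact: bc..|move=> A B mA mB].
  have mc b' (C : set R) : measurable C ->
      measurable ((fun x : 'rV[R]_N => cos (dot a x + b')) @^-1` C).
    move=> mC; rewrite -[X in measurable X]setTI.
    by apply: continuous_measurable_rV => //; exact: continuous_cos_dot.
  exact: (iX.2 _ _ (mc b1 _ mA) (mc b2 _ mB)).
rewrite (_ : (fun t => _) = (fun t => c1 0 t * c0 b t + c1 (- (pi / 2)) t * c0 (b - pi / 2) t)).
  rewrite meanD; [|exact: bounded_measurableM (bc _ _ _) (bc _ _ _)..].
  rewrite !ind !(gaussian_charfun _ _ _ gX0)// !(gaussian_charfun _ _ _ indep_copy_gaussian)//.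
  rewrite cosN cos_pihalf mul0r mul0r addr0 cos0 mul1r mulrCA -expRD.
  by congr (_ * expR _); lra.
apply/funext => t; rewrite /c0 /c1 addr0 cosBpihalf addrA cosBpihalf dotDr dotNr.
rewrite (_ : dot a (X0 t) - dot a (X t) + b = (dot a (X0 t) + b) - dot a (X t)); last by lra.
by rewrite cosB; lra.
Qed.

End gaussian_difference.

(** * Convergence of distribution functions *)

(** Monotonicity traps [Fn] between its values at the ends of a short interval, compactness of
    [0, M] makes this uniform, and beyond [M] both functions are close to 1. Convergence is assumed
    on [0, oo) only: when the left end is negative, F = 0 there and Fn >= 0 replace it. *)
Lemma polya (R : realType) (F : R -> R) (Fn : nat -> R -> R) :
  (forall s t, s <= t -> F s <= F t) ->
  (forall n s t, s <= t -> Fn n s <= Fn n t) ->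
  (forall t, F t <= 1) -> (forall n t, 0 <= Fn n t <= 1) ->
  (forall t, t < 0 -> F t = 0) ->
  (forall t, 0 <= t -> Fn n t @[n --> \oo] --> F t) ->
  (forall t e, 0 <= t -> 0 < e -> exists2 del, 0 < del & F (t + del) <= F (t - del) + e) ->
  (forall e, 0 < e -> exists M, 1 - e <= F M) ->
  forall e, 0 < e -> \forall n \near \oo, forall t, 0 <= t -> `|Fn n t - F t| <= e.
Proof.
move=> F_mono Fn_mono F1 Fn01 F0 FnF Fc FM e e0.
have e4 : 0 < e / 4 by rewrite divr_gt0.
have [M' M'P] := FM _ e4.
pose M := Num.max M' 0.
have M0 : 0 <= M by rewrite le_max lexx orbT.
have MP : 1 - e / 4 <= F M by apply: (le_trans M'P); apply: F_mono; rewrite le_max lexx.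
have near_F t : 0 <= t -> \forall n \near \oo, `|F t - Fn n t| <= e / 4.
  by move=> t0; have /cvgrPdist_le/(_ _ e4) := FnF _ t0.
pose Q n t := 0 <= t -> `|Fn n t - F t| <= e.
have := (@compact_near_coveringP _ `[0, M]%classic).1 (@segment_compact R 0 M).
move=> /(_ nat \oo%classic Q _).
have loc x : `[0, M]%classic x -> \forall x' \near x & i \near \oo%classic, Q i x'.
  rewrite /= in_itv/= => /andP[x0 _].
  have [del del0 Fdel] := Fc _ _ x0 e4.
  have hi : \forall n \near \oo, `|F (x + del) - Fn n (x + del)| <= e / 4.
    by apply: near_F; rewrite addr_ge0// ltW.
  have lo : \forall n \near \oo, 0 <= x - del -> `|F (x - del) - Fn n (x - del)| <= e / 4.
    have [xd|xd] := leP 0 (x - del); last by near=> n => //.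
    by have := near_F _ xd; apply: filterS.
  exists (ball x del, [set n | `|F (x + del) - Fn n (x + del)| <= e / 4 /\
     (0 <= x - del -> `|F (x - del) - Fn n (x - del)| <= e / 4)]) => /=.
    by split; [exact: nbhsx_ballx|near=> n; split; near: n].
  move=> [x' n] [/= + [hin lon]] x'0; rewrite /ball/= ltr_norml => x'x.
  have x1 : x' <= x + del by lra.
  have x2 : x - del <= x' by lra.
  have h1 := Fn_mono n _ _ x1; have h2 := F_mono _ _ x2; have h3 := F_mono _ _ x1.
  have h4 := Fn_mono n _ _ x2; have /andP[h5 h6] := Fn01 n x'.
  move: hin lon; have [xd|xd] := leP 0 (x - del).
    by move=> + /(_ isT); rewrite !ler_norml; lra.
  by move=> + _; have := F0 _ xd; rewrite !ler_norml; lra.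
move=> /(_ loc) cov.
have nM := near_F _ M0.
near=> n => t t0.
have [tM|tM] := leP t M.
  have : `[0, M]%classic `<=` Q n by near: n; exact: cov.
  by apply => //=; rewrite in_itv/= t0.
have h1 := Fn_mono n _ _ (ltW tM); have h2 := F_mono _ _ (ltW tM).
have /andP[_ h3] := Fn01 n t; have h4 := F1 t.
have : `|F M - Fn n M| <= e / 4 by near: n.
by rewrite !ler_norml; lra.
Unshelve. all: by end_near. Qed.

Section cumulative.
Context d (T : measurableType d) (R : realType) (Q : probability T R).
Variables (f : T -> R) (mf : measurable_fun setT f).

Lemma measurable_sublevel t : measurable [set x | f x <= t].
Proof. exact: measurable_le_fun. Qed.

Lemma sublevel_mono s t : s <= t ->
  fine (Q [set x | f x <= s]) <= fine (Q [set x | f x <= t]).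
Proof.
move=> st; apply: fine_le; [exact: fin_num_measure (measurable_sublevel _)..|].
apply: le_measure; rewrite ?inE; [exact: measurable_sublevel..|].
by move=> x /= /le_trans; apply.
Qed.

Lemma fine_prob_itv (A : set T) : measurable A -> 0 <= fine (Q A) <= 1.
Proof.
move=> mA; rewrite fine_ge0//= -lee_fin fineK ?probability_le1//.
exact: fin_num_measure.
Qed.

(** The sets t - 1/(n+1) < f <= t + 1/(n+1) decrease to the null set f = t. *)
Lemma sublevel_continuous t e : Q [set x | f x = t] = 0%E -> 0 < e ->
  exists2 del, 0 < del &
    fine (Q [set x | f x <= t + del]) <= fine (Q [set x | f x <= t - del]) + e.
Proof.
move=> Qt e0.
pose A n := [set x | f x <= t + n.+1%:R^-1] `\` [set x | f x <= t - n.+1%:R^-1].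
have mA n : measurable (A n) by apply: measurableD; exact: measurable_sublevel.
have : Q (A n) @[n --> \oo] --> Q (\bigcap_n A n).
  apply: nonincreasing_cvg_mu => //.
  - by apply: (le_lt_trans (probability_le1 Q _)); rewrite ?ltry.
  - exact: bigcapT_measurable.
  - move=> m n mn; apply/subsetPset => x [/= h1 /negP h2].
    have mn' : n.+1%:R^-1 <= m.+1%:R^-1 :> R by rewrite lef_pV2 ?posrE// ler_nat.
    split; first by apply: (le_trans h1); rewrite lerD2l.
    move=> h3; apply: (negP h2); apply: (le_trans h3); rewrite lerD2l lerN2//.
rewrite (_ : \bigcap_n A n = [set x | f x = t]); last first.
  apply/seteqP; split=> x /=; last first.
    move=> fx n _; split=> /=; rewrite fx; first by rewrite lerDl.
    by apply/negP; rewrite -ltNge ltrBlDr ltrDl invr_gt0.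
  move=> xA; apply/eqP; rewrite eq_le; apply/andP; split.
    apply/ler_addgt0Pr => r r0.
    have [n nr] : exists n : nat, n.+1%:R^-1 <= r.
      exists (Num.truncn r^-1); rewrite invf_ple ?posrE//.
      by apply: ltW; rewrite truncnS_gt.
    by have [/= h _] := xA n I; apply: (le_trans h); rewrite lerD2l.
  apply/ler_addgt0Pr => r r0.
  have [n nr] : exists n : nat, n.+1%:R^-1 <= r.
    exists (Num.truncn r^-1); rewrite invf_ple ?posrE//.
    by apply: ltW; rewrite truncnS_gt.
  have [_ /= /negP h] := xA n I; rewrite -ltNge in h.
  by rewrite -lerBlDr; apply: (le_trans _ (ltW h)); rewrite lerD2l lerN2.
rewrite Qt => /fine_cvgP[_ /cvgr0Pnorm_le/(_ _ e0)[n _ nP]].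
exists n.+1%:R^-1; first by rewrite invr_gt0.
have := nP n (leqnn n); rewrite /= ger0_norm ?fine_ge0//.
have st : [set x | f x <= t - n.+1%:R^-1] `<=` [set x | f x <= t + n.+1%:R^-1].
  move=> x /= h; apply: (le_trans h); rewrite lerD2l.
  by apply: (@le_trans _ _ 0); rewrite ?oppr_le0 invr_ge0.
rewrite /A measureD//; [|exact: measurable_sublevel..|].
  rewrite (setIidr st) fineB ?fin_num_measure//; [lra|exact: measurable_sublevel..].
by apply: (le_lt_trans (probability_le1 Q _)); rewrite ?ltry//; exact: measurable_sublevel.
Qed.

Lemma sublevel_cvg1 e : 0 < e -> exists M, 1 - e <= fine (Q [set x | f x <= M]).
Proof.
move=> e0.
have : Q [set x | f x <= n%:R] @[n --> \oo] --> Q (\bigcup_n [set x | f x <= n%:R]).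
  apply: nondecreasing_cvg_mu => //.
  - by move=> n; exact: measurable_sublevel.
  - by apply: bigcup_measurable => n _; exact: measurable_sublevel.
  - by move=> m n mn; apply/subsetPset => x /= /le_trans; apply; rewrite ler_nat.
rewrite (_ : \bigcup_n _ = setT); last first.
  rewrite -subTset => x _; exists (Num.truncn (f x)).+1 => //=.
  by rewrite ltW// truncnS_gt.
rewrite probability_setT => /fine_cvgP[_ /cvgrPdist_le/(_ _ e0)[n _ nP]].
exists n%:R; have := nP n (leqnn n); rewrite /= ler_norml; lra.
Qed.

End cumulative.

Section portmanteau.
Context d (T : measurableType d) d' (T' : measurableType d') (R : realType) (N : nat).
Variables (P : probability T R) (Q : probability T' R).
Variables (X : nat -> T -> 'rV[R]_N) (Y : T' -> 'rV[R]_N) (psi : 'rV[R]_N -> R).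
Hypothesis mX : forall n, measurable_fun setT (X n).
Hypothesis mY : measurable_fun setT Y.
Hypothesis XY : cvg_in_distribution P Q X Y.
Hypothesis cpsi : continuous psi.

(** A continuous ramp, 1 where psi <= t and 0 where psi >= t + del, squeezed between the indicators
    of the two sublevel sets. *)
Let test t del x : R := clamp ((t + del - psi x) / del).

Let continuous_test t del : continuous (test t del).
Proof.
apply: continuous_compR; last exact: continuous_clamp.
apply: continuous_mul; last exact: continuous_cst.
apply: continuous_add; first exact: continuous_cst.
by apply: (continuous_compR cpsi (h := -%R)) => x; apply: cvgN; exact: cvg_id.
Qed.

Let test_le t del x : 0 < del -> test t del x <= \1_[set x | psi x <= t + del] x.
Proof.
move=> del0; rewrite indicE; have [pt|pt] := leP (psi x) (t + del).
  by rewrite mem_set//; have /andP[] := clamp_itv ((t + del - psi x) / del).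
rewrite memNset/=; last by apply/negP; rewrite -ltNge.
by rewrite /test clamp_le0// pmulr_lle0 ?invr_gt0//; lra.
Qed.

Let test_ge t del x : 0 < del -> \1_[set x | psi x <= t] x <= test t del x.
Proof.
move=> del0; rewrite indicE; have [pt|pt] := leP (psi x) t.
  by rewrite mem_set// /test clamp_ge1// ler_pdivlMr//; lra.
rewrite memNset/=; last by apply/negP; rewrite -ltNge.
by have /andP[] := clamp_itv ((t + del - psi x) / del).
Qed.

Let bt d0 (T0 : measurableType d0) (W : T0 -> 'rV[R]_N) t del :
  measurable_fun setT W -> bounded_measurable (fun x => test t del (W x)).
Proof.
move=> mW; apply: (continuous_rV_bounded_measurable mW (@continuous_test t del) (M := 1)).
move=> x; have /andP[h1 h2] := clamp_itv ((t + del - psi x) / del).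
by rewrite ger0_norm.
Qed.

Let mpsi d0 (T0 : measurableType d0) (W : T0 -> 'rV[R]_N) :
  measurable_fun setT W -> measurable_fun setT (fun x => psi (W x)).
Proof. by move=> mW; exact: continuous_rV_measurable. Qed.

Let fine_sublevel d0 (T0 : measurableType d0) (P0 : probability T0 R)
    (W : T0 -> 'rV[R]_N) t : measurable_fun setT W ->
  fine (P0 [set x | psi (W x) <= t]) = mean P0 (fun x => \1_[set x | psi x <= t] (W x)).
Proof.
move=> mW; rewrite -(mean_indic P0); last exact: (measurable_sublevel (mpsi mW)).
by congr mean; apply/funext => x; rewrite !indicE; congr (_%:R); apply/idP/idP;
  rewrite !inE.
Qed.

Let bi d0 (T0 : measurableType d0) (W : T0 -> 'rV[R]_N) t : measurable_fun setT W ->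
  bounded_measurable (fun x => \1_[set x | psi x <= t] (W x) : R).
Proof.
move=> mW; have := @bounded_measurable_indic _ _ R _ (measurable_sublevel (mpsi mW) t).
by congr bounded_measurable; apply/funext => x; rewrite !indicE; congr (_%:R);
  apply/idP/idP; rewrite !inE.
Qed.

Lemma test_mean_cvg t del :
  mean P (fun x => test t del (X n x)) @[n --> \oo] --> mean Q (fun x => test t del (Y x)).
Proof.
have bd : exists M, forall x, `|test t del x| <= M.
  exists 1 => x; have /andP[h1 h2] := clamp_itv ((t + del - psi x) / del).
  by rewrite ger0_norm.
have := XY (@continuous_test t del) bd.
rewrite expectation_mean; last exact: bt.
under eq_fun do (rewrite expectation_mean; last exact: bt).
by move/fine_cvg.
Qed.

Lemma portmanteau_le t del e : 0 < del -> 0 < e -> \forall n \near \oo,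
  fine (P [set x | psi (X n x) <= t]) <= fine (Q [set x | psi (Y x) <= t + del]) + e.
Proof.
move=> del0 e0; have /cvgrPdist_le/(_ _ e0) := @test_mean_cvg t del.
apply: filterS => n; rewrite !fine_sublevel// => h.
have h1 := le_mean P (bi t (mX n)) (bt t del (mX n)) (fun x => test_ge t (X n x) del0).
have h2 := le_mean Q (bt t del mY) (bi (t + del) mY) (fun x => test_le t (Y x) del0).
by move: h; rewrite ler_norml; lra.
Qed.

Lemma portmanteau_ge t del e : 0 < del -> 0 < e -> \forall n \near \oo,
  fine (Q [set x | psi (Y x) <= t]) <= fine (P [set x | psi (X n x) <= t + del]) + e.
Proof.
move=> del0 e0; have /cvgrPdist_le/(_ _ e0) := @test_mean_cvg t del.
apply: filterS => n; rewrite !fine_sublevel// => h.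
have h1 := le_mean P (bt t del (mX n)) (bi (t + del) (mX n)) (fun x => test_le t (X n x) del0).
have h2 := le_mean Q (bi t mY) (bt t del mY) (fun x => test_ge t (Y x) del0).
by move: h; rewrite ler_norml; lra.
Qed.

End portmanteau.

(** * Potentials and minimum-cost flows *)

Section hahn_banach.
Context {R : realType} {N : nat}.
Implicit Types (p q : 'rV[R]_N -> R) (v x y z : 'rV[R]_N).

Definition sublinear p : Prop :=
  (forall x y, p (x + y) <= p x + p y) /\
  (forall s x, 0 <= s -> p (s *: x) = s * p x).

Lemma sublinear0 p : sublinear p -> p 0 = 0.
Proof. by move=> [_ pZ]; rewrite -(scale0r 0) pZ// mul0r. Qed.

Lemma sublinear_opp_ge p x : sublinear p -> - p (- x) <= p x.
Proof.
move=> sp; have := sp.1 x (- x); rewrite subrr sublinear0//; lra.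
Qed.

(** The largest sublinear function below [p] that is linear along [v] with slope p v: the extension
    step of the Hahn-Banach theorem in infimum form. *)
Definition lin_along p v x : R := inf [set p (x + s *: v) - s * p v | s in [set s | 0 <= s]].

Lemma lin_along_lb p v x : sublinear p ->
  lbound [set p (x + s *: v) - s * p v | s in [set s | 0 <= s]] (- p (- x)).
Proof.
move=> sp _ [s /= s0 <-]; have := sp.1 (x + s *: v) (- x).
by rewrite addrAC subrr add0r sp.2//; lra.
Qed.

Lemma lin_along_le p v x s : sublinear p -> 0 <= s ->
  lin_along p v x <= p (x + s *: v) - s * p v.
Proof.
by move=> sp s0; apply: ge_inf; [exists (- p (- x)); exact: lin_along_lb|exists s].
Qed.

Lemma lin_along_ge p v x a :
  (forall s, 0 <= s -> a <= p (x + s *: v) - s * p v) -> a <= lin_along p v x.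
Proof.
move=> H; apply: lb_le_inf; first by exists (p (x + 0 *: v) - 0 * p v), 0 => //=.
by move=> _ [s /= s0 <-]; exact: H.
Qed.

Lemma lin_along_sublinear p v : sublinear p -> sublinear (lin_along p v).
Proof.
move=> sp; split=> [x y|].
  rewrite -lerBlDr; apply: lin_along_ge => s s0.
  rewrite lerBlDr -lerBlDl; apply: lin_along_ge => t t0.
  rewrite lerBlDl; have st0 : 0 <= s + t by rewrite addr_ge0.
  apply: (le_trans (lin_along_le v (x + y) sp st0)).
  rewrite scalerDl addrACA; have := sp.1 (x + s *: v) (y + t *: v); lra.
have H s x : 0 < s -> lin_along p v (s *: x) <= s * lin_along p v x.
  move=> s0; rewrite -ler_pdivrMl//; apply: lin_along_ge => t t0.
  rewrite ler_pdivrMl//.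
  have st0 : 0 <= s * t by rewrite mulr_ge0// ltW.
  apply: (le_trans (lin_along_le v (s *: x) sp st0)).
  by rewrite -scalerA -scalerDr sp.2; [lra|exact: ltW].
move=> s x; rewrite le_eqVlt => /predU1P[<-|s0].
  rewrite scale0r mul0r; apply/eqP; rewrite eq_le; apply/andP; split.
    have := lin_along_le v 0 sp (lexx 0).
    by rewrite scale0r addr0 (sublinear0 sp) mul0r subr0.
  apply: lin_along_ge => t t0; rewrite add0r sp.2// subrr//.
apply/eqP; rewrite eq_le H//= -ler_pdivlMl//.
apply: le_trans (H _ _ _); last by rewrite invr_gt0.
by rewrite scalerA mulVf ?gt_eqF// scale1r.
Qed.

Lemma lin_along_dominated p v x : sublinear p -> lin_along p v x <= p x.
Proof.
move=> sp; have := lin_along_le v x sp (lexx 0).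
by rewrite scale0r addr0 mul0r subr0.
Qed.

Lemma lin_along_odd p v : sublinear p ->
  lin_along p v v = p v /\ lin_along p v (- v) = - p v.
Proof.
move=> sp; have sq := lin_along_sublinear v sp.
have h1 := lin_along_dominated v v sp.
have h2 : lin_along p v (- v) <= - p v.
  have := lin_along_le v (- v) sp ler01.
  by rewrite scale1r addNr sublinear0// mul1r sub0r.
by have := sublinear_opp_ge v sq; split; lra.
Qed.

(** Hence linearity gained along one direction survives every later application of [lin_along]. *)
Lemma sublinear_odd_le p q v : sublinear q -> (forall x, q x <= p x) ->
  p (- v) = - p v -> q v = p v /\ q (- v) = - q v.
Proof.
move=> sq qp pv; have h1 := qp v; have h2 := qp (- v).
by have := sublinear_opp_ge v sq; split; lra.
Qed.

Lemma sublinear_odd_on p (vs : seq 'rV[R]_N) : sublinear p -> exists q,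
  [/\ sublinear q, forall x, q x <= p x & forall v, v \in vs -> q (- v) = - q v].
Proof.
move=> sp; elim: vs => [|v vs [q [sq qp qvs]]]; first by exists p.
exists (lin_along q v); split; first exact: lin_along_sublinear.
  by move=> x; apply: le_trans (qp x); exact: lin_along_dominated.
move=> w; rewrite inE => /predU1P[->|wvs].
  by have [-> ->] := lin_along_odd v sq.
have [] // := sublinear_odd_le (lin_along_sublinear v sq) _ (qvs w wvs).
by move=> x; exact: lin_along_dominated.
Qed.

(** [lin_along] is applied first to [z], which fixes the value p z, then to each basis vector. A
    sublinear function that is odd on a basis is linear: subadditivity gives q <= <a, .>, and the
    same at -x gives the reverse. *)
Theorem hahn_banach_rV p z : sublinear p ->
  exists a, (forall x, dot a x <= p x) /\ dot a z = p z.
Proof.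
move=> sp; have sq0 := lin_along_sublinear z sp.
have [qz qNz] := lin_along_odd z sp.
have [q [sq qq0 qe]] := sublinear_odd_on [seq delta_mx 0 i | i : 'I_N] sq0.
pose a : 'rV[R]_N := \row_i q (delta_mx 0 i).
have qZ i r : q (r *: delta_mx 0 i) = r * q (delta_mx 0 i).
  have [r0|r0] := leP 0 r; first by rewrite sq.2.
  rewrite -[r]opprK scaleNr -scalerN sq.2 ?oppr_ge0 ?ltW//.
  by rewrite qe ?map_f ?mem_enum// mulrN -mulNr.
have q_le x : q x <= dot a x.
  have -> : q x = q (\sum_i x 0 i *: delta_mx 0 i) by rewrite -row_sum_delta.
  rewrite /dot; elim/big_rec2 : _ => [|i u w _ uw]; first by rewrite sublinear0.
  apply: (le_trans (sq.1 _ _)); rewrite qZ mxE mulrC; exact: lerD.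
have qE x : q x = dot a x.
  apply/eqP; rewrite eq_le q_le/=.
  have := sublinear_opp_ge x sq; have := q_le (- x); rewrite dotNr; lra.
exists a; split=> [x|].
  by rewrite -qE; apply: (le_trans (qq0 x)); exact: lin_along_dominated.
have qNz' : lin_along p z (- z) = - lin_along p z z by rewrite qNz qz.
by have [qz' _] := sublinear_odd_le sq qq0 qNz'; rewrite -qE qz' qz.
Qed.

End hahn_banach.

Lemma closed_sublevel (R : realType) (T : topologicalType) (f : T -> R) a :
  continuous f -> closed [set x | f x <= a].
Proof.
move=> cf; apply: (@closed_comp _ _ f [set r | r <= a]) => [x _|].
  exact: cf.
exact: closed_le.
Qed.

Lemma finite_positive_bound (R : realType) (I : finType) (Q : pred I) (f : I -> R) :
  (forall i, Q i -> 0 < f i) -> exists2 eta, 0 < eta & forall i, Q i -> eta <= f i.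
Proof.
move=> f0.
have [eta eta0 H] : exists2 eta, 0 < eta &
    forall i, i \in index_enum I -> Q i -> eta <= f i.
  elim: (index_enum I) => [|i s [eta eta0 IH]]; first by exists 1.
  have [Qi|nQi] := boolP (Q i); last first.
    exists eta => // j; rewrite inE => /predU1P[->|]; first by rewrite (negbTE nQi).
    exact: IH.
  exists (Num.min eta (f i)); first by rewrite lt_min eta0 f0.
  move=> j; rewrite inE => /predU1P[-> _|js Qj]; first by rewrite ge_min lexx orbT.
  by rewrite ge_min IH.
by exists eta => // i; apply: H; rewrite mem_index_enum.
Qed.

Section potentials_polytope.
Context {R : realType} {N : nat}.
Variables (i0 : 'I_N) (c : 'I_N -> 'I_N -> R).
Hypothesis c0 : forall x, c x x = 0.
Hypothesis c_gt0 : forall x y, x != y -> 0 < c x y.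
Implicit Types (h z w : 'rV[R]_N).

Definition potential h : Prop := forall x y, h 0 x - h 0 y <= c x y.

(* Potentials are only defined up to constants: [i0] fixes the constant. *)
Definition normalized : set 'rV[R]_N := [set h : 'rV[R]_N | h 0 i0 = 0 /\ potential h].

(** The function psi of the overview. It is finite at every [z], and on zero-sum vectors it is the
    supremum over all potentials ([potential_le_support]). *)
Definition support_fun z : R := sup [set dot h z | h in normalized].

Let C : R := \sum_x \sum_y c x y.

Lemma c_ge0 x y : 0 <= c x y.
Proof. by have [->|xy] := eqVneq x y; [rewrite c0|exact/ltW/c_gt0]. Qed.

Lemma c_leC x y : c x y <= C.
Proof.
rewrite /C (bigD1 x)//= (bigD1 y)//= -!addrA lerDl addr_ge0//.
  by apply: sumr_ge0 => i _; exact: c_ge0.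
by apply: sumr_ge0 => i _; apply: sumr_ge0 => j _; exact: c_ge0.
Qed.

Lemma C_ge0 : 0 <= C.
Proof. exact: le_trans (c_ge0 i0 i0) (c_leC i0 i0). Qed.

Lemma normalized_bound h i : normalized h -> `|h 0 i| <= C.
Proof.
move=> [h0 hP]; have := hP i i0; have := hP i0 i; rewrite h0 subr0 sub0r.
have := c_leC i i0; have := c_leC i0 i; rewrite ler_norml; lra.
Qed.

Lemma normalized0 : normalized 0.
Proof. by split=> [|x y]; rewrite ?mxE// subrr c_ge0. Qed.

Lemma dot_bound h z : normalized h -> `|dot h z| <= C * \sum_i `|z 0 i|.
Proof.
move=> hn; apply: (le_trans (ler_norm_sum _ _ _)); rewrite mulr_sumr.
by apply: ler_sum => i _; rewrite normrM ler_wpM2r// normalized_bound.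
Qed.

Lemma support_fun_ge h z : normalized h -> dot h z <= support_fun z.
Proof.
move=> hn; apply: ub_le_sup; last by exists h.
exists (C * \sum_i `|z 0 i|) => _ [w wn <-].
by apply: le_trans (ler_norm _) _; exact: dot_bound.
Qed.

Lemma support_fun_le z s : (forall h, normalized h -> dot h z <= s) ->
  support_fun z <= s.
Proof.
move=> H; apply: ge_sup; first by exists (dot 0 z), 0 => //; exact: normalized0.
by move=> _ [h hn <-]; exact: H.
Qed.

Lemma support_fun_ge0 z : 0 <= support_fun z.
Proof. by rewrite -(dot0l z) support_fun_ge//; exact: normalized0. Qed.

Lemma support_funZ s z : 0 <= s -> support_fun (s *: z) = s * support_fun z.
Proof.
move=> s0; apply/eqP; rewrite eq_le; apply/andP; split.
  by apply: support_fun_le => h hn; rewrite dotZr ler_wpM2l// support_fun_ge.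
have [->|sn0] := eqVneq s 0; first by rewrite mul0r support_fun_ge0.
have {}s0 : 0 < s by rewrite lt_neqAle eq_sym sn0.
rewrite -ler_pdivlMl//; apply: support_fun_le => h hn.
by rewrite ler_pdivlMl// -dotZr support_fun_ge.
Qed.

Lemma support_fun_lip z z' :
  support_fun z <= support_fun z' + C * \sum_i `|z 0 i - z' 0 i|.
Proof.
apply: support_fun_le => h hn.
have -> : dot h z = dot h z' + dot h (z - z') by rewrite -dotDr addrC subrK.
apply: lerD; first exact: support_fun_ge.
apply: le_trans (ler_norm _) _; apply: le_trans (dot_bound _ hn) _.
by under eq_bigr do rewrite !mxE.
Qed.

Lemma support_fun_bound z : support_fun z <= C * \sum_i `|z 0 i|.
Proof.
by apply: support_fun_le => h hn; apply: le_trans (ler_norm _) _; exact: dot_bound.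
Qed.

Lemma support_fun_continuous : continuous support_fun.
Proof.
move=> z.
pose F z' := C * \sum_i `|z 0 i - z' 0 i|.
have cF : continuous F.
  apply: continuous_mul; first exact: continuous_cst.
  apply: continuous_sum => i.
  apply: (continuous_compR (f := fun z' : 'rV[R]_N => z 0 i - z' 0 i)); last exact: norm_continuous.
  apply: continuous_add; first exact: continuous_cst.
  apply: (continuous_compR (f := fun z' : 'rV[R]_N => z' 0 i) (h := -%R)).
    exact: coord_continuous.
  by move=> x; apply: cvgN; exact: cvg_id.
have Fz : F z = 0 by rewrite /F big1 ?mulr0// => i _; rewrite subrr normr0.
have cS : F @ z --> 0 by rewrite -Fz; exact: cF.
have FF := nbhs_filter z.
apply/(@cvgrPdist_le _ _ _ _ FF) => e e0.
move/(@cvgr0Pnorm_le _ _ _ _ FF) : cS => /(_ _ e0); apply: filterS => z'.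
rewrite ger0_norm; last by rewrite mulr_ge0 ?C_ge0// sumr_ge0.
have h1 := support_fun_lip z z'; have := support_fun_lip z' z.
have -> : C * \sum_i `|z' 0 i - z 0 i| = F z'.
  by congr (_ * _); apply: eq_bigr => i _; rewrite distrC.
by rewrite -/(F z') in h1; rewrite ler_norml; lra.
Qed.

Lemma normalized_closed : closed normalized.
Proof.
have -> : normalized = [set h : 'rV[R]_N | h 0 i0 = 0] `&`
    \bigcap_(x in [set: 'I_N]) \bigcap_(y in [set: 'I_N])
      [set h : 'rV[R]_N | h 0 x - h 0 y <= c x y].
  apply/seteqP; split=> [h [h0 hP]|h [h0 hP]]; split=> //.
    by move=> x _ y _ /=; exact: hP.
  by move=> x y; exact: (hP x I y I).
apply: closedI.
  apply: (@closed_comp _ _ (fun h : 'rV[R]_N => h 0 i0) [set 0]) => [h _|].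
    exact: coord_continuous.
  exact: closed_eq.
apply: closed_bigI => x _; apply: closed_bigI => y _.
apply: (closed_sublevel (f := fun h : 'rV[R]_N => h 0 x - h 0 y)).
apply: continuous_add; first exact: coord_continuous.
apply: (continuous_compR (f := fun h : 'rV[R]_N => h 0 y) (h := -%R)).
  exact: coord_continuous.
by move=> r; apply: cvgN; exact: cvg_id.
Qed.

Lemma support_fun_max z : exists2 h, normalized h & support_fun z = dot h z.
Proof.
have cn : compact normalized.
  apply: (subclosed_compact normalized_closed (@compact_cube R N C)).
  by move=> h hn i; exact: normalized_bound.
have [||h hn hmax] := @EVT_max_rV R N (fun h => dot h z) normalized _ cn.
- by exists 0; exact: normalized0.
- apply: continuous_subspaceT => h; under eq_fun do rewrite dotC.
  exact: continuous_dot.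
rewrite inE in hn; exists h => //; apply/eqP; rewrite eq_le support_fun_ge// andbT.
by apply: support_fun_le => w wn; apply: hmax; rewrite inE.
Qed.

Lemma dot_shift h z (a : R) : \sum_i z 0 i = 0 -> dot (\row_i (h 0 i - a)) z = dot h z.
Proof.
move=> z0; rewrite /dot; under eq_bigr do rewrite mxE mulrBl.
by rewrite sumrB -mulr_sumr z0 mulr0 subr0.
Qed.

Lemma potential_le_support h z : \sum_i z 0 i = 0 -> potential h ->
  dot h z <= support_fun z.
Proof.
move=> z0 hP; rewrite -(dot_shift h (h 0 i0) z0); apply: support_fun_ge.
split=> [|x y]; rewrite !mxE ?subrr//; have := hP x y; lra.
Qed.

(** As [c] is at least [eta] off the diagonal, both eta and -eta times a basis vector are
    potentials, and they bound each coordinate of [z] from both sides. *)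
Lemma support_fun_eq0 z : \sum_i z 0 i = 0 -> support_fun z <= 0 -> z = 0.
Proof.
move=> z0 zs.
have [eta eta0 etaP] : exists2 eta, 0 < eta & forall xy : 'I_N * 'I_N,
    xy.1 != xy.2 -> eta <= c xy.1 xy.2.
  exact: (@finite_positive_bound R ('I_N * 'I_N)%type (fun xy => xy.1 != xy.2)
    (fun xy => c xy.1 xy.2) (fun xy => @c_gt0 xy.1 xy.2)).
have pot (s : R) i : `|s| <= eta -> potential (s *: delta_mx 0 i).
  move=> se x y; rewrite !mxE !eqxx/=.
  have [->|xy] := eqVneq x y; first by rewrite subrr c0.
  apply: le_trans (etaP (x, y) xy); move: se; rewrite ler_norml.
  by case: (x =P i) => [xi|_]; case: (y =P i) => [yi|_] /=;
    rewrite ?mulr1 ?mulr0; [rewrite xi yi eqxx in xy|lra..].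
apply/rowP => i; rewrite mxE; apply/eqP; rewrite eq_le; apply/andP; split.
  have := le_trans (potential_le_support z0 (pot eta i _)) zs.
  by rewrite dotZl dot_delta pmulr_rle0//; apply; rewrite gtr0_norm.
have := le_trans (potential_le_support z0 (pot (- eta) i _)) zs.
by rewrite dotZl dot_delta mulNr oppr_le0 pmulr_rge0//; apply; rewrite normrN gtr0_norm.
Qed.

(* If [w] maximizes [dot _ z] then [z] is orthogonal to every direction along
   which the tight constraints stay tight, so the maximum only depends on the
   set of tight constraints: finitely many linear functionals suffice. *)
Lemma support_fun_finite : exists s : seq 'rV[R]_N,
  forall z, exists2 w, w \in s & support_fun z = dot w z.
Proof.
(* [I] stands for a set of tight constraints; [W] picks one solution of each solvable system, which
   gives a finite family independent of [z]. *)
pose solves (I : {set 'I_N * 'I_N}) w := w 0 i0 = 0 /\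
  forall xy, xy \in I -> w 0 xy.1 - w 0 xy.2 = c xy.1 xy.2.
have /choice[W WP] : forall I, exists w, (exists w', solves I w') -> solves I w.
  move=> I; have [[w Iw]|nw] := pselect (exists w', solves I w'); first by exists w.
  by exists 0.
exists [seq W J | J : {set 'I_N * 'I_N}] => z.
have [w [w0 wP] wE] := support_fun_max z.
pose I : {set 'I_N * 'I_N} := [set xy : 'I_N * 'I_N | w 0 xy.1 - w 0 xy.2 == c xy.1 xy.2]%SET.
have [W0 WI] : solves I (W I).
  by apply: WP; exists w; split=> // xy; rewrite inE => /eqP.
exists (W I); first by rewrite map_f// mem_enum.
pose v := W I - w.
have [eta eta0 etaP] : exists2 eta, 0 < eta & forall xy : 'I_N * 'I_N,
    xy \notin I -> eta <= c xy.1 xy.2 - (w 0 xy.1 - w 0 xy.2).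
  apply: (@finite_positive_bound R ('I_N * 'I_N)%type (fun xy => xy \notin I)
    (fun xy => c xy.1 xy.2 - (w 0 xy.1 - w 0 xy.2))) => xy.
  by rewrite inE => xyI; rewrite subr_gt0 lt_neqAle xyI wP.
(* A move by s v with |s| <= eta / B changes no tight constraint and uses at most the slack [eta] of
   the others. Both signs of [s] are allowed, so optimality of [w] forces <v, z> = 0. *)
pose B := 1 + 2 * \sum_i `|v 0 i|.
have S0 : 0 <= \sum_i `|v 0 i| by apply: sumr_ge0.
have B0 : 0 < B by rewrite /B; lra.
have vB x y : `|v 0 x - v 0 y| <= B.
  have vi i : `|v 0 i| <= \sum_i `|v 0 i| by rewrite (bigD1 i)//= lerDl sumr_ge0.
  apply: (le_trans (ler_normB _ _)); have := vi x; have := vi y; rewrite /B; lra.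
have move_ok (s : R) : `|s| <= eta / B -> normalized (w + s *: v).
  move=> sB; split=> [|x y]; first by rewrite !mxE w0 W0 subrr mulr0 addr0.
  have -> : (w + s *: v) 0 x - (w + s *: v) 0 y =
      (w 0 x - w 0 y) + s * (v 0 x - v 0 y) by rewrite !mxE; lra.
  have [xyI|xyI] := boolP ((x, y) \in I).
    have := WI _ xyI; move: xyI; rewrite inE => /eqP /= <-.
    move=> WE; have -> : v 0 x - v 0 y = 0 by rewrite !mxE; lra.
    by rewrite mulr0 addr0.
  have := etaP _ xyI; rewrite /= => slack.
  have : `|s * (v 0 x - v 0 y)| <= eta.
    rewrite normrM; apply: (@le_trans _ _ (eta / B * B)); first exact: ler_pM.
    by rewrite divfK// gt_eqF.
  by rewrite ler_norml; lra.
have eB : 0 < eta / B by rewrite divr_gt0.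
have up s : `|s| <= eta / B -> s * dot v z <= 0.
  move=> sB; have := support_fun_ge z (move_ok s sB).
  by rewrite wE dotDl dotZl; lra.
have vz : dot v z = 0.
  apply/eqP; rewrite eq_le; apply/andP; split.
    by have := up _ (_ : `|eta / B| <= eta / B); rewrite pmulr_rle0//; apply; rewrite gtr0_norm.
  have := up _ (_ : `|- (eta / B)| <= eta / B).
  by rewrite mulNr oppr_le0 pmulr_rge0//; apply; rewrite normrN gtr0_norm.
by rewrite wE -[W I](subrK w) -/v dotDl vz add0r.
Qed.

(** By [support_fun_finite] the level set is covered by level sets of finitely many linear forms. *)
Lemma support_fun_level (d : measure_display) (T : measurableType d)
    (P : probability T R) (Y : T -> 'rV[R]_N) t : measurable_fun setT Y ->
  (forall a, P [set x | dot a (Y x) = t] = 0%E) ->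
  P [set x | support_fun (Y x) = t] = 0%E.
Proof.
move=> mY aY; have [s sP] := support_fun_finite.
have ms (f : 'rV[R]_N -> R) : continuous f -> measurable [set x | f (Y x) = t].
  move=> cf; have := continuous_rV_measurable mY cf => /(_ measurableT [set t]).
  by rewrite setTI; apply; exact: measurable_set1.
have m1 a : measurable [set x | dot a (Y x) = t] by apply: ms; exact: continuous_dot.
apply/eqP; rewrite -measure_le0.
apply: (@le_trans _ _ (P (\big[setU/set0]_(a <- s) [set x | dot a (Y x) = t]))).
  apply: le_measure; rewrite ?inE.
  - by apply: ms; exact: support_fun_continuous.
  - exact: bigsetU_measurable.
  - move=> x /=; have [w ws ->] := sP (Y x) => wt.
    by rewrite -bigcup_seq; exists w.
rewrite measure_le0; apply/eqP.
elim: s {sP} => [|a s IH]; first by rewrite big_nil measure0.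
rewrite big_cons; apply/eqP; rewrite -measure_le0.
apply: (le_trans (measureU2 _ _ _)) => //; first exact: bigsetU_measurable.
by rewrite [X in (X + _ <= _)%E]aY [X in (_ + X <= _)%E]IH adde0.
Qed.

(** * Minimum-cost flows and their duality *)

Section min_cost_flow.
Implicit Types rho : 'M[R]_N.

Definition divergence (rho : 'M[R]_N) x : R := \sum_y rho x y - \sum_y rho y x.

Definition flow_cost (rho : 'M[R]_N) : R := \sum_x \sum_y rho x y * c x y.

(** The diagonal is set to zero because loops cost nothing: only then does the cost control the
    total mass of the flow. *)
Definition flow (rho : 'M[R]_N) z : Prop :=
  [/\ forall x y, 0 <= rho x y, forall x, rho x x = 0 &
      forall x, divergence rho x = z 0 x].

(* Total on all vectors: the excess mass of [z] is removed at [i0]. *)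
Let V z : R := inf [set flow_cost rho |
  rho in [set rho | flow rho (z - (\sum_i z 0 i) *: delta_mx 0 i0)]].

Lemma flow_cost_ge0 rho : (forall x y, 0 <= rho x y) -> 0 <= flow_cost rho.
Proof.
by move=> r0; apply: sumr_ge0 => x _; apply: sumr_ge0 => y _; rewrite mulr_ge0// c_ge0.
Qed.

Lemma flowD rho rho' z z' : flow rho z -> flow rho' z' -> flow (rho + rho') (z + z').
Proof.
move=> [r0 rd rz] [r0' rd' rz']; split=> [x y|x|x].
- by rewrite mxE addr_ge0.
- by rewrite mxE rd rd' addr0.
- rewrite mxE -rz -rz' /divergence; under eq_bigr do rewrite mxE.
  by under [X in _ - X]eq_bigr do rewrite mxE; rewrite !big_split/=; lra.
Qed.

Lemma flow_costD rho rho' : flow_cost (rho + rho') = flow_cost rho + flow_cost rho'.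
Proof.
rewrite /flow_cost -big_split/=; apply: eq_bigr => x _.
by rewrite -big_split/=; apply: eq_bigr => y _; rewrite mxE mulrDl.
Qed.

Lemma flowZ (s : R) rho z : 0 <= s -> flow rho z -> flow (s *: rho) (s *: z).
Proof.
move=> s0 [r0 rd rz]; split=> [x y|x|x].
- by rewrite mxE mulr_ge0.
- by rewrite mxE rd mulr0.
- rewrite mxE -rz /divergence mulrBr !mulr_sumr.
  by congr (_ - _); apply: eq_bigr => y _; rewrite mxE.
Qed.

Lemma flow_costZ (s : R) rho : flow_cost (s *: rho) = s * flow_cost rho.
Proof.
rewrite /flow_cost mulr_sumr; apply: eq_bigr => x _.
by rewrite mulr_sumr; apply: eq_bigr => y _; rewrite mxE mulrA.
Qed.

Let proj z := z - (\sum_i z 0 i) *: delta_mx 0 i0.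

Let projD z z' : proj (z + z') = proj z + proj z'.
Proof.
rewrite /proj (_ : \sum_i (z + z') 0 i = \sum_i z 0 i + \sum_i z' 0 i).
  by rewrite scalerDl opprD addrACA.
by rewrite -big_split; apply: eq_bigr => i _; rewrite mxE.
Qed.

Let projZ (s : R) z : proj (s *: z) = s *: proj z.
Proof.
rewrite /proj scalerBr scalerA; congr (_ - _ *: _).
by rewrite mulr_sumr; apply: eq_bigr => i _; rewrite mxE.
Qed.

Lemma edge_flow (x y : 'I_N) : x != y ->
  flow (delta_mx x y) (delta_mx 0 x - delta_mx 0 y) /\
  flow_cost (delta_mx x y) = c x y.
Proof.
move=> xy; split; first split=> [u v|u|u].
- by rewrite mxE; case: (_ && _).
- by rewrite mxE; case: eqP => [->|]//=; rewrite (negbTE xy).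
- rewrite /divergence (bigD1 y)//= [X in _ + X - _]big1 => [|j jy]; last first.
    by rewrite mxE (negbTE jy) andbF.
  rewrite [X in _ - X](bigD1 x)//= [X in _ - (_ + X)]big1 => [|j jx]; last first.
    by rewrite mxE (negbTE jx).
  by rewrite !addr0 !mxE !eqxx andbT.
- rewrite /flow_cost (bigD1 x)//= (bigD1 y)//= big1 ?addr0; last first.
    by move=> i iy; rewrite mxE (negbTE iy) andbF mul0r.
  rewrite big1 ?addr0; first by rewrite mxE !eqxx mul1r.
  by move=> i ix; rewrite big1// => j _; rewrite mxE (negbTE ix) mul0r.
Qed.

(** Each coordinate is routed along the single edge between its point and [i0], in the direction
    given by its sign. *)
Lemma flow_exists z : exists rho, flow rho (proj z).
Proof.
have edge (x : 'I_N) (s : R) : exists rho, flow rho (proj (s *: delta_mx 0 x)).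
  have sumd : \sum_i (s *: delta_mx 0 x : 'rV[R]_N) 0 i = s.
    rewrite (bigD1 x)//= !mxE !eqxx mulr1 big1 ?addr0// => i ix.
    by rewrite !mxE (negbTE ix) mulr0.
  rewrite /proj sumd -scalerBr; have [->|xi0] := eqVneq x i0.
    exists 0; rewrite subrr scaler0; split=> [u v|u|u]; rewrite ?mxE//.
    by rewrite /divergence !big1 ?subrr// => i _; rewrite mxE.
  have [s0|s0] := leP 0 s.
    exists (s *: delta_mx x i0); apply: flowZ => //; exact: (edge_flow xi0).1.
  exists ((- s) *: delta_mx i0 x).
  have -> : s *: (delta_mx 0 x - delta_mx 0 i0) =
      (- s) *: (delta_mx 0 i0 - delta_mx 0 x) :> 'rV[R]_N.
    by rewrite scaleNr -scalerN opprB.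
  apply: flowZ; first by rewrite oppr_ge0 ltW.
  by apply: (edge_flow _).1; rewrite eq_sym.
rewrite [z]row_sum_delta; elim/big_ind : _ => [|u v [r ru] [r' rv]|i _].
- have [r] := edge i0 0; rewrite scale0r => ?; by exists r.
- by exists (r + r'); rewrite projD; exact: flowD.
- exact: edge.
Qed.

Let V_lb z : has_lbound [set flow_cost rho | rho in [set rho | flow rho (proj z)]].
Proof. by exists 0 => _ [rho [r0 _ _] <-]; exact: flow_cost_ge0. Qed.

Let V_le rho z : flow rho (proj z) -> V z <= flow_cost rho.
Proof. by move=> fr; apply: ge_inf; [exact: V_lb|exists rho]. Qed.

Let V_adh z e : 0 < e -> exists2 rho, flow rho (proj z) & flow_cost rho <= V z + e.
Proof.
move=> e0.
have [|_ [rho fr <-] lt] := @inf_adherent R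
    [set flow_cost rho | rho in [set rho | flow rho (proj z)]] e e0.
  by split; [have [rho fr] := flow_exists z; exists (flow_cost rho), rho|exact: V_lb].
by exists rho => //; exact: ltW.
Qed.

Let V_sublinear : sublinear V.
Proof.
split=> [z z'|].
  apply/ler_addgt0Pr => e e0; have e2 : 0 < e / 2 by rewrite divr_gt0.
  have [r fr rV] := V_adh z e2; have [r' fr' rV'] := V_adh z' e2.
  have := V_le (z := z + z') (rho := r + r'); rewrite projD flow_costD => /(_ (flowD fr fr')).
  by lra.
have H (s : R) z : 0 <= s -> V (s *: z) <= s * V z.
  move=> s0; apply/ler_addgt0Pr => e e0.
  have es : 0 < e / (s + 1) by rewrite divr_gt0// ltr_wpDl.
  have [r fr rV] := V_adh z es.
  have := V_le (z := s *: z) (rho := s *: r); rewrite projZ flow_costZ => /(_ (flowZ s0 fr)).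
  move=> /le_trans; apply; apply: (le_trans (ler_wpM2l s0 rV)).
  rewrite mulrDr lerD2l mulrA ler_pdivrMr ?ltr_wpDl// mulrC ler_wpM2l ?ltW//.
  lra.
move=> s z; rewrite le_eqVlt => /predU1P[<-|s0].
  rewrite mul0r; apply/eqP; rewrite eq_le; apply/andP; split.
    by have := H 0 z (lexx 0); rewrite mul0r.
  apply: lb_le_inf.
    by have [r fr] := flow_exists (0 *: z); exists (flow_cost r), r.
  by move=> _ [r [r0 _ _] <-]; exact: flow_cost_ge0.
apply/eqP; rewrite eq_le (H _ _ (ltW s0))/= -ler_pdivlMl//.
apply: le_trans (H _ _ _); last by rewrite ltW// invr_gt0.
by rewrite scalerA mulVf ?gt_eqF// scale1r.
Qed.

Let proj_id z : \sum_i z 0 i = 0 -> proj z = z.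
Proof. by move=> z0; rewrite /proj z0 scale0r subr0. Qed.

(* Linear programming duality for min-cost flows: a linear functional below
   the (sublinear) optimal value is a potential. *)
Theorem flow_duality z e : \sum_i z 0 i = 0 -> 0 < e ->
  exists2 rho, flow rho z & flow_cost rho <= support_fun z + e.
Proof.
move=> z0 e0; have [a [aV aE]] := hahn_banach_rV z V_sublinear.
have aP : potential a.
  move=> x y; have [->|xy] := eqVneq x y; first by rewrite subrr c0.
  have [fl fc] := edge_flow xy.
  have s0 : \sum_i (delta_mx 0 x - delta_mx 0 y : 'rV[R]_N) 0 i = 0.
    rewrite (bigD1 x)//= (bigD1 y) 1?eq_sym//= !mxE !eqxx (negbTE xy) eq_sym (negbTE xy)/=.
    by rewrite big1 ?addr0 ?subr0 ?sub0r ?subrr// => i /andP[ix iy]; rewrite !mxE (negbTE ix) (negbTE iy) subrr.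
  have := V_le (z := delta_mx 0 x - delta_mx 0 y) (rho := delta_mx x y).
  rewrite (proj_id s0) fc => /(_ fl); apply: le_trans.
  have := aV (delta_mx 0 x - delta_mx 0 y).
  by rewrite dotDr dotNr !(dotC a) !dot_delta.
have [rho fr rV] := V_adh z e0; rewrite proj_id// in fr.
exists rho => //; apply: (le_trans rV); rewrite lerD2r -aE.
exact: potential_le_support.
Qed.

End min_cost_flow.

End potentials_polytope.

(** * Gromov-Wasserstein couplings near the null hypothesis *)

Section gw_objective.
Context {R : realType} (p : R) {N0 N1 : nat}.
Variables (k0 : 'I_N0 -> 'I_N0 -> R) (k1 : 'I_N1 -> 'I_N1 -> R).
Hypothesis p0 : 0 < p.
Local Notation D := (Delta p k0 k1).
Implicit Types pi : 'M[R]_(N0, N1).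

Definition objective pi : R :=
  \sum_x \sum_y \sum_x' \sum_y' D x y x' y' * pi x y * pi x' y'.

Definition GWp (w0 : 'rV[R]_N0) (w1 : 'rV[R]_N1) : R := inf [set objective pi | pi in couplings w0 w1].

Definition Delta_sum : R :=
  \sum_(u : 'I_N0 * 'I_N1) \sum_(v : 'I_N0 * 'I_N1) D u.1 u.2 v.1 v.2.

Lemma Delta_ge0 x y x' y' : 0 <= D x y x' y'.
Proof. exact: powR_ge0. Qed.

Lemma Delta_eq0 x y x' y' : D x y x' y' = 0 -> k0 x x' = k1 y y'.
Proof.
by move/eqP; rewrite powR_eq0 normr_eq0 subr_eq0 (gt_eqF p0) andbT => /eqP.
Qed.

Lemma Delta_le_sum x y x' y' : D x y x' y' <= Delta_sum.
Proof.
rewrite /Delta_sum (bigD1 (x, y))//= (bigD1 (x', y'))//= -!addrA lerDl addr_ge0//.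
  by apply: sumr_ge0 => v _; exact: Delta_ge0.
by apply: sumr_ge0 => u _; apply: sumr_ge0 => v _; exact: Delta_ge0.
Qed.

Lemma Delta_sum_ge0 : 0 <= Delta_sum.
Proof. by apply: sumr_ge0 => u _; apply: sumr_ge0 => v _; exact: Delta_ge0. Qed.

Lemma objectiveE pi : objective pi = \sum_(u : 'I_N0 * 'I_N1) \sum_(v : 'I_N0 * 'I_N1)
  D u.1 u.2 v.1 v.2 * pi u.1 u.2 * pi v.1 v.2.
Proof.
rewrite /objective pair_bigA; apply: eq_bigr => u _ /=.
by rewrite pair_bigA.
Qed.

Lemma objective_ge0 pi : (forall x y, 0 <= pi x y) -> 0 <= objective pi.
Proof.
move=> pi0; rewrite objectiveE; apply: sumr_ge0 => u _; apply: sumr_ge0 => v _.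
by rewrite !mulr_ge0// Delta_ge0.
Qed.

Lemma GWp_lb (w0 : 'rV[R]_N0) (w1 : 'rV[R]_N1) : lbound [set objective pi | pi in couplings w0 w1] 0.
Proof. by move=> _ [pi [pi0 _ _] <-]; exact: objective_ge0. Qed.

Lemma GWp_le pi (w0 : 'rV[R]_N0) (w1 : 'rV[R]_N1) : couplings w0 w1 pi -> GWp w0 w1 <= objective pi.
Proof. by move=> cpi; apply: ge_inf; [exists 0; exact: GWp_lb|exists pi]. Qed.

Lemma product_coupling (w0 : 'rV[R]_N0) (w1 : 'rV[R]_N1) : simplex w0 -> simplex w1 ->
  couplings w0 w1 (\matrix_(x, y) (w0 0 x * w1 0 y)).
Proof.
move=> [w00 w01] [w10 w11]; split=> [x y|x|y]; first by rewrite mxE mulr_ge0.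
  by under eq_bigr do rewrite mxE; rewrite -mulr_sumr w11 mulr1.
by under eq_bigr do rewrite mxE; rewrite -mulr_suml w01 mul1r.
Qed.

Lemma GWp_ge0 (w0 : 'rV[R]_N0) (w1 : 'rV[R]_N1) : simplex w0 -> simplex w1 -> 0 <= GWp w0 w1.
Proof.
move=> s0 s1; apply: lb_le_inf; last exact: GWp_lb.
by exists (objective (\matrix_(x, y) (w0 0 x * w1 0 y))),
  (\matrix_(x, y) (w0 0 x * w1 0 y)) => //; exact: product_coupling.
Qed.

Lemma GW_powR (w0 : 'rV[R]_N0) (w1 : 'rV[R]_N1) : simplex w0 -> simplex w1 -> GW p k0 k1 w0 w1 `^ p = GWp w0 w1.
Proof.
move=> s0 s1; have g0 := GWp_ge0 s0 s1.
by rewrite /GW -/(GWp w0 w1) -powRrM mulVf ?gt_eqF// powRr1.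
Qed.

Lemma GWp_adh (w0 : 'rV[R]_N0) (w1 : 'rV[R]_N1) e : simplex w0 -> simplex w1 -> 0 < e ->
  exists2 pi, couplings w0 w1 pi & objective pi <= GWp w0 w1 + e.
Proof.
move=> s0 s1 e0.
have [|_ [pi cpi <-] lt] := @inf_adherent R
    [set objective pi | pi in couplings w0 w1] e e0; last by exists pi => //; exact: ltW.
split; last by exists 0; exact: GWp_lb.
by exists (objective (\matrix_(x, y) (w0 0 x * w1 0 y))),
  (\matrix_(x, y) (w0 0 x * w1 0 y)) => //; exact: product_coupling.
Qed.

Definition l1_dist (pi pi' : 'M[R]_(N0, N1)) : R := \sum_(u : 'I_N0 * 'I_N1) `|pi u.1 u.2 - pi' u.1 u.2|.

Lemma coupling_total pi (w0 : 'rV[R]_N0) (w1 : 'rV[R]_N1) : simplex w0 -> couplings w0 w1 pi ->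
  \sum_(u : 'I_N0 * 'I_N1) pi u.1 u.2 = 1.
Proof.
move=> [_ w01] [_ pi1 _]; rewrite -(pair_bigA _ (fun x y => pi x y))/= -w01.
by apply: eq_bigr => x _.
Qed.

(** Termwise, a'b' - ab = (a' - a) b' + a (b' - b); since both total masses are 1, each half
    contributes one l1 distance. *)
Lemma objective_lip (pi pi' : 'M[R]_(N0, N1)) : (forall x y, 0 <= pi x y) -> (forall x y, 0 <= pi' x y) ->
  \sum_(u : 'I_N0 * 'I_N1) pi u.1 u.2 = 1 -> \sum_(u : 'I_N0 * 'I_N1) pi' u.1 u.2 = 1 ->
  objective pi' <= objective pi + 2 * Delta_sum * l1_dist pi pi'.
Proof.
move=> pi0 pi0' pi1 pi1'; rewrite -lerBlDl !objectiveE -sumrB.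
apply: (@le_trans _ _ (\sum_(u : 'I_N0 * 'I_N1) \sum_(v : 'I_N0 * 'I_N1)
  Delta_sum * (`|pi u.1 u.2 - pi' u.1 u.2| * pi' v.1 v.2 +
    pi u.1 u.2 * `|pi v.1 v.2 - pi' v.1 v.2|))).
  apply: ler_sum => u _; rewrite -sumrB; apply: ler_sum => v _.
  have d0 := Delta_ge0 u.1 u.2 v.1 v.2; have dS := Delta_le_sum u.1 u.2 v.1 v.2.
  set d := D _ _ _ _ in d0 dS *.
  have a0 := pi0 u.1 u.2; have b0 := pi0' v.1 v.2.
  set a := pi u.1 u.2 in a0 *; set a' := pi' u.1 u.2.
  set b := pi v.1 v.2; set b' := pi' v.1 v.2 in b0 *.
  have E0 : 0 <= `|a - a'| * b' + a * `|b - b'| by rewrite addr_ge0// mulr_ge0.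
  have E : a' * b' - a * b <= `|a - a'| * b' + a * `|b - b'|.
    have h1 : (a' - a) * b' <= `|a - a'| * b'.
      by rewrite ler_wpM2r// distrC ler_norm.
    have h2 : a * (b' - b) <= a * `|b - b'|.
      by rewrite ler_wpM2l// distrC ler_norm.
    lra.
  apply: le_trans (ler_wpM2r E0 dS).
  by have := ler_wpM2l d0 E; lra.
under eq_bigr do rewrite -mulr_sumr big_split/= -mulr_sumr -mulr_sumr pi1' mulr1.
rewrite -mulr_sumr big_split/= -mulr_suml pi1 mul1r -/(l1_dist pi pi').
by rewrite /l1_dist; lra.
Qed.

End gw_objective.

Definition l1norm {R : realType} {N} (w : 'rV[R]_N) : R := \sum_i `|w 0 i|.

(* Rows are scaled down to the new marginal; the removed mass is put back as a
   product measure.  All divisions by zero occur at zero mass. *)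
Lemma change_first_marginal (R : realType) (N0 N1 : nat) (w0 w0' : 'rV[R]_N0)
    (w1 : 'rV[R]_N1) pi :
  simplex w0 -> simplex w0' -> couplings w0 w1 pi ->
  exists2 pi', couplings w0' w1 pi' & l1_dist pi pi' <= 2 * l1norm (w0 - w0').
Proof.
move=> [a0 a1] [b0 b1] [pi0 pirow picol].
pose m x := Num.min (w0 0 x) (w0' 0 x).
have m0 x : 0 <= m x by rewrite le_min a0 b0.
have ma x : m x <= w0 0 x by rewrite ge_min lexx.
have mb x : m x <= w0' 0 x by rewrite ge_min lexx orbT.
pose f x := m x / w0 0 x.
have f0 x : 0 <= f x by rewrite divr_ge0.
have f1 x : f x <= 1.
  have [ax|ax] := eqVneq (w0 0 x) 0; first by rewrite /f ax invr0 mulr0 ler01.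
  by rewrite ler_pdivrMr ?mul1r// lt_neqAle eq_sym ax a0.
have fa x : f x * w0 0 x = m x.
  have [ax|ax] := eqVneq (w0 0 x) 0; last by rewrite /f divfK.
  by rewrite ax mulr0; apply/esym/eqP; rewrite eq_le m0 andbT -ax.
pose nu y := \sum_x (1 - f x) * pi x y.
have nu0 y : 0 <= nu y by apply: sumr_ge0 => x _; rewrite mulr_ge0// subr_ge0.
pose t := \sum_y nu y.
have tE : t = \sum_x (w0 0 x - m x).
  rewrite /t exchange_big; apply: eq_bigr => x _ /=.
  by rewrite -mulr_sumr pirow mulrBl mul1r fa.
have tE' : t = \sum_x (w0' 0 x - m x) by rewrite tE !sumrB a1 b1.
have t0 : 0 <= t by apply: sumr_ge0.
have tt x : (w0' 0 x - m x) * (t / t) = w0' 0 x - m x.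
  have [tz|tn0] := eqVneq t 0; last by rewrite divff// mulr1.
  rewrite tz mul0r mulr0; apply/esym/eqP; move/eqP: tE'; rewrite tz eq_sym.
  rewrite psumr_eq0; first by move/allP/(_ x (mem_index_enum _)).
  by move=> i _; rewrite subr_ge0.
have nt y : nu y * (t / t) = nu y.
  have [tz|tn0] := eqVneq t 0; last by rewrite divff// mulr1.
  rewrite tz mul0r mulr0; apply/esym/eqP; move/eqP: tz.
  by rewrite /t psumr_eq0//; move/allP/(_ y (mem_index_enum _)).
pose pi' : 'M[R]_(N0, N1) := \matrix_(x, y) (f x * pi x y + (w0' 0 x - m x) * nu y / t).
exists pi'.
  split=> [x y|x|y].
  - by rewrite mxE addr_ge0// ?divr_ge0// mulr_ge0// subr_ge0.
  - under eq_bigr do rewrite mxE; rewrite big_split/= -mulr_sumr pirow fa.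
    by rewrite -mulr_suml -mulr_sumr -/t -mulrA tt; lra.
  - under eq_bigr do rewrite mxE; rewrite big_split/=.
    under [X in _ + X]eq_bigr do rewrite -mulrA.
    rewrite -mulr_suml -tE' mulrCA nt /nu.
    under [X in _ + X]eq_bigr do rewrite mulrBl mul1r.
    by rewrite sumrB picol; lra.
(* Scaling removes mass [t] and the product measure restores mass [t], whence the factor 2; [t] is
   at most the l1 distance of the marginals. *)
apply: (@le_trans _ _ (\sum_(u : 'I_N0 * 'I_N1)
   ((1 - f u.1) * pi u.1 u.2 + (w0' 0 u.1 - m u.1) * nu u.2 / t))).
  apply: ler_sum => u _; rewrite mxE.
  have e1 : 0 <= (1 - f u.1) * pi u.1 u.2 by rewrite mulr_ge0// subr_ge0.
  have e2 : 0 <= (w0' 0 u.1 - m u.1) * nu u.2 / t.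
    by rewrite divr_ge0// mulr_ge0// subr_ge0.
  by rewrite ler_norml; lra.
rewrite big_split/= -(pair_bigA _ (fun x y => (1 - f x) * pi x y))/=.
rewrite -(pair_bigA _ (fun x y => (w0' 0 x - m x) * nu y / t))/=.
have -> : \sum_x \sum_y (1 - f x) * pi x y = t by rewrite exchange_big.
have -> : \sum_x \sum_y (w0' 0 x - m x) * nu y / t = t.
  rewrite [RHS]tE'; apply: eq_bigr => x _.
  by rewrite -mulr_suml -mulr_sumr -/t -mulrA tt.
have tl : t <= l1norm (w0 - w0').
  rewrite tE; apply: ler_sum => x _; rewrite !mxE /m.
  have [ab|ba] := leP (w0 0 x) (w0' 0 x); first by rewrite subrr.
  by rewrite ler_norm.
lra.
Qed.

Lemma coupling_tr (R : realType) (N0 N1 : nat) (w0 : 'rV[R]_N0) (w1 : 'rV[R]_N1) pi :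
  couplings w0 w1 pi -> couplings w1 w0 pi^T.
Proof.
move=> [pi0 pirow picol]; split=> [x y|x|y]; first by rewrite mxE.
  by under eq_bigr do rewrite mxE.
by under eq_bigr do rewrite mxE.
Qed.

Lemma change_second_marginal (R : realType) (N0 N1 : nat) (w0 : 'rV[R]_N0)
    (w1 w1' : 'rV[R]_N1) pi :
  simplex w1 -> simplex w1' -> couplings w0 w1 pi ->
  exists2 pi', couplings w0 w1' pi' & l1_dist pi pi' <= 2 * l1norm (w1 - w1').
Proof.
move=> s1 s1' /coupling_tr cpi.
have [pi' cpi' ppi'] := change_first_marginal s1 s1' cpi.
exists pi'^T; first exact: coupling_tr.
apply: le_trans ppi'; rewrite le_eqVlt; apply/orP; left; apply/eqP.
rewrite /l1_dist -(pair_bigA _ (fun x y => `|pi x y - pi'^T x y|))/=.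
rewrite -(pair_bigA _ (fun x y => `|pi^T x y - pi' x y|))/= exchange_big/=.
by apply: eq_bigr => x _; apply: eq_bigr => y _; rewrite !mxE.
Qed.

(** The marginals of a nearly optimal coupling are changed one after the other; 4 is the product of
    the factors 2 of [objective_lip] and of the change of marginal. *)
Lemma GWp_lip (R : realType) (p : R) (N0 N1 : nat) (k0 : 'I_N0 -> 'I_N0 -> R)
    (k1 : 'I_N1 -> 'I_N1 -> R) (w0 w0' : 'rV[R]_N0) (w1 w1' : 'rV[R]_N1) :
  simplex w0 -> simplex w0' -> simplex w1 -> simplex w1' ->
  GWp p k0 k1 w0' w1' <= GWp p k0 k1 w0 w1 +
    4 * Delta_sum p k0 k1 * (l1norm (w0 - w0') + l1norm (w1 - w1')).
Proof.
move=> s0 s0' s1 s1'; apply/ler_addgt0Pr => e e0.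
have [pi cpi pie] := GWp_adh p k0 k1 s0 s1 e0.
have [pi1 cpi1 d1] := change_first_marginal s0 s0' cpi.
have [pi2 cpi2 d2] := change_second_marginal s1 s1' cpi1.
have DS := Delta_sum_ge0 p k0 k1.
have tot (w : 'rV[R]_N0) (w' : 'rV[R]_N1) r : simplex w -> couplings w w' r ->
  \sum_(u : 'I_N0 * 'I_N1) r u.1 u.2 = 1 by exact: coupling_total.
have nn (w : 'rV[R]_N0) (w' : 'rV[R]_N1) r : couplings w w' r ->
  forall x y, 0 <= r x y by case.
have h1 := objective_lip p k0 k1 (nn _ _ _ cpi) (nn _ _ _ cpi1)
  (tot _ _ _ s0 cpi) (tot _ _ _ s0' cpi1).
have h2 := objective_lip p k0 k1 (nn _ _ _ cpi1) (nn _ _ _ cpi2)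
  (tot _ _ _ s0' cpi1) (tot _ _ _ s0' cpi2).
have h3 := GWp_le p k0 k1 cpi2.
have h4 := ler_wpM2l DS d1; have h5 := ler_wpM2l DS d2.
lra.
Qed.

(** * The isomorphism behind a vanishing distance *)

Section null_isomorphism.
Context {R : realType} (p : R) {N0 N1 : nat}.
Variables (k0 : 'I_N0 -> 'I_N0 -> R) (k1 : 'I_N1 -> 'I_N1 -> R).
Hypothesis p0 : 0 < p.
Variables (w0 : 'rV[R]_N0) (w1 : 'rV[R]_N1).
Hypotheses (s0 : simplex w0) (s1 : simplex w1).

(** Flattened to row vectors, the couplings form a closed subset of the unit cube, on which the
    continuous objective attains its minimum. *)
Lemma optimal_coupling : exists2 pi, couplings w0 w1 pi & objective p k0 k1 pi <= GWp p k0 k1 w0 w1.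
Proof.
have vE (v : 'rV[R]_(N0 * N1)) x y : vec_mx v x y = v 0 (mxvec_index x y).
  by rewrite -mxvecE vec_mxK.
pose A := [set v : 'rV[R]_(N0 * N1) | couplings w0 w1 (vec_mx v)].
have cc (i : 'I_(N0 * N1)) : continuous (fun v : 'rV[R]_(N0 * N1) => v 0 i).
  exact: coord_continuous.
have cA : compact A.
  have AE : A = \bigcap_(x in [set: 'I_N0]) \bigcap_(y in [set: 'I_N1])
        [set v : 'rV[R]_(N0 * N1) | - v 0 (mxvec_index x y) <= 0] `&`
      (\bigcap_(x in [set: 'I_N0])
        [set v : 'rV[R]_(N0 * N1) | \sum_y v 0 (mxvec_index x y) = w0 0 x] `&`
      \bigcap_(y in [set: 'I_N1])
        [set v : 'rV[R]_(N0 * N1) | \sum_x v 0 (mxvec_index x y) = w1 0 y]).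
    apply/seteqP; split=> [v [v0 vr vc]|v [v0 [vr vc]]].
      split; first by move=> x _ y _ /=; rewrite oppr_le0 -vE.
      split; first by move=> x _ /=; under eq_bigr do rewrite -vE.
      by move=> y _ /=; under eq_bigr do rewrite -vE.
    split=> [x y|x|y]; first by have := v0 x I y I; rewrite /= oppr_le0 vE.
      by under eq_bigr do rewrite vE; exact: (vr x I).
    by under eq_bigr do rewrite vE; exact: (vc y I).
  apply: (subclosed_compact _ (@compact_cube R (N0 * N1) 1)).
    rewrite AE; apply: closedI; [|apply: closedI].
    - apply: closed_bigI => x _; apply: closed_bigI => y _; apply: closed_sublevel.
      apply: (continuous_compR (h := -%R)); first exact: cc.
      by move=> r; apply: cvgN; exact: cvg_id.
    - apply: closed_bigI => x _.
      apply: (@closed_comp _ _ (fun v : 'rV[R]_(N0 * N1) => \sum_y v 0 (mxvec_index x y))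
        [set r | r = w0 0 x]) => [v _|]; last exact: closed_eq.
      by apply: continuous_sum => y; exact: cc.
    - apply: closed_bigI => y _.
      apply: (@closed_comp _ _ (fun v : 'rV[R]_(N0 * N1) => \sum_x v 0 (mxvec_index x y))
        [set r | r = w1 0 y]) => [v _|]; last exact: closed_eq.
      by apply: continuous_sum => x; exact: cc.
  move=> v [v0 vr vc] i; case/mxvec_indexP: i => x y; rewrite -vE ger0_norm//.
  have [a0 a1] := s0; rewrite -a1 (bigD1 x)//= -vr (bigD1 y)//= -addrA lerDl addr_ge0//.
    exact: sumr_ge0.
  by apply: sumr_ge0.
have [||v vA vmin] := @EVT_min_rV R (N0 * N1)
    (fun v => objective p k0 k1 (vec_mx v)) A _ cA.
- exists (mxvec (\matrix_(x, y) (w0 0 x * w1 0 y))); rewrite /A/= mxvecK.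
  exact: product_coupling.
- apply: continuous_subspaceT; apply: continuous_sum => x; apply: continuous_sum => y.
  apply: continuous_sum => x'; apply: continuous_sum => y'.
  apply: continuous_mul; first apply: continuous_mul.
  + exact: continuous_cst.
  + by under eq_fun do rewrite vE; exact: cc.
  + by under eq_fun do rewrite vE; exact: cc.
rewrite inE in vA; exists (vec_mx v) => //; apply/ler_addgt0Pr => e e0.
have [pi cpi pie] := GWp_adh p k0 k1 s0 s1 e0.
apply: le_trans pie; have := vmin (mxvec pi); rewrite mxvecK; apply.
by rewrite inE /A/= mxvecK.
Qed.

Hypotheses (f0 : full_support w0) (f1 : full_support w1).
Hypothesis inj0 : forall x x', x <> x' -> k0 x <> k0 x'.
Hypothesis inj1 : forall y y', y <> y' -> k1 y <> k1 y'.

(** An optimal coupling has objective 0, so [Delta] vanishes on pairs of its support. Full support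
    makes the support meet every row and column, and distinctness of the kernel rows makes it the
    graph of a bijection. *)
Lemma null_iso_exists : GW p k0 k1 w0 w1 = 0 -> exists S T,
  [/\ null_isos k0 k1 w0 w1 S, cancel S T & cancel T S].
Proof.
move=> GW0.
have G0 : GWp p k0 k1 w0 w1 = 0 by rewrite -(GW_powR k0 k1 p0)// GW0 powR0// gt_eqF.
have [pi [pi0 pirow picol] pile] := optimal_coupling.
have supp x y x' y' : 0 < pi x y -> 0 < pi x' y' -> k0 x x' = k1 y y'.
  move=> xy xy'; apply: (@Delta_eq0 _ p _ _ _ _ p0).
  have : objective p k0 k1 pi = 0.
    by apply/eqP; rewrite eq_le objective_ge0// andbT -G0.
  rewrite objectiveE => /eqP; rewrite psumr_eq0; last first.
    by move=> u _; apply: sumr_ge0 => v _; rewrite !mulr_ge0// Delta_ge0.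
  move=> /allP/(_ (x, y) (mem_index_enum _)); rewrite /= psumr_eq0; last first.
    by move=> v _; rewrite !mulr_ge0// Delta_ge0.
  move=> /allP/(_ (x', y') (mem_index_enum _)) /=.
  by rewrite !mulf_eq0 (gt_eqF xy) (gt_eqF xy') !orbF => /eqP.
have rowS x : exists y, 0 < pi x y.
  apply: contrapT => nex; have := f0 x; rewrite -pirow big1 ?ltxx// => y _.
  apply/eqP; rewrite eq_le pi0 andbT leNgt; apply/negP => xy; apply: nex; by exists y.
have colS y : exists x, 0 < pi x y.
  apply: contrapT => nex; have := f1 y; rewrite -picol big1 ?ltxx// => x _.
  apply/eqP; rewrite eq_le pi0 andbT leNgt; apply/negP => xy; apply: nex; by exists x.
(* Every [z] is coupled with some [u], so k1 y z and k1 y' z both equal k0 x u. *)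
have row1 x y y' : 0 < pi x y -> 0 < pi x y' -> y = y'.
  move=> xy xy'; apply: contrapT => /inj1; apply; apply/funext => z.
  by have [u uz] := colS z; rewrite -(supp _ _ _ _ xy uz) -(supp _ _ _ _ xy' uz).
have col1 x x' y : 0 < pi x y -> 0 < pi x' y -> x = x'.
  move=> xy xy'; apply: contrapT => /inj0; apply; apply/funext => z.
  by have [u uz] := rowS z; rewrite (supp _ _ _ _ xy uz) (supp _ _ _ _ xy' uz).
have /choice[S SP] := rowS; have /choice[T TP] := colS.
have ST : cancel S T by move=> x; apply: col1 (TP _) (SP _).
have TS : cancel T S by move=> y; apply: row1 (SP _) (TP _).
exists S, T; split=> //; split; first by split; [exists T|move=> x x'; exact: supp].
apply/rowP => y; rewrite mxE -picol (bigD1 (T y))//= [in RHS](big_pred1 (T y)); last first.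
  by move=> x; apply/eqP/eqP => [<-|->]; rewrite ?ST ?TS.
rewrite -pirow [in RHS](bigD1 y)//= !big1// => [z zy|x xT]; apply/eqP;
  rewrite eq_le pi0 andbT leNgt; apply/negP => h.
  by rewrite (row1 _ _ _ h (TP y)) eqxx in zy.
by rewrite (col1 _ _ _ h (TP y)) eqxx in xT.
Qed.

End null_isomorphism.

(** * Couplings obtained by displacing mass along a flow *)

Section upper_bound.
Context {R : realType} (p : R) {N0 N1 : nat}.
Variables (k0 : 'I_N0 -> 'I_N0 -> R) (k1 : 'I_N1 -> 'I_N1 -> R).
Hypothesis p0 : 0 < p.
Hypothesis Dsym : forall x y x' y', Delta p k0 k1 x y x' y' = Delta p k0 k1 x' y' x y.
Variables (S : 'I_N0 -> 'I_N1) (T : 'I_N1 -> 'I_N0).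
Hypotheses (ST : cancel S T) (TS : cancel T S).
Hypothesis kS : forall x x', k0 x x' = k1 (S x) (S x').
Local Notation DS := (Delta_sum p k0 k1).
Local Notation G x j x' j' := (Delta p k0 k1 x (S j) x' (S j')).

Lemma reindex_iso (F : 'I_N1 -> R) : \sum_y F y = \sum_j F (S j).
Proof.
apply: (reindex S); exists T => x _; [exact: ST|exact: TS].
Qed.

Let m (a : 'rV[R]_N0) (rho : 'M[R]_N0) x := a 0 x - \sum_j rho x j.

(** Mass rho x j goes from [x] to S j; what is left at [x] stays on the graph of [S]. *)
Let plan (a : 'rV[R]_N0) (rho : 'M[R]_N0) : 'M[R]_(N0, N1) :=
  \matrix_(x, y) (rho x (T y) + (T y == x)%:R * m a rho x).

Let sum_diag (F : 'I_N0 -> R) x : \sum_j (j == x)%:R * F j = F x.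
Proof.
rewrite (bigD1 x)//= eqxx mul1r big1 ?addr0// => j jx.
by rewrite (negbTE jx) mul0r.
Qed.

Lemma plan_coupling (a : 'rV[R]_N0) (b : 'rV[R]_N1) rho :
  flow rho (a - permute S b) -> (forall x, \sum_j rho x j <= a 0 x) ->
  couplings a b (plan a rho).
Proof.
move=> [r0 rd rdiv] ra; split=> [x y|x|y].
- by rewrite mxE addr_ge0// mulr_ge0// subr_ge0.
- rewrite reindex_iso; under eq_bigr do rewrite mxE ST.
  by rewrite big_split/= (sum_diag (fun=> m a rho x)) /m; lra.
- under eq_bigr do rewrite mxE eq_sym.
  rewrite big_split/= sum_diag /m.
  have := rdiv (T y); rewrite /divergence !mxE TS; lra.
Qed.

(** Pairs of graph points contribute 0 because [S] is an isometry, and the two mixed terms coincide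
    by [Dsym], which produces the factor 2. *)
Lemma objective_plan (a : 'rV[R]_N0) (rho : 'M[R]_N0) :
  objective p k0 k1 (plan a rho) =
  \sum_x \sum_j \sum_x' \sum_j' G x j x' j' * rho x j * rho x' j' +
  2 * \sum_x \sum_j rho x j * \sum_z G x j z z * m a rho z.
Proof.
have -> : objective p k0 k1 (plan a rho) = \sum_x \sum_j \sum_x' \sum_j'
    G x j x' j' * (rho x j + (j == x)%:R * m a rho x) *
      (rho x' j' + (j' == x')%:R * m a rho x').
  apply: eq_bigr => x _; rewrite reindex_iso; apply: eq_bigr => j _.
  apply: eq_bigr => x' _; rewrite reindex_iso; apply: eq_bigr => j' _.
  by rewrite !mxE !ST.
have D0 x x' : G x x x' x' = 0 by rewrite /Delta kS subrr normr0 powR0// gt_eqF.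
pose A x j := \sum_x' \sum_j' G x j x' j' * rho x j * rho x' j'.
pose B x j := rho x j * \sum_z G x j z z * m a rho z.
have inner x j : \sum_x' \sum_j' G x j x' j' * (rho x j + (j == x)%:R * m a rho x) *
      (rho x' j' + (j' == x')%:R * m a rho x') =
    A x j + B x j + (j == x)%:R * m a rho x * \sum_x' \sum_j' G x j x' j' * rho x' j'.
  have E x' : \sum_j' G x j x' j' * (rho x j + (j == x)%:R * m a rho x) *
        (rho x' j' + (j' == x')%:R * m a rho x') =
      \sum_j' G x j x' j' * rho x j * rho x' j' +
      rho x j * (G x j x' x' * m a rho x') +
      (j == x)%:R * m a rho x * \sum_j' G x j x' j' * rho x' j'.
    have F1 : \sum_j' (j' == x')%:R * (G x j x' j' * (rho x j + (j == x)%:R * m a rho x) * m a rho x')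
        = G x j x' x' * (rho x j + (j == x)%:R * m a rho x) * m a rho x'.
      by rewrite sum_diag.
    have F2 : (j == x)%:R * G x j x' x' = 0.
      by case: eqP => [->|_]; rewrite ?D0 ?mulr0// mul0r.
    transitivity (\sum_j' (G x j x' j' * rho x j * rho x' j' +
       (j == x)%:R * m a rho x * (G x j x' j' * rho x' j') +
       (j' == x')%:R * (G x j x' j' * (rho x j + (j == x)%:R * m a rho x) * m a rho x'))).
      by apply: eq_bigr => j' _; lra.
    rewrite !big_split/= F1 -mulr_sumr.
    have F3 : (j == x)%:R * G x j x' x' * (m a rho x * m a rho x') = 0 by rewrite F2 mul0r.
    by lra.
  under eq_bigr do rewrite E.
  by rewrite !big_split/= -!mulr_sumr.
under eq_bigr do under eq_bigr do rewrite inner.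
under eq_bigr do rewrite !big_split/=.
rewrite !big_split/= -/(A _ _).
have -> : \sum_x \sum_j (j == x)%:R * m a rho x * \sum_x' \sum_j' G x j x' j' * rho x' j' =
    \sum_x \sum_j B x j.
  under eq_bigr => x _.
    under eq_bigr do rewrite -mulrA.
    rewrite (sum_diag (fun j => m a rho x * \sum_x' \sum_j' G x j x' j' * rho x' j')).
    rewrite mulr_sumr; under eq_bigr do rewrite mulr_sumr.
    over.
  rewrite exchange_big/=; apply: eq_bigr => x' _; rewrite exchange_big/=.
  apply: eq_bigr => j' _; rewrite /B mulr_sumr; apply: eq_bigr => z _.
  by rewrite Dsym; lra.
by lra.
Qed.

(** The undisplaced mass is at most mu z + |a z - mu z|. Its first part turns the doubled mixed term
    into [flow_cost]; the second part and the purely displaced term form the second-order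
    remainder. *)
Lemma GWp_flow_bound (mu a : 'rV[R]_N0) (b : 'rV[R]_N1) rho :
  flow rho (a - permute S b) -> (forall x, \sum_j rho x j <= a 0 x) ->
  GWp p k0 k1 a b <= flow_cost (cost p k0 mu) rho +
    DS * (\sum_x \sum_j rho x j) * (\sum_x \sum_j rho x j + 2 * l1norm (a - mu)).
Proof.
move=> fr ra; have [r0 rd rdiv] := fr.
apply: (le_trans (GWp_le p k0 k1 (plan_coupling fr ra))).
rewrite objective_plan; set r := \sum_x \sum_j rho x j.
have rr0 : 0 <= r by apply: sumr_ge0 => x _; exact: sumr_ge0.
have DS0 := Delta_sum_ge0 p k0 k1.
have quad : \sum_x \sum_j \sum_x' \sum_j' G x j x' j' * rho x j * rho x' j' <= DS * r * r.
  have -> : DS * r * r = \sum_x \sum_j \sum_x' \sum_j' DS * rho x j * rho x' j'.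
    transitivity (\sum_x \sum_j DS * rho x j * r).
      by under eq_bigr do rewrite -mulr_suml -mulr_sumr; rewrite -mulr_suml -mulr_sumr.
    apply: eq_bigr => x _; apply: eq_bigr => j _; rewrite /r mulr_sumr.
    by apply: eq_bigr => x' _; rewrite mulr_sumr.
  apply: ler_sum => x _; apply: ler_sum => j _; apply: ler_sum => x' _.
  by apply: ler_sum => j' _; rewrite ler_wpM2r// ler_wpM2r// Delta_le_sum.
have lin x j : rho x j * \sum_z G x j z z * m a rho z <=
    rho x j * (2^-1 * cost p k0 mu x j + DS * l1norm (a - mu)).
  apply: ler_wpM2l => //; rewrite /cost mulrA mulVf// mul1r /l1norm mulr_sumr -big_split/=.
  apply: ler_sum => z _.
  have GE : G x j z z = `|k0 x z - k0 j z| `^ p by rewrite /Delta -kS.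
  have g0 := Delta_ge0 p k0 k1 x (S j) z (S z).
  have gD := Delta_le_sum p k0 k1 x (S j) z (S z).
  rewrite -GE; set g := G x j z z in g0 gD *.
  have mz : m a rho z <= mu 0 z + `|(a - mu) 0 z|.
    rewrite /m !mxE; have : 0 <= \sum_j rho z j by exact: sumr_ge0.
    by have := ler_norm (a 0 z - mu 0 z); lra.
  apply: (le_trans (ler_wpM2l g0 mz)); rewrite mulrDr lerD2l.
  exact: ler_wpM2r.
have tot : \sum_x \sum_j rho x j * (2^-1 * cost p k0 mu x j + DS * l1norm (a - mu)) =
    2^-1 * flow_cost (cost p k0 mu) rho + DS * l1norm (a - mu) * r.
  rewrite /flow_cost /r !mulr_sumr -big_split/=; apply: eq_bigr => x _.
  rewrite !mulr_sumr -big_split/=; apply: eq_bigr => j _; lra.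
have : \sum_x \sum_j rho x j * \sum_z G x j z z * m a rho z <=
    2^-1 * flow_cost (cost p k0 mu) rho + DS * l1norm (a - mu) * r.
  by rewrite -tot; apply: ler_sum => x _; apply: ler_sum => j _.
lra.
Qed.

End upper_bound.

Section l1norm_lemmas.
Context {R : realType}.

Lemma l1norm_ge0 N (w : 'rV[R]_N) : 0 <= l1norm w.
Proof. exact: sumr_ge0. Qed.

Lemma l1normZ N (s : R) (w : 'rV[R]_N) : 0 <= s -> l1norm (s *: w) = s * l1norm w.
Proof.
move=> s0; rewrite /l1norm mulr_sumr; apply: eq_bigr => i _.
by rewrite mxE normrM ger0_norm.
Qed.

Lemma l1normB N (v w : 'rV[R]_N) : l1norm (v - w) <= l1norm v + l1norm w.
Proof.
rewrite /l1norm -big_split/=; apply: ler_sum => i _; rewrite !mxE.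
exact: ler_normB.
Qed.

Lemma l1norm_le_norm N (w : 'rV[R]_N) : l1norm w <= N%:R * `|w|.
Proof.
rewrite /l1norm; apply: (@le_trans _ _ (\sum_(i < N) `|w|)).
  by apply: ler_sum => i _; exact: ler_coord_norm.
by rewrite sumr_const card_ord mulr_natl.
Qed.

Lemma coord_le_l1norm N (w : 'rV[R]_N) i : `|w 0 i| <= l1norm w.
Proof. by rewrite /l1norm (bigD1 i)//= lerDl sumr_ge0. Qed.

End l1norm_lemmas.

Section null_cost.
Context {R : realType} (p : R) {N : nat}.
Variables (k0 : 'I_N -> 'I_N -> R) (mu : 'rV[R]_N).
Hypotheses (p0 : 0 < p) (fmu : full_support mu).
Hypothesis inj0 : forall x x', x <> x' -> k0 x <> k0 x'.

Lemma cost_diag x : cost p k0 mu x x = 0.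
Proof.
rewrite /cost big1 ?mulr0// => z _.
by rewrite subrr normr0 powR0 ?mul0r// gt_eqF.
Qed.

Lemma cost_gt0 x y : x != y -> 0 < cost p k0 mu x y.
Proof.
move=> /eqP/inj0 kxy; rewrite /cost mulr_gt0//.
have [z kz] : exists z, k0 x z != k0 y z.
  apply: contrapT => nex; apply: kxy; apply/funext => z; apply/eqP/negPn/negP => kz.
  by apply: nex; exists z.
rewrite (bigD1 z)//= ltr_pwDl//.
  by rewrite mulr_gt0// powR_gt0// normr_gt0 subr_eq0.
by apply: sumr_ge0 => i _; rewrite mulr_ge0 ?powR_ge0// ltW.
Qed.

End null_cost.

Section asymptotic_bound.
Context {R : realType} (p : R) {N0 N1 : nat}.
Variables (k0 : 'I_N0 -> 'I_N0 -> R) (k1 : 'I_N1 -> 'I_N1 -> R).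
Hypothesis p0 : 0 < p.
Hypothesis Dsym : forall x y x' y', Delta p k0 k1 x y x' y' = Delta p k0 k1 x' y' x y.
Variables (mu0 : 'rV[R]_N0) (mu1 : 'rV[R]_N1).
Hypothesis f0 : full_support mu0.
Hypothesis inj0 : forall x x', x <> x' -> k0 x <> k0 x'.
Variables (S : 'I_N0 -> 'I_N1) (T : 'I_N1 -> 'I_N0).
Hypotheses (ST : cancel S T) (TS : cancel T S).
Hypothesis nS : null_isos k0 k1 mu0 mu1 S.
Variable i0 : 'I_N0.
Local Notation DS := (Delta_sum p k0 k1).
Local Notation c := (cost p k0 mu0).
Local Notation psi := (support_fun i0 c).

Lemma permute_mu1 : permute S mu1 = mu0.
Proof.
have [_ ->] := nS; apply/rowP => x; rewrite !mxE (big_pred1 x)// => x'.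
by apply/eqP/eqP => [/(can_inj ST)|->].
Qed.

Lemma permuteB (v w : 'rV[R]_N1) : permute S (v - w) = permute S v - permute S w.
Proof. by apply/rowP => x; rewrite !mxE. Qed.

Lemma permuteZ (s : R) (v : 'rV[R]_N1) : permute S (s *: v) = s *: permute S v.
Proof. by apply/rowP => x; rewrite !mxE. Qed.

Lemma l1norm_permute (v : 'rV[R]_N1) : l1norm (permute S v) = l1norm v.
Proof.
rewrite /l1norm [RHS](reindex_iso ST TS); apply: eq_bigr => x _.
by rewrite mxE.
Qed.

Lemma sum_permute (v : 'rV[R]_N1) : \sum_x permute S v 0 x = \sum_y v 0 y.
Proof.
by rewrite [RHS](reindex_iso ST TS); apply: eq_bigr => x _; rewrite mxE.
Qed.

(** With r = sqrt n, a nearly optimal flow has mass at most K2/r because off-diagonal costs are at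
    least [eta]. The remainder of [GWp_flow_bound] is then at most Q/r^2, still small after
    multiplication by r. The threshold is uniform over deviations bounded by [K]. *)
Lemma GWp_asymptotic K e : 0 < K -> 0 < e -> exists n0 : nat, forall n, (n0 <= n)%N ->
  forall (a : 'rV[R]_N0) (b : 'rV[R]_N1), simplex a -> simplex b ->
  l1norm (Num.sqrt n%:R *: (a - mu0)) <= K -> l1norm (Num.sqrt n%:R *: (b - mu1)) <= K ->
  Num.sqrt n%:R * GWp p k0 k1 a b <= psi (Num.sqrt n%:R *: (a - permute S b)) + e.
Proof.
move=> K0 e0.
have c0 := cost_diag k0 mu0 p0; have c_gt0 := cost_gt0 p f0 inj0.
have [eta eta0 etaP] : exists2 eta, 0 < eta & forall xy : 'I_N0 * 'I_N0,
    xy.1 != xy.2 -> eta <= c xy.1 xy.2.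
  exact: (@finite_positive_bound R ('I_N0 * 'I_N0)%type (fun xy => xy.1 != xy.2)
    (fun xy => c xy.1 xy.2) (fun xy => @c_gt0 xy.1 xy.2)).
have [m0 m0_gt0 m0P] : exists2 m0, 0 < m0 & forall x, true -> m0 <= mu0 0 x.
  exact: (@finite_positive_bound R 'I_N0 (fun=> true) (fun x => mu0 0 x) (fun x _ => f0 x)).
pose C2 := \sum_x \sum_y c x y.
have C20 : 0 <= C2.
  by apply: sumr_ge0 => x _; apply: sumr_ge0 => y _; exact: (c_ge0 c0 c_gt0).
have DS0 := Delta_sum_ge0 p k0 k1.
(* 2 K bounds the l1 norm of r z, [C2] bounds psi by that norm, and e/2 is r times the duality gap
   e/(2 r). *)
pose K2 := (C2 * (2 * K) + e / 2) / eta.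
have K20 : 0 <= K2.
  have h : 0 <= C2 * (2 * K) by apply: mulr_ge0 => //; lra.
  by apply: divr_ge0; [lra|exact: ltW].
pose Q := DS * K2 * (K2 + 2 * K).
have Q0 : 0 <= Q by apply: mulr_ge0; [exact: mulr_ge0|lra].
(* The second summand gives K + K2 <= r m0, so the outflow at each point never exceeds its weight;
   the third makes Q/r at most e/2. *)
pose r0 := 1 + (K + K2) / m0 + 2 * Q / e.
have r01 : 0 <= (K + K2) / m0 by apply: divr_ge0; lra.
have r02 : 0 <= 2 * Q / e by apply: divr_ge0; lra.
exists (Num.truncn (r0 ^+ 2)).+1 => n n0n a b sa sb aK bK.
set r := Num.sqrt n%:R in aK bK *.
have rr0 : r0 <= r.
  have r00 : 0 <= r0 by rewrite /r0; lra.
  rewrite -(ger0_norm r00) -sqrtr_sqr ler_sqrt//.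
  by apply: ltW; apply: (lt_le_trans (truncnS_gt _)); rewrite ler_nat.
have r_gt0 : 0 < r by apply: lt_le_trans rr0; rewrite /r0; lra.
have rK : K + K2 <= r * m0.
  by rewrite -ler_pdivrMr//; apply: le_trans rr0; rewrite /r0; lra.
have rQ : 2 * Q <= r * e.
  by rewrite -ler_pdivrMr//; apply: le_trans rr0; rewrite /r0; lra.
set z := a - permute S b.
have zE : z = (a - mu0) - permute S (b - mu1).
  by rewrite permuteB permute_mu1 opprB addrA subrK.
have zsum : \sum_i z 0 i = 0.
  rewrite /z; under eq_bigr do rewrite mxE [X in _ + X]mxE.
  by rewrite sumrB sum_permute sa.2 sb.2 subrr.
have zl : r * l1norm z <= 2 * K.
  rewrite -l1normZ; last exact: ltW.
  rewrite zE scalerBr -permuteZ.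
  by apply: (le_trans (l1normB _ _)); rewrite l1norm_permute; lra.
have er0 : 0 < e / (2 * r) by rewrite divr_gt0// mulr_gt0.
have [rho frho costrho] := flow_duality i0 c0 c_gt0 zsum er0.
have [rho0 rhod rhodiv] := frho.
pose m := \sum_x \sum_j rho x j.
have psiz : psi z <= C2 * l1norm z := support_fun_bound i0 c0 c_gt0 z.
have rcost : r * flow_cost c rho <= r * psi z + e / 2.
  have := ler_wpM2l (ltW r_gt0) costrho; rewrite mulrDr.
  rewrite (_ : r * (e / (2 * r)) = e / 2)//.
  by rewrite invfM mulrCA mulrA -!mulrA [r * _]mulrCA divff ?mulr1// gt_eqF.
have m_ge0 : 0 <= m by apply: sumr_ge0 => x _; exact: sumr_ge0.
have etam : eta * m <= flow_cost c rho.
  rewrite /m /flow_cost mulr_sumr; apply: ler_sum => x _.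
  rewrite mulr_sumr; apply: ler_sum => y _.
  have [->|xy] := eqVneq x y; first by rewrite rhod mulr0 mul0r.
  by rewrite mulrC ler_wpM2l// (etaP (x, y)).
have rm : r * m <= K2.
  rewrite /K2 ler_pdivlMr//.
  have h1 := ler_wpM2l (ltW r_gt0) etam.
  have h2 := ler_wpM2l C20 zl.
  have h3 := ler_wpM2l (ltW r_gt0) psiz.
  lra.
have al : r * l1norm (a - mu0) <= K by rewrite -l1normZ//; exact: ltW.
have ra x : \sum_j rho x j <= a 0 x.
  have h1 : \sum_j rho x j <= m.
    by rewrite /m [leRHS](bigD1 x)//= lerDl; apply: sumr_ge0 => y _; exact: sumr_ge0.
  have h2 := coord_le_l1norm (a - mu0) x; rewrite !mxE in h2.
  have h3 := ler_norm (- (a 0 x - mu0 0 x)); rewrite normrN in h3.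
  have h4 := m0P x isT.
  suff : r * (m + l1norm (a - mu0)) <= r * m0 by rewrite ler_pM2l//; lra.
  by rewrite mulrDr; lra.
have [[_ kS] _] := nS.
have := GWp_flow_bound p0 Dsym ST TS kS mu0 frho ra.
rewrite -/m => G; have {G} := ler_wpM2l (ltW r_gt0) G.
rewrite support_funZ //; last exact: ltW.
move=> G; apply: (le_trans G); rewrite mulrDr.
suff : r * (DS * m * (m + 2 * l1norm (a - mu0))) <= e / 2 by lra.
rewrite -(ler_pM2l r_gt0).
have h1 : DS * (r * m) * (r * m + 2 * (r * l1norm (a - mu0))) <= Q.
  apply: ler_pM => //.
  - by apply: mulr_ge0 => //; apply: mulr_ge0 => //; exact: ltW.
  - have h : 0 <= r * l1norm (a - mu0) by apply: mulr_ge0; [exact: ltW|exact: l1norm_ge0].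
    have h' : 0 <= r * m by apply: mulr_ge0 => //; exact: ltW.
    lra.
  - exact: ler_wpM2l.
  - by lra.
lra.
Qed.

End asymptotic_bound.

(** * The bootstrap linear program *)

Section linear_program.
Context {R : realType} {N : nat} (i0 : 'I_N).
Variables (c : 'I_N -> 'I_N -> R).
Hypothesis c0 : forall x, c x x = 0.
Hypothesis c_gt0 : forall x y, x != y -> 0 < c x y.
Local Notation psi := (support_fun i0 c).
Implicit Types (u : 'rV[R]_(N * N)) (z : 'rV[R]_N).

Lemma idx_surj (x y : 'I_N) : exists l : 'I_(N * N), idx_i l = x /\ idx_j l = y.
Proof.
have N_gt0 : (0 < N)%N by case: N x => // -[].
have lt : (x * N + y < N * N)%N.
  apply: (@leq_trans (x * N + N)%N); first by rewrite ltn_add2l.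
  by rewrite addnC -mulSn leq_mul2r ltn_ord orbT.
exists (Ordinal lt); split; apply: val_inj => /=.
  by rewrite divnMDl// divn_small ?addn0.
by rewrite modnMDl modn_small.
Qed.

(** A feasible [w] divided by 1 + eps is a potential. It need not be normalized, which is where the
    zero sum of [z] enters. *)
Lemma Lhat_le u z eps t : 0 < 1 + eps -> \sum_i z 0 i = 0 ->
  (forall l, idx_i l != idx_j l -> u 0 l <= (1 + eps) * c (idx_i l) (idx_j l)) ->
  Num.sqrt 2 * ((1 + eps) * psi z) <= t -> (Lhat u z <= t%:E)%E.
Proof.
move=> e1 z0 ule pt; apply: ge_ereal_sup => _ [w /= wu <-]; rewrite lee_fin.
apply: le_trans pt; rewrite ler_wpM2l ?sqrtr_ge0//.
rewrite -ler_pdivrMl// -dotZr dotC; apply: potential_le_support => // x y.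
rewrite !mxE -mulrBr ler_pdivrMl//.
have [->|xy] := eqVneq x y; first by rewrite subrr c0 mulr0.
have [l [lx ly]] := idx_surj x y; rewrite -lx -ly in xy *.
exact: le_trans (wu _ xy) (ule _ xy).
Qed.

(** A maximizing potential multiplied by 1 - eps is feasible. *)
Lemma Lhat_ge u z eps t : 0 <= 1 - eps ->
  (forall l, idx_i l != idx_j l -> (1 - eps) * c (idx_i l) (idx_j l) <= u 0 l) ->
  (Lhat u z <= t%:E)%E -> Num.sqrt 2 * ((1 - eps) * psi z) <= t.
Proof.
move=> e1 ule Lt; have [h [h0 hP] ->] := support_fun_max i0 c0 c_gt0 z.
rewrite -lee_fin; apply: le_trans Lt; apply: ereal_sup_ubound.
exists ((1 - eps) *: h); last by rewrite /= dotZr [dot z h]dotC.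
move=> l lij; rewrite !mxE -mulrBr; apply: le_trans (ule _ lij).
by rewrite ler_wpM2l.
Qed.

Lemma Lhat_closed u t : closed [set z | (Lhat u z <= t%:E)%E].
Proof.
pose A := [set w : 'rV[R]_N | forall l, idx_i l != idx_j l ->
                          w 0 (idx_i l) - w 0 (idx_j l) <= u 0 l].
rewrite (_ : mkset _ = \bigcap_(w in A) [set z | Num.sqrt 2 * dot z w <= t]).
  apply: closed_bigI => w _; apply: closed_sublevel.
  apply: continuous_mul; first exact: continuous_cst.
  by under eq_fun do rewrite dotC; exact: continuous_dot.
apply/seteqP; split=> z /=.
  move=> Lt w Aw /=; rewrite -lee_fin; apply: le_trans Lt.
  by apply: ereal_sup_ubound; exists w.
by move=> H; apply: ge_ereal_sup => _ [w /= Aw <-]; rewrite lee_fin; exact: H.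
Qed.

End linear_program.

(** * Measurability of the statistic *)

Section GW_measurable.
Context {R : realType} (p : R) {N0 N1 : nat}.
Variables (k0 : 'I_N0 -> 'I_N0 -> R) (k1 : 'I_N1 -> 'I_N1 -> R).
Context d (Om : measurableType d).
Variables (X0 : Om -> 'rV[R]_N0) (X1 : Om -> 'rV[R]_N1).
Hypotheses (mX0 : measurable_fun setT X0) (mX1 : measurable_fun setT X1).
Hypotheses (sX0 : forall t, simplex (X0 t)) (sX1 : forall t, simplex (X1 t)).

Lemma measurable_coord N (X : Om -> 'rV[R]_N) i : measurable_fun setT X ->
  measurable_fun setT (fun t => X t 0 i).
Proof.
move=> mX; apply: (continuous_rV_measurable mX (f := fun x => x 0 i)).
exact: coord_continuous.
Qed.

Lemma measurable_row_mx : measurable_fun setT (fun t => row_mx (X0 t) (X1 t)).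
Proof.
apply: measurable_rV => i; case: (splitP i) => j ij.
  rewrite (_ : (fun t => _) = fun t => X0 t 0 j); first exact: measurable_coord.
  by apply/funext => t; rewrite (_ : i = lshift N1 j) ?row_mxEl//; exact: val_inj.
rewrite (_ : (fun t => _) = fun t => X1 t 0 j); first exact: measurable_coord.
by apply/funext => t; rewrite (_ : i = rshift N0 j) ?row_mxEr//; exact: val_inj.
Qed.

(** [GWp_lip] controls [GWp] on pairs of weight vectors only, not on the ambient space. A set GWp >
    a is therefore written as the trace, on such pairs, of an open union of l1-balls centred at its
    points. *)
Lemma measurable_GWp : measurable_fun setT (fun t => GWp p k0 k1 (X0 t) (X1 t)).
Proof.
pose K := 4 * Delta_sum p k0 k1.
pose dist (x : 'rV[R]_(N0 + N1)) (w : 'rV[R]_N0 * 'rV[R]_N1) :=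
  l1norm (w.1 - lsubmx x) + l1norm (w.2 - rsubmx x).
have cd w : continuous (fun x => K * dist x w).
  have cl N (v : 'rV[R]_N) (f : 'I_N -> 'I_(N0 + N1)) :
      continuous (fun x : 'rV[R]_(N0 + N1) => \sum_i `|v 0 i - x 0 (f i)|).
    apply: continuous_sum => i.
    apply: (continuous_compR (f := fun x : 'rV[R]_(N0 + N1) => v 0 i - x 0 (f i)));
      last exact: norm_continuous.
    apply: continuous_add; first exact: continuous_cst.
    apply: (continuous_compR (f := fun x : 'rV[R]_(N0 + N1) => x 0 (f i)) (h := -%R)).
      exact: coord_continuous.
    by move=> r; apply: cvgN; exact: cvg_id.
  have -> : (fun x => K * dist x w) = (fun x => K * (\sum_i `|w.1 0 i - x 0 (lshift N1 i)| +
     \sum_i `|w.2 0 i - x 0 (rshift N0 i)|)).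
    apply/funext => x; rewrite /dist /l1norm; congr (_ * (_ + _));
      by apply: eq_bigr => i _; rewrite !mxE.
  by apply: continuous_mul; [exact: continuous_cst|apply: continuous_add; exact: cl].
apply: (measurability _ (measurable_realfun.RGenOInfty.measurableE R)).
move=> _ [_ [a ->] <-]; rewrite setTI.
pose B := [set w : 'rV[R]_N0 * 'rV[R]_N1 |
  [/\ simplex w.1, simplex w.2 & a < GWp p k0 k1 w.1 w.2]].
pose O := \bigcup_(w in B) [set x | K * dist x w < GWp p k0 k1 w.1 w.2 - a].
have oO : open O.
  apply: bigcup_open => w _; apply: (@open_comp _ _ (fun x => K * dist x w) [set r | r < _]).
    by move=> x _; exact: cd.
  exact: open_lt.
rewrite (_ : _ @^-1` _ = (fun t => row_mx (X0 t) (X1 t)) @^-1` O).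
  rewrite -[X in measurable X]setTI; apply: measurable_row_mx => //.
  exact: open_measurable_rV.
apply/seteqP; split=> t /=; rewrite in_itv/= andbT.
  move=> aG; exists (X0 t, X1 t); first by split => /=.
  rewrite /= /dist row_mxKl row_mxKr/= !subrr /l1norm.
  by rewrite !big1 ?addr0 ?mulr0 ?subr_gt0// => i _; rewrite mxE normr0.
move=> [w [s1 s2 aw]] /=; rewrite /dist row_mxKl row_mxKr => h.
have := GWp_lip p k0 k1 (sX0 t) s1 (sX1 t) s2.
have sym N (v v' : 'rV[R]_N) : l1norm (v - v') = l1norm (v' - v).
  by apply: eq_bigr => i _; rewrite !mxE distrC.
by rewrite sym (sym _ (X1 t)) -/K; lra.
Qed.

End GW_measurable.

(** * The limit law *)

Section quadratic_form.
Context {R : realType} {N : nat}.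
Implicit Types (V : 'M[R]_N) (a : 'rV[R]_N).

Lemma qformE V a : qform V a = \sum_j (\sum_i a 0 i * V i j) * a 0 j.
Proof. by rewrite /qform mxE; apply: eq_bigr => j _; rewrite !mxE. Qed.

Lemma qformZ V a s : qform V (s *: a) = s ^+ 2 * qform V a.
Proof.
rewrite !qformE mulr_sumr; apply: eq_bigr => j _; rewrite mxE.
have -> : \sum_i (s *: a) 0 i * V i j = s * \sum_i a 0 i * V i j.
  by rewrite mulr_sumr; apply: eq_bigr => i _; rewrite mxE mulrA.
lra.
Qed.

Lemma qform_continuous a : continuous (fun V => qform V a).
Proof.
under eq_fun do rewrite qformE.
apply: continuous_sum => j; apply: continuous_mul; last exact: continuous_cst.
apply: continuous_sum => i; apply: continuous_mul; first exact: continuous_cst.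
exact: coord_continuous.
Qed.

Lemma bilinear_delta V i j : (delta_mx 0 i *m V *m (delta_mx 0 j)^T : 'M[R]_1) 0 0 = V i j.
Proof. by rewrite -rowE trmx_delta -colE !mxE. Qed.

(** Polarization: the values at sums of two basis vectors recover every entry of a symmetric
    matrix. *)
Lemma qform_neq0 V : V^T = V -> V <> 0 -> exists a, qform V a != 0.
Proof.
move=> VT V0; apply: contrapT => nex; apply: V0.
have q0 a : qform V a = 0.
  by apply/eqP/negPn/negP => qa; apply: nex; exists a.
have addE (A B : 'M[R]_1) : (A + B) 0 0 = A 0 0 + B 0 0 by rewrite mxE.
apply/matrixP => i j; rewrite mxE.
have Vji : V j i = V i j by rewrite -[in LHS]VT mxE.
have := q0 (delta_mx 0 i + delta_mx 0 j).
rewrite /qform linearD/= !mulmxDl !mulmxDr !addE !bilinear_delta.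
have := q0 (delta_mx 0 i); have := q0 (delta_mx 0 j).
rewrite /qform !bilinear_delta Vji; lra.
Qed.

Lemma sum_dot (z : 'rV[R]_N) : \sum_i z 0 i = dot (const_mx 1) z.
Proof. by apply: eq_bigr => i _; rewrite mxE mul1r. Qed.

Lemma Sigma_sym (q : 'rV[R]_N) : (Sigma q)^T = Sigma q.
Proof. by rewrite /Sigma linearB/= tr_diag_mx trmx_mul trmxK. Qed.

(** Makes a Gaussian vector with covariance [Sigma q] sum to zero almost surely. *)
Lemma Sigma_ones (q : 'rV[R]_N) : simplex q -> qform (Sigma q) (const_mx 1) = 0.
Proof.
move=> [_ q1]; rewrite qformE big1// => j _.
rewrite [X in X * _](_ : _ = 0) ?mul0r//.
under eq_bigr do rewrite !mxE mul1r big_ord1 !mxE.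
rewrite sumrB -mulr_suml q1 mul1r (bigD1 j)//= eqxx mulr1n big1 ?addr0 ?subrr// => i ij.
by rewrite (negbTE ij) mulr0n.
Qed.

End quadratic_form.

Section almost_sure.
Context d (T : measurableType d) (R : realType) (P : probability T R).
Implicit Types A B E : set T.

Lemma prob_le_almost_surely A B E : measurable A -> measurable B -> measurable E ->
  P E = 1%E -> A `&` E `<=` B -> fine (P A) <= fine (P B).
Proof.
move=> mA mB mE PE AEB.
have PCE : P (~` E) = 0%E by rewrite probability_setC// PE subee.
rewrite -lee_fin !fineK ?fin_num_measure//.
have : (P A <= P (B `|` ~` E))%E.
  apply: le_measure; rewrite ?inE//; first by apply: measurableU => //; exact: measurableC.
  by move=> t At; have [Et|nEt] := pselect (E t); [left; exact: AEB|right].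
move=> /le_trans; apply; apply: (le_trans (measureU2 _ mB (measurableC mE))).
by rewrite [X in (_ + X)%E]PCE adde0.
Qed.

Lemma prob_eq_almost_surely A B E : measurable A -> measurable B -> measurable E ->
  P E = 1%E -> (forall t, E t -> A t <-> B t) -> fine (P A) = fine (P B).
Proof.
move=> mA mB mE PE AB; apply/eqP; rewrite eq_le.
rewrite !(@prob_le_almost_surely _ _ E)// => t [? Et]; exact/AB.
Qed.

End almost_sure.

Lemma measurable_scale d (T : measurableType d) (R : realType) N (s : R)
    (X : T -> 'rV[R]_N) : measurable_fun setT X -> measurable_fun setT (fun t => s *: X t).
Proof.
move=> mX; apply: measurable_rV => i; under eq_fun do rewrite mxE.
by apply: measurable_funM; [exact: measurable_cst|exact: measurable_coord].
Qed.

Lemma measurable_sub d (T : measurableType d) (R : realType) N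
    (X Y : T -> 'rV[R]_N) : measurable_fun setT X -> measurable_fun setT Y ->
  measurable_fun setT (fun t => X t - Y t).
Proof.
move=> mX mY; apply: measurable_rV => i; under eq_fun do rewrite !mxE.
by apply: measurable_funB; exact: measurable_coord.
Qed.

Lemma measurable_permute d (T : measurableType d) (R : realType) N0 N1
    (S : 'I_N0 -> 'I_N1) (X : T -> 'rV[R]_N1) :
  measurable_fun setT X -> measurable_fun setT (fun t => permute S (X t)).
Proof.
by move=> mX; apply: measurable_rV => i; under eq_fun do rewrite mxE; exact: measurable_coord.
Qed.

Lemma measurable_eq_cst d (T : measurableType d) (R : realType) (f : T -> R) a :
  measurable_fun setT f -> measurable [set t | f t = a].
Proof. by move=> mf; have := mf measurableT [set a] (measurable_set1 a); rewrite setTI. Qed.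

Lemma measurable_sum_coord d (T : measurableType d) (R : realType) N
    (X : T -> 'rV[R]_N) : measurable_fun setT X ->
  measurable [set t | \sum_i X t 0 i = 0].
Proof.
move=> mX; apply: measurable_eq_cst.
by under eq_fun do rewrite sum_dot; exact: measurable_dot.
Qed.

Lemma gaussian_sqrt2_charfun d (T : measurableType d) (R : realType)
    (P : probability T R) N (X : T -> 'rV[R]_N) V a b :
  measurable_fun setT X -> gaussian P X V ->
  mean P (fun x => cos (dot a (Num.sqrt 2 *: X x) + b)) = cos b * expR (- qform V a).
Proof.
move=> mX gX; transitivity (mean P (fun x => cos (dot (Num.sqrt 2 *: a) (X x) + b))).
  by congr mean; apply/funext => x; rewrite dotZr dotZl.
rewrite (gaussian_charfun _ _ mX gX) qformZ sqr_sqrtr//; congr (_ * expR _); lra.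
Qed.

Section limit_law.
Context d (T : measurableType d) (R : realType) (Q : probability T R) (N : nat).
Variables (i0 : 'I_N) (c : 'I_N -> 'I_N -> R).
Hypothesis c0 : forall x, c x x = 0.
Hypothesis c_gt0 : forall x y, x != y -> 0 < c x y.
Variables (q : 'rV[R]_N) (G : T -> 'rV[R]_N).
Hypotheses (sq : simplex q) (q0 : Sigma q <> 0).
Hypotheses (mG : measurable_fun setT G) (gG : gaussian Q G (Sigma q)).
Local Notation psi := (support_fun i0 c).

Definition limit_cdf t : R := fine (Q [set x | psi (Num.sqrt 2 *: G x) <= t]).

Let mY : measurable_fun setT (fun x => Num.sqrt 2 *: G x).
Proof. exact: measurable_scale. Qed.

Let cpsi : continuous psi. Proof. exact: support_fun_continuous. Qed.

Let mpsi : measurable_fun setT (fun x => psi (Num.sqrt 2 *: G x)).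
Proof. exact: continuous_rV_measurable. Qed.

Lemma limit_sum0 : Q [set x | \sum_i G x 0 i = 0] = 1%E.
Proof.
rewrite -(gaussian_degenerate gG (Sigma_ones sq)); congr (Q _).
by apply/funext => x /=; rewrite sum_dot.
Qed.

Lemma limit_level t : 0 <= t -> Q [set x | psi (Num.sqrt 2 *: G x) = t] = 0%E.
Proof.
move=> t0; have s2 : Num.sqrt 2 != 0 :> R by rewrite sqrtr_eq0 -ltNge.
have [->|tn0] := eqVneq t 0; last first.
  apply: (support_fun_level i0 c0 c_gt0 mY) => a.
  rewrite (_ : mkset _ = [set x | dot a (G x) = t / Num.sqrt 2]).
    by apply: (gaussian_atom gG); rewrite mulf_neq0 ?orbT// invr_eq0.
  apply/seteqP; split=> x /=; rewrite dotZr; first by move=> <-; rewrite mulrC mulKf.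
  by move=> ->; rewrite mulrC divfK.
have [a qa] := qform_neq0 (Sigma_sym q) q0.
have mA := measurable_eq_cst 0 mpsi.
have mB := measurable_eq_cst 0 (measurable_dot a mG).
have := prob_le_almost_surely mA mB (measurable_sum_coord mG) limit_sum0.
have QB : Q [set x | dot a (G x) = 0] = 0%E by apply: (gaussian_atom gG); rewrite qa.
rewrite QB/= => H.
apply/eqP; rewrite -[X in X == _]fineK ?fin_num_measure// eqe eq_le fine_ge0// andbT.
apply: H => x [/= px Gx].
have : Num.sqrt 2 *: G x = 0.
  apply: (support_fun_eq0 (i0 := i0) c0 c_gt0); last by rewrite px.
  by under eq_bigr do rewrite mxE; rewrite -mulr_sumr Gx mulr0.
by move=> /eqP; rewrite scaler_eq0 (negbTE s2)/= => /eqP ->; rewrite dotC dot0l.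
Qed.

Lemma limit_cdf_mono s t : s <= t -> limit_cdf s <= limit_cdf t.
Proof. exact: sublevel_mono. Qed.

Lemma limit_cdf_le1 t : limit_cdf t <= 1.
Proof. by have /andP[] := fine_prob_itv Q (measurable_sublevel mpsi t). Qed.

Lemma limit_cdf_lt0 t : t < 0 -> limit_cdf t = 0.
Proof.
move=> t0; rewrite /limit_cdf (_ : mkset _ = set0) ?measure0//.
by rewrite -subset0 => x /=; rewrite leNgt (lt_le_trans t0)// support_fun_ge0.
Qed.

Lemma limit_cdf_cvg1 e : 0 < e -> exists M, 1 - e <= limit_cdf M.
Proof. exact: sublevel_cvg1. Qed.

Lemma limit_cdf_continuous t e : 0 <= t -> 0 < e ->
  exists2 del, 0 < del & limit_cdf (t + del) <= limit_cdf (t - del) + e.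
Proof. by move=> t0; apply: sublevel_continuous => //; exact: limit_level. Qed.

(** The portmanteau bounds shift the level by del/2, and continuity of the limit pays for it. The
    remaining room [del] around [t] later absorbs the factors 1 ± eps of the linear program. *)
Lemma limit_cdf_cvg_in_distribution d' (T' : measurableType d') (P : probability T' R)
    (X : nat -> T' -> 'rV[R]_N) :
  (forall n, measurable_fun setT (X n)) ->
  cvg_in_distribution P Q X (fun x => Num.sqrt 2 *: G x) ->
  forall t e, 0 <= t -> 0 < e -> exists2 del, 0 < del & \forall n \near \oo,
    fine (P [set x | psi (X n x) <= t + del]) <= limit_cdf t + e /\
    limit_cdf t - e <= fine (P [set x | psi (X n x) <= t - del]).
Proof.
move=> mX XY t e t0 e0; have e2 : 0 < e / 2 by rewrite divr_gt0.
have [del del0 Fdel] := limit_cdf_continuous t0 e2.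
have del2 : 0 < del / 2 by rewrite divr_gt0.
exists (del / 2) => //.
near=> n; split.
  have : fine (P [set x | psi (X n x) <= t + del / 2]) <=
      fine (Q [set x | psi (Num.sqrt 2 *: G x) <= t + del / 2 + del / 2]) + e / 2.
    by near: n; exact: portmanteau_le.
  have : limit_cdf (t - del) <= limit_cdf t by apply: limit_cdf_mono; lra.
  rewrite -addrA -splitr -/(limit_cdf _); move: Fdel; lra.
have : fine (Q [set x | psi (Num.sqrt 2 *: G x) <= t - del]) <=
    fine (P [set x | psi (X n x) <= t - del + del / 2]) + e / 2.
  by near: n; exact: portmanteau_ge.
rewrite -/(limit_cdf _) (_ : t - del + del / 2 = t - del / 2); last lra.
have : limit_cdf t <= limit_cdf (t + del) by apply: limit_cdf_mono; lra.
move: Fdel; lra.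
Unshelve. all: by end_near. Qed.

End limit_law.

Section bootstrap.
Context {R : realType} {N : nat}.
Variables (i0 : 'I_N) (c : 'I_N -> 'I_N -> R).
Hypothesis c0 : forall x, c x x = 0.
Hypothesis c_gt0 : forall x y, x != y -> 0 < c x y.
Variable q : 'rV[R]_N.
Context d' (T' : measurableType d') (P : probability T' R).
Variables (Z : nat -> T' -> 'rV[R]_N) (V : nat -> 'M[R]_N).
Variables (u : nat -> 'rV[R]_(N * N)) (u0 : 'rV[R]_(N * N)).
Hypotheses (mZ : forall n, measurable_fun setT (Z n)).
Hypotheses (gZ : forall n, gaussian P (Z n) (V n)).
Hypothesis VSigma : V @ \oo --> Sigma q.
Hypothesis uu0 : u @ \oo --> u0.
Hypothesis u0E : forall l, u0 0 l = c (idx_i l) (idx_j l).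
Hypothesis Z_sum0 : \forall n \near \oo, P [set z | \sum_i Z n z 0 i = 0] = 1%E.
Local Notation psi := (support_fun i0 c).

(** Convergence of the bounds becomes a relative estimate because the finitely many off-diagonal
    costs are positive. *)
Lemma bound_estimate eps : 0 < eps -> \forall n \near \oo, forall l, idx_i l != idx_j l ->
  (1 - eps) * c (idx_i l) (idx_j l) <= u n 0 l <= (1 + eps) * c (idx_i l) (idx_j l).
Proof.
move=> eps0.
have [eta eta0 etaP] : exists2 eta, 0 < eta & forall l : 'I_(N * N),
    idx_i l != idx_j l -> eta <= eps * c (idx_i l) (idx_j l).
  by apply: finite_positive_bound => l /c_gt0 cl; rewrite mulr_gt0.
have /cvgrPdist_le/(_ _ eta0) := uu0; apply: filterS => n un l /etaP el.
have := le_trans (ler_coord_norm (u0 - u n) l) un.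
rewrite !mxE u0E ler_norml; lra.
Qed.

Lemma measurable_Lhat n t : measurable [set z | (Lhat (u n) (Z n z) <= t%:E)%E].
Proof.
have := @mZ n measurableT _ (closed_measurable_rV (@Lhat_closed R N (u n) t)).
by rewrite setTI.
Qed.

(** The crude choice eps = 1 bounds the program by a multiple of the norm of [Z]. No limiting vector
    [G] appears, since under the alternative (A1) provides none. *)
Lemma Lhat_tight e : 0 < e -> exists B, \forall n \near \oo,
  1 - e <= fine (P [set z | (Lhat (u n) (Z n z) <= B%:E)%E]).
Proof.
move=> e0; have s2 : 0 < Num.sqrt 2 :> R by rewrite sqrtr_gt0.
have [M MP] := gaussian_tight mZ gZ VSigma e0.
pose C := \sum_x \sum_y c x y.
have C0 : 0 <= C by apply: sumr_ge0 => x _; apply: sumr_ge0 => y _; exact: c_ge0.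
exists (Num.sqrt 2 * ((1 + 1) * (C * (N%:R * M)))).
near=> n.
have uP : forall l, idx_i l != idx_j l ->
  (1 - 1) * c (idx_i l) (idx_j l) <= u n 0 l <= (1 + 1) * c (idx_i l) (idx_j l).
  by near: n; exact: bound_estimate.
have Z1 : P [set z | \sum_i Z n z 0 i = 0] = 1%E by near: n.
have tM : fine (P [set t | M < `|Z n t|]) <= e by near: n.
have mT := measurable_tail (mZ n) M.
have : 1 - e <= fine (P (~` [set t | M < `|Z n t|])).
  by rewrite probability_setC// fineB ?fin_num_measure//= lerB.
move=> /le_trans; apply.
apply: (prob_le_almost_surely _ _ (measurable_sum_coord (mZ n)) Z1).
- exact: measurableC.
- exact: measurable_Lhat.
move=> z [/= /negP]; rewrite -leNgt => zM Zz.
apply: (@Lhat_le _ _ i0 _ c0 c_gt0 (u n) (Z n z) 1) => //; first by move=> l /uP/andP[].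
rewrite ler_wpM2l ?sqrtr_ge0// ler_wpM2l//; apply: (le_trans (support_fun_bound i0 c0 c_gt0 _)).
rewrite ler_wpM2l//; apply: (le_trans (l1norm_le_norm _)).
by rewrite ler_wpM2l.
Unshelve. all: by end_near. Qed.

Context d (T : measurableType d) (Q : probability T R) (G : T -> 'rV[R]_N).
Hypotheses (sq : simplex q) (q0 : Sigma q <> 0).
Hypotheses (mG : measurable_fun setT G) (gG : gaussian Q G (Sigma q)).

Lemma bootstrap_cvg_in_distribution :
  cvg_in_distribution P Q (fun n z => Num.sqrt 2 *: Z n z) (fun x => Num.sqrt 2 *: G x).
Proof.
have s2 : 0 < Num.sqrt 2 :> R by rewrite sqrtr_gt0.
apply: cvg_in_distribution_charfun.
- by move=> n; exact: measurable_scale.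
- exact: measurable_scale.
- move=> a b; under eq_fun do rewrite (gaussian_sqrt2_charfun _ _ (mZ _) (gZ _)).
  rewrite (gaussian_sqrt2_charfun _ _ mG gG); apply: cvgM; first exact: cvg_cst.
  apply: (cvg_comp V (fun V => expR (- qform V a)) VSigma).
  apply: (@continuous_compR R _ (fun W : 'M[R]_N => - qform W a) expR).
    by move=> W; apply: (@cvgN _ _ _ (nbhs W)); exact: qform_continuous.
  exact: continuous_expR.
- move=> e e0; have [M MP] := gaussian_tight mZ gZ VSigma e0.
  exists (Num.sqrt 2 * M); move: MP; apply: filterS => n.
  congr (fine (P _) <= _); apply/seteqP; split=> z /=;
    by rewrite normrZ gtr0_norm// ltr_pM2l.
Qed.

Lemma bootstrap_cdf_cvg t : 0 <= t ->
  fine (P [set z | (Lhat (u n) (Z n z) <= t%:E)%E]) @[n --> \oo] --> limit_cdf Q i0 c G t.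
Proof.
move=> t0; have s2 : 0 < Num.sqrt 2 :> R by rewrite sqrtr_gt0.
apply/cvgrPdist_le => e e0.
have mZ2 n : measurable_fun setT (fun z => Num.sqrt 2 *: Z n z) by exact: measurable_scale.
have [del del0 delP] := limit_cdf_cvg_in_distribution i0 c0 c_gt0 sq q0 mG gG mZ2
  bootstrap_cvg_in_distribution t0 e0.
(* Chosen so that t <= (1 - eps)(t + del) and (1 + eps)(t - del) <= t, which fits the relative error
   into the additive room [del]. *)
pose eps := del / (t + del) / 2.
have td : 0 < t + del by lra.
have epsE : eps * (t + del) = del / 2 by rewrite /eps mulrAC divfK// gt_eqF.
have eps0 : 0 < eps by rewrite !divr_gt0.
have eps1 : eps <= 1 / 2 by rewrite ler_pM2r// ler_pdivrMr// mul1r; lra.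
have mpsi n s : measurable [set z | psi (Num.sqrt 2 *: Z n z) <= s].
  apply: measurable_sublevel; apply: continuous_rV_measurable => //.
  exact: support_fun_continuous.
near=> n.
have uP : forall l, idx_i l != idx_j l ->
  (1 - eps) * c (idx_i l) (idx_j l) <= u n 0 l <= (1 + eps) * c (idx_i l) (idx_j l).
  by near: n; exact: bound_estimate.
have Z1 : P [set z | \sum_i Z n z 0 i = 0] = 1%E by near: n.
have [h1 h2] : fine (P [set x | psi (Num.sqrt 2 *: Z n x) <= t + del]) <=
    limit_cdf Q i0 c G t + e /\
    limit_cdf Q i0 c G t - e <= fine (P [set x | psi (Num.sqrt 2 *: Z n x) <= t - del]).
  by near: n.
have mS := measurable_sum_coord (mZ n).
have h3 : fine (P [set z | (Lhat (u n) (Z n z) <= t%:E)%E]) <=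
    fine (P [set x | psi (Num.sqrt 2 *: Z n x) <= t + del]).
  apply: (prob_le_almost_surely _ _ mS Z1) => //; first exact: measurable_Lhat.
  move=> z [/= Lt Zz]; rewrite (support_funZ i0 c0 c_gt0) ?sqrtr_ge0//.
  have e1 : 0 < 1 - eps by lra.
  have := @Lhat_ge _ _ i0 _ c0 c_gt0 (u n) (Z n z) eps t (ltW e1).
  move=> /(_ (fun l lij => proj1 (andP (uP l lij))) Lt) H.
  rewrite -(ler_pM2l e1) mulrCA; apply: (le_trans H); lra.
have h4 : fine (P [set x | psi (Num.sqrt 2 *: Z n x) <= t - del]) <=
    fine (P [set z | (Lhat (u n) (Z n z) <= t%:E)%E]).
  apply: (prob_le_almost_surely _ _ mS Z1) => //; first exact: measurable_Lhat.
  move=> z [/=]; rewrite (support_funZ i0 c0 c_gt0) ?sqrtr_ge0//.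
  move=> pz Zz; apply: (@Lhat_le _ _ i0 _ c0 c_gt0 (u n) (Z n z) eps) => //; first by lra.
    by move=> l /uP/andP[].
  rewrite mulrCA; apply: (@le_trans _ _ ((1 + eps) * (t - del))).
    by apply: ler_wpM2l => //; lra.
  have := mulr_ge0 (ltW eps0) (ltW del0); lra.
rewrite ler_norml; lra.
Unshelve. all: by end_near. Qed.

End bootstrap.

Lemma cvg_in_distribution_tight d (T : measurableType d) d' (T' : measurableType d')
    (R : realType) N (P : probability T R) (Q : probability T' R)
    (X : nat -> T -> 'rV[R]_N) (Y : T' -> 'rV[R]_N) e :
  (forall n, measurable_fun setT (X n)) -> measurable_fun setT Y ->
  cvg_in_distribution P Q X Y -> 0 < e ->
  exists2 M, 0 < M & \forall n \near \oo, 1 - e <= fine (P [set t | `|X n t| <= M]).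
Proof.
move=> mX mY XY e0; have e2 : 0 < e / 2 by rewrite divr_gt0.
have [M0 M0P] := random_vector_tight mY Q e2.
pose M := Num.max M0 0; exists (M + 1); first by rewrite ltr_wpDl// le_max lexx orbT.
have mtail := measurable_tail mY M0.
have MP : 1 - e / 2 <= fine (Q [set t | `|Y t| <= M]).
  have : 1 - e / 2 <= fine (Q (~` [set t | M0 < `|Y t|])).
    by rewrite probability_setC// fineB ?fin_num_measure//= lerB.
  move=> /le_trans; apply; apply: (prob_le_almost_surely _ _ measurableT (probability_setT Q)).
  - exact: measurableC.
  - apply: measurable_sublevel; apply: continuous_rV_measurable => //.
    by move=> x; exact: norm_continuous.
  - by move=> t [/= /negP]; rewrite -leNgt => tM _; rewrite le_max tM.
have cn : continuous (fun x : 'rV[R]_N => `|x|) by move=> x; exact: norm_continuous.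
have := portmanteau_ge mX mY XY cn M ltr01 e2.
by apply: filterS => n; lra.
Qed.

Section difference_law.
Context d (T : measurableType d) (R : realType) (Q : probability T R) (N : nat).
Variables (i0 : 'I_N) (c : 'I_N -> 'I_N -> R).
Hypothesis c0 : forall x, c x x = 0.
Hypothesis c_gt0 : forall x y, x != y -> 0 < c x y.
Variables (q : 'rV[R]_N) (G H : T -> 'rV[R]_N).
Hypotheses (sq : simplex q) (q0 : Sigma q <> 0).
Hypotheses (mG : measurable_fun setT G) (gG : gaussian Q G (Sigma q)).
Hypotheses (mH : measurable_fun setT H) (iH : indep_copy Q H G).
Local Notation psi := (support_fun i0 c).

Let mW : measurable_fun setT (fun x => G x - H x).
Proof. exact: measurable_sub. Qed.

Let mpsi : measurable_fun setT (fun x => psi (G x - H x)).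
Proof. by apply: continuous_rV_measurable => //; exact: support_fun_continuous. Qed.

(** Equal characteristic functions make the constant sequence G - H converge in distribution to sqrt
    2 G; continuity of the limit at [t] then forces equality. *)
Lemma difference_cdf t : 0 <= t ->
  fine (Q [set x | psi (G x - H x) <= t]) = limit_cdf Q i0 c G t.
Proof.
move=> t0.
have WY : cvg_in_distribution Q Q (fun _ x => G x - H x) (fun x => Num.sqrt 2 *: G x).
  apply: cvg_in_distribution_charfun => //.
  - exact: measurable_scale.
  - move=> a b; rewrite (gaussian_difference_charfun mH mG gG iH).
    by rewrite (gaussian_sqrt2_charfun _ _ mG gG); exact: cvg_cst.
  - by move=> e e0; have [M ?] := random_vector_tight mW Q e0; exists M; exact: nearW.
suff H0 e : 0 < e -> `|fine (Q [set x | psi (G x - H x) <= t]) - limit_cdf Q i0 c G t| <= e.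
  apply/eqP; rewrite -subr_eq0 -normr_le0.
  by apply/ler_addgt0Pr => e e0; rewrite add0r H0.
move=> e0.
have [del del0 [n _ /(_ n (leqnn n))/= [h1 h2]]] :=
  limit_cdf_cvg_in_distribution i0 c0 c_gt0 sq q0 mG gG (fun=> mW) WY t0 e0.
have h3 : fine (Q [set x | psi (G x - H x) <= t]) <= fine (Q [set x | psi (G x - H x) <= t + del]).
  by apply: (sublevel_mono Q mpsi); lra.
have h4 : fine (Q [set x | psi (G x - H x) <= t - del]) <= fine (Q [set x | psi (G x - H x) <= t]).
  by apply: (sublevel_mono Q mpsi); lra.
rewrite ler_norml; lra.
Qed.

(** For use at points s - del of unknown sign: at negative [t] the left side is 0. *)
Lemma difference_cdf_ge t : limit_cdf Q i0 c G t <= fine (Q [set x | psi (G x - H x) <= t]).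
Proof.
have [t0|t0] := leP 0 t; first by rewrite difference_cdf.
by rewrite limit_cdf_lt0// fine_ge0.
Qed.

Lemma difference_sum0 : Q [set x | \sum_i (G x - H x) 0 i = 0] = 1%E.
Proof.
have gH := indep_copy_gaussian gG iH.
have mS := measurable_sum_coord mW.
have := prob_le_almost_surely (measurable_sum_coord mG) mS (measurable_sum_coord mH)
  (limit_sum0 sq gH).
rewrite (limit_sum0 sq gG) => H1.
apply/eqP; rewrite eq_le probability_le1//= -[leRHS]fineK ?fin_num_measure// lee_fin.
apply: H1 => x [/= Gx Hx]; under eq_bigr do rewrite !mxE.
by rewrite sumrB Gx Hx subrr.
Qed.

End difference_law.

Section limit_statistic.
Context {R : realType} (p : R) {N0 N1 : nat}.
Variables (k0 : 'I_N0 -> 'I_N0 -> R) (k1 : 'I_N1 -> 'I_N1 -> R).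
Variables (mu0 : 'rV[R]_N0) (mu1 : 'rV[R]_N1).
Variables (S : 'I_N0 -> 'I_N1) (T : 'I_N1 -> 'I_N0).
Hypotheses (ST : cancel S T) (TS : cancel T S).

Lemma dot_permute (h : 'I_N0 -> R) (g0 : 'rV[R]_N0) (g1 : 'rV[R]_N1) :
  dot (\row_x h x) g0 + dot (\row_y - h (T y)) g1 = dot (\row_x h x) (g0 - permute S g1).
Proof.
rewrite dotDr dotNr; congr (_ + _); rewrite /dot (reindex_iso ST TS) -sumrN.
by apply: eq_bigr => x _; rewrite !mxE ST mulNr.
Qed.

(** [T] is determined by [S], so uniqueness of [S] leaves a single value under the infimum. All
    potentials occur here, not only the normalized ones. *)
Lemma Lstar_le (g0 : 'rV[R]_N0) (g1 : 'rV[R]_N1) s : null_isos k0 k1 mu0 mu1 = [set S] ->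
  (Lstar p k0 k1 mu0 mu1 g0 g1 <= s%:E)%E <->
  forall h, potential (cost p k0 mu0) h -> dot h (g0 - permute S g1) <= s.
Proof.
move=> nS.
have -> : Lstar p k0 k1 mu0 mu1 g0 g1 = ereal_sup
    [set (dot h (g0 - permute S g1))%:E | h in potential (cost p k0 mu0)].
  have E : [set (dot (\row_x h x) g0 + dot (\row_y - h (T y)) g1)%:E
      | h in potentials p k0 mu0] =
      [set (dot h (g0 - permute S g1))%:E | h in potential (cost p k0 mu0)].
    apply/seteqP; split=> _ [h hP <-].
      by exists (\row_x h x); [move=> x y; rewrite !mxE; exact: hP|rewrite dot_permute].
    exists (fun x => h 0 x); first by move=> x y; exact: hP.
    by rewrite dot_permute; congr (dot _ _)%:E; apply/rowP => x; rewrite mxE.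
  rewrite /Lstar -E -[RHS]ereal_inf1; congr ereal_inf; apply/seteqP; split=> s' /=.
    move=> [S' [T' [nS' ST' TS' ->]]]; move: nS'; rewrite nS => /= SS'.
    rewrite (_ : T' = T)//; apply/funext => y.
    by rewrite -[in LHS](TS y) -SS' ST'.
  by move=> ->; exists S, T; split=> //; rewrite nS.
split=> [Ls h hP|hP].
  by rewrite -lee_fin; apply: le_trans Ls; apply: ereal_sup_ubound; exists h.
by apply: ge_ereal_sup => _ [h /hP hs <-]; rewrite lee_fin.
Qed.

Lemma potential_bound_closed s :
  closed [set w : 'rV[R]_N0 | forall h, potential (cost p k0 mu0) h -> dot h w <= s].
Proof.
rewrite (_ : mkset _ = \bigcap_(h in potential (cost p k0 mu0)) [set w | dot h w <= s])//.
by apply: closed_bigI => h _; apply: closed_sublevel; exact: continuous_dot.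
Qed.

End limit_statistic.

Lemma continuous_coords (R : realType) (T : topologicalType) N (f : T -> 'rV[R]_N) :
  (forall i, continuous (fun x => f x 0 i)) -> continuous f.
Proof.
move=> cf x; apply/cvg_ballP => e e0.
have : \forall y \near x, forall i, `|f x 0 i - f y 0 i| < e.
  apply: filter_forall => i.
  by have /cvgrPdist_lt/(_ _ e0) := cf i x.
by apply: filterS => y H; exact/ball_rVP.
Qed.

(** * The test statistic *)

Section statistic.
Context {R : realType} (p : R) {N0 N1 : nat}.
Variables (k0 : 'I_N0 -> 'I_N0 -> R) (k1 : 'I_N1 -> 'I_N1 -> R).
Variables (mu0 : 'rV[R]_N0) (mu1 : 'rV[R]_N1).
Context d (Om : measurableType d) (P : probability Om R).
Context d' (OmG : measurableType d') (PG : probability OmG R).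
Variables (X0 : nat -> Om -> 'rV[R]_N0) (X1 : nat -> Om -> 'rV[R]_N1).
Variables (G0 : OmG -> 'rV[R]_N0) (G1 : OmG -> 'rV[R]_N1).
Hypotheses (mX0 : forall n, measurable_fun setT (X0 n)).
Hypotheses (mX1 : forall n, measurable_fun setT (X1 n)).
Hypotheses (mG0 : measurable_fun setT G0) (mG1 : measurable_fun setT G1).
Hypotheses (s0 : simplex mu0) (s1 : simplex mu1).
Hypotheses (sX0 : forall n t, simplex (X0 n t)) (sX1 : forall n t, simplex (X1 n t)).
Let X n t := Num.sqrt n%:R *: (row_mx (X0 n t) (X1 n t) - row_mx mu0 mu1).
Let G t := row_mx (G0 t) (G1 t).
Hypothesis XG : cvg_in_distribution P PG X G.
Let stat n t := Num.sqrt n%:R * GWp p k0 k1 (X0 n t) (X1 n t).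

Let mX n : measurable_fun setT (X n).
Proof.
apply: measurable_scale; apply: measurable_sub; first exact: measurable_row_mx.
exact: measurable_cst.
Qed.

Let mG : measurable_fun setT G. Proof. exact: measurable_row_mx. Qed.

Lemma measurable_stat n : measurable_fun setT (stat n).
Proof. by apply: measurable_funM; [exact: measurable_cst|exact: measurable_GWp]. Qed.

Let l1norm_deviation n t M : `|X n t| <= M ->
  l1norm (Num.sqrt n%:R *: (X0 n t - mu0)) <= (N0 + N1)%:R * M /\
  l1norm (Num.sqrt n%:R *: (X1 n t - mu1)) <= (N0 + N1)%:R * M.
Proof.
move=> XM; have : l1norm (X n t) <= (N0 + N1)%:R * M.
  by apply: (le_trans (l1norm_le_norm _)); rewrite ler_wpM2l.
rewrite /X opp_row_mx add_row_mx scale_row_mx /l1norm big_split_ord/=.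
under eq_bigr do rewrite row_mxEl; under [X in _ + X <= _]eq_bigr do rewrite row_mxEr.
move=> H; split; apply: le_trans H; first by rewrite lerDl sumr_ge0.
by rewrite lerDr sumr_ge0.
Qed.

Section alternative.
Hypothesis gw_gt0 : 0 < GWp p k0 k1 mu0 mu1.

(** On the event |X n| <= M the weights deviate by O(1/sqrt n), so by [GWp_lip] the statistic stays
    above sqrt n * g - C. *)
Lemma stat_unbounded B e : 0 < e ->
  \forall n \near \oo, 1 - e <= fine (P [set t | B < stat n t]).
Proof.
move=> e0; have [M M0 MP] := cvg_in_distribution_tight mX mG XG e0.
pose g := GWp p k0 k1 mu0 mu1.
pose K := (N0 + N1)%:R * M; pose C := 4 * Delta_sum p k0 k1 * (K + K).
have [n0 n0P] : exists n0 : nat, forall n, (n0 <= n)%N -> B + C < Num.sqrt n%:R * g.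
  pose r := Num.max ((B + C) / g) 0 + 1.
  have r0 : 0 < r by rewrite ltr_wpDl// le_max lexx orbT.
  exists (Num.truncn (r ^+ 2)).+1 => n n0.
  have : r < Num.sqrt n%:R.
    rewrite -[ltLHS]ger0_norm ?ltW// -sqrtr_sqr ltr_sqrt ?ltr0n; last exact: leq_ltn_trans n0.
    by apply: (lt_le_trans (truncnS_gt _)); rewrite ler_nat.
  move=> rn; rewrite -ltr_pdivrMr//; apply: le_lt_trans rn.
  by rewrite /r -[leLHS]addr0 lerD// le_max lexx.
have mstat n : measurable [set t | B < stat n t].
  by apply: measurable_lt_fun; [exact: measurable_cst|exact: measurable_stat].
near=> n.
have h1 : 1 - e <= fine (P [set t | `|X n t| <= M]) by near: n.
apply: (le_trans h1).
apply: (prob_le_almost_surely _ (mstat n) measurableT (probability_setT P)).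
  apply: measurable_sublevel; apply: continuous_rV_measurable => //.
  by move=> x; exact: norm_continuous.
move=> t [/= XM _]; have [l0 l1] := l1norm_deviation XM.
have sn : 0 <= Num.sqrt n%:R :> R by exact: sqrtr_ge0.
have := GWp_lip p k0 k1 (sX0 n t) s0 (sX1 n t) s1.
move=> /(ler_wpM2l sn); rewrite mulrDr -/g -/(stat n t).
have -> : Num.sqrt n%:R * (4 * Delta_sum p k0 k1 * (l1norm (X0 n t - mu0) + l1norm (X1 n t - mu1)))
   = 4 * Delta_sum p k0 k1 * (l1norm (Num.sqrt n%:R *: (X0 n t - mu0)) +
      l1norm (Num.sqrt n%:R *: (X1 n t - mu1))).
  by rewrite !l1normZ// -mulrDr mulrCA.
have hC : 4 * Delta_sum p k0 k1 * (l1norm (Num.sqrt n%:R *: (X0 n t - mu0)) +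
      l1norm (Num.sqrt n%:R *: (X1 n t - mu1))) <= C.
  by rewrite /C ler_wpM2l ?mulr_ge0 ?Delta_sum_ge0// lerD.
have : B + C < Num.sqrt n%:R * g by apply: n0P; near: n; exact: nbhs_infty_ge.
rewrite /stat; lra.
Unshelve. all: by end_near. Qed.

End alternative.

Section null.
Hypothesis p0 : 0 < p.
Hypothesis Dsym : forall x y x' y', Delta p k0 k1 x y x' y' = Delta p k0 k1 x' y' x y.
Hypothesis f0 : full_support mu0.
Hypothesis inj0 : forall x x', x <> x' -> k0 x <> k0 x'.
Variables (S : 'I_N0 -> 'I_N1) (T : 'I_N1 -> 'I_N0).
Hypotheses (ST : cancel S T) (TS : cancel T S).
Hypothesis nS : null_isos k0 k1 mu0 mu1 S.
Variable i0 : 'I_N0.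
Local Notation psi := (support_fun i0 (cost p k0 mu0)).

Let c0 := cost_diag k0 mu0 p0.
Let c_gt0 := cost_gt0 p f0 inj0.

Let phi (x : 'rV[R]_(N0 + N1)) : R := psi (lsubmx x - permute S (rsubmx x)).

Let cphi : continuous phi.
Proof.
have cw : continuous (fun x : 'rV[R]_(N0 + N1) => lsubmx x - permute S (rsubmx x)).
  apply: continuous_coords => i.
  rewrite (_ : (fun x : 'rV[R]_(N0 + N1) => _) =
    fun x => x 0 (lshift N1 i) - x 0 (rshift N0 (S i))); last by apply/funext => x; rewrite !mxE.
  have cc j : continuous (fun x : 'rV[R]_(N0 + N1) => x 0 j) by exact: coord_continuous.
  apply: continuous_add; first exact: cc.
  apply: (continuous_compR (h := -%R)); first exact: cc.
  by move=> x; apply: cvgN; exact: cvg_id.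
by move=> x; apply: (cvg_comp _ psi (cw x)); exact: support_fun_continuous.
Qed.

(** One half of [del] absorbs the remainder of [GWp_asymptotic], the other the portmanteau shift;
    likewise [e] is split between the portmanteau error and the event that the deviation is
    large. *)
Lemma stat_upper_tail t del e : 0 < del -> 0 < e -> \forall n \near \oo,
  fine (P [set x | t < stat n x]) <=
  1 - fine (PG [set x | psi (G0 x - permute S (G1 x)) <= t - del]) + e.
Proof.
move=> del0 e0; have e2 : 0 < e / 2 by rewrite divr_gt0.
have d2 : 0 < del / 2 by rewrite divr_gt0.
have [M M0 MP] := cvg_in_distribution_tight mX mG XG e2.
have K0 : 0 < (N0 + N1)%:R * M by rewrite mulr_gt0// ltr0n addn_gt0 (leq_trans _ (ltn_ord i0)).
have [n0 n0P] := GWp_asymptotic p0 Dsym f0 inj0 ST TS nS i0 K0 d2.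
have := portmanteau_ge mX mG XG cphi (t - del) d2 e2.
have mphi n s : measurable [set x | phi (X n x) <= s].
  by apply: measurable_sublevel; exact: continuous_rV_measurable.
have mnorm n : measurable [set x | `|X n x| <= M].
  apply: measurable_sublevel; apply: continuous_rV_measurable => //.
  by move=> x; exact: norm_continuous.
have mstat n : measurable [set x | t < stat n x].
  by apply: measurable_lt_fun; [exact: measurable_cst|exact: measurable_stat].
have phiE n x : phi (X n x) = psi (Num.sqrt n%:R *: (X0 n x - permute S (X1 n x))).
  rewrite /phi /X; congr (support_fun _ _ _); apply/rowP => i; rewrite !mxE.
  have := @row_mxEl R 1 N0 N1 (X0 n x) (X1 n x) 0 i.
  have := @row_mxEl R 1 N0 N1 mu0 mu1 0 i.
  have := @row_mxEr R 1 N0 N1 (X0 n x) (X1 n x) 0 (S i).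
  have := @row_mxEr R 1 N0 N1 mu0 mu1 0 (S i).
  have := permute_mu1 ST nS => /rowP/(_ i); rewrite !mxE => <- -> -> -> ->; lra.
have phiG : [set x | phi (G x) <= t - del] =
    [set x | psi (G0 x - permute S (G1 x)) <= t - del].
  by apply/funext => x; rewrite /= /phi /G row_mxKl row_mxKr.
rewrite phiG; move=> H; near=> n.
have h1 : fine (PG [set x | psi (G0 x - permute S (G1 x)) <= t - del]) <=
  fine (P [set x | phi (X n x) <= t - del + del / 2]) + e / 2 by near: n; exact: H.
have h2 : 1 - e / 2 <= fine (P [set x | `|X n x| <= M]) by near: n.
set s := t - del + del / 2 in h1.
have sE : s + del / 2 = t by rewrite /s -addrA -splitr subrK.
have h4 : fine (P [set x | t < stat n x]) <=
    fine (P (~` [set x | phi (X n x) <= s] `|` ~` [set x | `|X n x| <= M])).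
  apply: (prob_le_almost_surely (mstat n) _ measurableT (probability_setT P)).
    by apply: measurableU; exact: measurableC.
  move=> x [/= tx _]; apply: contrapT => /not_orP[/contrapT phix /contrapT XM].
  have [l0 l1] := l1norm_deviation XM.
  have := n0P n _ _ _ (sX0 n x) (sX1 n x) l0 l1; rewrite -phiE -/(stat n x) => h.
  have {}h : stat n x <= phi (X n x) + del / 2 by apply: h; near: n; exact: nbhs_infty_ge.
  by move: tx; rewrite ltNge => /negP; apply; rewrite -sE (le_trans h)// lerD2r.
apply: (le_trans h4); rewrite {h4}.
have : fine (P (~` [set x | phi (X n x) <= s] `|` ~` [set x | `|X n x| <= M])) <=
    fine (P (~` [set x | phi (X n x) <= s])) + fine (P (~` [set x | `|X n x| <= M])).
  rewrite -fineD ?fin_num_measure//; [|exact: measurableC..].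
  apply: fine_le; first by apply: fin_num_measure; apply: measurableU; exact: measurableC.
    by rewrite fin_numD !fin_num_measure//; exact: measurableC.
  by apply: measureU2; exact: measurableC.
rewrite !probability_setC// !fineB ?fin_num_measure//=; lra.
Unshelve. all: by end_near. Qed.

End null.
End statistic.

(** * Limits, quantiles and the final assembly *)

Section extended_limits.
Context {R : realType}.
Local Open Scope ereal_scope.

Lemma limn_esup_le (f : nat -> \bar R) (a : R) :
  (forall e : R, (0 < e)%R -> \forall n \near \oo, f n <= (a + e)%:E) ->
  limn_esup f <= a%:E.
Proof.
move=> H; apply/lee_addgt0Pr => e e0.
have /= fV := H e e0.
apply: (@le_trans _ _ (ereal_sup (f @` [set n | f n <= (a + e)%:E]))).
  by apply: ereal_inf_lbound; exists [set n | f n <= (a + e)%:E].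
by apply: ge_ereal_sup => _ [n /= fn <-]; rewrite -EFinD.
Qed.

Lemma cvge_to0 (f : nat -> \bar R) : (forall n, 0 <= f n) ->
  (forall e : R, (0 < e)%R -> \forall n \near \oo, f n <= e%:E) -> f @ \oo --> 0.
Proof.
move=> f0 fe; have fin e n : f n <= e%:E -> f n \is a fin_num.
  by move=> fn; rewrite ge0_fin_numE// (le_lt_trans fn)// ltry.
apply/fine_cvgP; split; first by apply: filterS (fe _ ltr01) => n; exact: fin.
apply/cvgrPdist_le => e e0; apply: filterS (fe _ e0) => n fn.
by rewrite /= sub0r normrN ger0_norm ?fine_ge0// -lee_fin fineK// (fin e).
Qed.

Lemma cvge_to1 (f : nat -> \bar R) : (forall n, 0 <= f n <= 1) ->
  (forall e : R, (0 < e)%R -> \forall n \near \oo, (1 - e <= fine (f n))%R) ->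
  f @ \oo --> 1.
Proof.
move=> f01 fe; have fin n : f n \is a fin_num.
  by have /andP[f0 f1] := f01 n; rewrite ge0_fin_numE// (le_lt_trans f1)// ltry.
apply/fine_cvgP; split; first exact: nearW.
apply/cvgrPdist_le => e e0; apply: filterS (fe _ e0) => n fn.
have : (fine (f n) <= 1)%R by rewrite -lee_fin fineK//; have /andP[] := f01 n.
by rewrite /= => f1; rewrite ler_norml; lra.
Qed.

End extended_limits.

Section quantiles.
Context d (T : measurableType d) (R : realType) (P : probability T R).
Variables (X : T -> \bar R) (b : R).
Hypothesis mX : forall t : R, measurable [set z | (X z <= t%:E)%E].

Lemma quantile_le t : b <= fine (P [set z | (X z <= t%:E)%E]) ->
  (quantile P X b <= t%:E)%E.
Proof.
move=> bt; apply: ereal_inf_lbound; exists t => //=.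
by rewrite -[leRHS]fineK ?fin_num_measure// lee_fin.
Qed.

Lemma quantile_ge t : fine (P [set z | (X z <= t%:E)%E]) < b ->
  (t%:E <= quantile P X b)%E.
Proof.
move=> tb; apply: le_ereal_inf_tmp => _ [s /= bs <-]; rewrite lee_fin leNgt.
apply/negP => st; move: bs; apply/negP; rewrite -ltNge.
rewrite -[ltLHS]fineK ?fin_num_measure// lte_fin; apply: le_lt_trans tb.
apply: fine_le; [exact: fin_num_measure (mX _)..|].
apply: le_measure; rewrite ?inE//.
by move=> z /= /le_trans; apply; rewrite lee_fin ltW.
Qed.

End quantiles.

Lemma measurable_gt_cst d (T : measurableType d) (R : realType) (f : T -> R) (c : \bar R) :
  measurable_fun setT f -> measurable [set t | (c < (f t)%:E)%E].
Proof.
move=> mf; case: c => [r||].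
- by under eq_set do rewrite lte_fin; apply: measurable_lt_fun => //; exact: measurable_cst.
- rewrite (_ : mkset _ = set0)//; apply/seteqP; split=> t //=.
- rewrite (_ : mkset _ = setT)//; apply/seteqP; split=> t //= _; exact: ltNyr.
Qed.

(** A strict inequality F t < b passes to the approximating distribution functions and places their
    quantiles above [t], even where [F] is flat. Points close to the supremum of such [t] lose at
    most [e], by continuity; F 0 = 0 < b provides one. *)
Lemma subcritical_level (R : realType) (F : R -> R) (b : R) e :
  (forall s t, s <= t -> F s <= F t) -> F 0 = 0 ->
  (forall t e, 0 <= t -> 0 < e -> exists2 del, 0 < del & F (t + del) <= F (t - del) + e) ->
  (forall e, 0 < e -> exists M, 1 - e <= F M) ->
  0 < b < 1 -> 0 < e -> exists2 t, 0 <= t & F t < b /\ b - e <= F t.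
Proof.
move=> F_mono F0 Fc FM /andP[b0 b1] e0.
pose A := [set t | 0 <= t /\ F t < b].
have A0 : A 0 by split; rewrite ?F0.
have b1' : 0 < 1 - b by lra.
have [M] := FM _ b1'; rewrite (_ : 1 - (1 - b) = b); last by lra.
move=> MP.
have Aub : ubound A M.
  move=> t [_ tb]; rewrite leNgt; apply/negP => /ltW/F_mono; lra.
have hA : has_sup A by split; [exists 0|exists M].
have s0 : 0 <= sup A by apply: ub_le_sup => //; exists M.
have [del del0 Fdel] := Fc _ _ s0 e0.
have [t [t0 tb] st] := sup_adherent del0 hA.
exists t => //; split=> //.
have : F (sup A - del) <= F t by apply: F_mono; exact: ltW.
have : b <= F (sup A + del).
  rewrite leNgt; apply/negP => lt.
  have : sup A + del <= sup A.
    by apply: ub_le_sup; [exists M|split=> //; lra].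
  lra.
lra.
Qed.

Theorem theorem4 (R : realType) (p : R) (N0 N1 : nat)
  (k0 : 'I_N0 -> 'I_N0 -> R) (k1 : 'I_N1 -> 'I_N1 -> R)
  (mu0 : 'rV[R]_N0) (mu1 : 'rV[R]_N1)
  (* the random measures mu_{0,n}, mu_{1,n} and the weak limit *)
  (dP : measure_display) (Om : measurableType dP) (P : probability Om R)
  (mu0n : nat -> {RV P >-> 'rV[R]_N0}) (mu1n : nat -> {RV P >-> 'rV[R]_N1})
  (dG : measure_display) (OmG : measurableType dG) (PG : probability OmG R)
  (G0 : {RV PG >-> 'rV[R]_N0}) (G1 : {RV PG >-> 'rV[R]_N1})
  (q : 'rV[R]_N0)
  (* the auxiliary samples Y_1, Y_2, ..., and the estimators *)
  (dE : measure_display) (E : measurableType dE) (nu : probability E R)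
  (dY : measure_display) (OmY : measurableType dY) (PY : probability OmY R)
  (Y : nat -> {RV PY >-> E})
  (Sigmahat : forall n : nat, {mfun n.-tuple E >-> 'M[R]_N0})
  (uhat : forall n : nat, {mfun n.-tuple E >-> 'rV[R]_(N0 * N0)})
  (* the vector Z, given that (Y_1, ..., Y_n) = y *)
  (dZ : measure_display) (OmZ : measurableType dZ) (PZ : probability OmZ R)
  (Z : forall n : nat, n.-tuple E -> {RV PZ >-> 'rV[R]_N0})
  (alpha : R) :
  let H0 := GW p k0 k1 mu0 mu1 = 0 in
  let L n y z := Lhat (uhat n y) (Z n y z) in
  let reject_prob n y :=
    P [set t | (quantile PZ (L n y) (1 - alpha) <
        (Num.sqrt n%:R * GW p k0 k1 (mu0n n t) (mu1n n t) `^ p)%:E)%E] in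
  0 < p ->
  (forall x y x' y', Delta p k0 k1 x y x' y' = Delta p k0 k1 x' y' x y) ->
  simplex mu0 -> simplex mu1 -> full_support mu0 -> full_support mu1 ->
  ~ point_mass mu0 ->
  (forall x x', x <> x' -> k0 x <> k0 x') ->
  (forall y y', y <> y' -> k1 y <> k1 y') ->
  (forall n t, simplex (mu0n n t)) -> (forall n t, simplex (mu1n n t)) ->
  cvg_in_distribution P PG
    (fun n t => Num.sqrt n%:R *:
       (row_mx (mu0n n t) (mu1n n t) - row_mx mu0 mu1))
    (fun t => row_mx (G0 t) (G1 t)) ->
  simplex q -> Sigma q <> 0 ->
  (* (A1) *)
  (H0 -> gaussian PG G0 (Sigma q)) ->
  (* (A2) *)
  (H0 -> forall S, null_isos k0 k1 mu0 mu1 S ->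
     indep_copy PG (fun t => permute S (G1 t)) G0) ->
  (forall i (A : set E), measurable A -> PY (Y i @^-1` A) = nu A) ->
  (* (A3) *)
  {ae PY, forall t,
     Sigmahat n (sample Y n t) @[n --> \oo] --> Sigma q /\
     uhat n (sample Y n t) @[n --> \oo] --> u_vec p k0 mu0} ->
  (forall n y, gaussian PZ (Z n y) (Sigmahat n y)) ->
  (* (A4) *)
  {ae PY, forall t, \forall n \near \oo,
     PZ [set z | \sum_i Z n (sample Y n t) z 0 i = 0] = 1%E} ->
  0 < alpha < 1 ->
  [/\ (* (a) *)
      H0 -> {ae PY, forall t,
               (limn_esup (fun n => reject_prob n (sample Y n t)) <= alpha%:E)%E},
      (* (b) *)
      H0 -> (exists S, null_isos k0 k1 mu0 mu1 = [set S]) ->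
        {ae PY, forall t,
           ereal_sup [set `|PZ [set z | (L n (sample Y n t) z <= s%:E)%E]
                - PG [set g | (Lstar p k0 k1 mu0 mu1 (G0 g) (G1 g) <= s%:E)%E]|%E
             | s in [set s : R | 0 <= s]] @[n --> \oo] --> (0 : \bar R)}
    & (* (c) *)
      0 < GW p k0 k1 mu0 mu1 ->
        {ae PY, forall t, reject_prob n (sample Y n t) @[n --> \oo] --> 1%E}].
Proof.
move=> H0 L reject_prob p0 Dsym smu0 smu1 fmu0 fmu1 _ inj0 inj1 sX0 sX1 XG sq Sq0
  A1 A2 _ A3 gZ A4 /andP[al0 al1].
have mX0 n : measurable_fun setT (mu0n n) by exact: measurable_funPT.
have mX1 n : measurable_fun setT (mu1n n) by exact: measurable_funPT.
have mG0 : measurable_fun setT G0 by exact: measurable_funPT.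
have mG1 : measurable_fun setT G1 by exact: measurable_funPT.
have mZ n y : measurable_fun setT (Z n y) by exact: measurable_funPT.
(* Weights summing to 1 force N0 > 0; [i0] is the point at which potentials are normalized. *)
have [i0] : exists i0 : 'I_N0, true.
  have [_ s1] := smu0; case: (posnP N0) => [N0E|N0_gt0]; last by exists (Ordinal N0_gt0).
  exfalso; move/eqP: s1; rewrite big1 ?(eq_sym 0) ?oner_eq0// => i _.
  by have iN := ltn_ord i; exfalso; move: iN; rewrite [X in (_ < X)%N]N0E.
move=> _.
have c0 := cost_diag k0 mu0 p0; have c_gt0 := cost_gt0 p fmu0 inj0.
have statE n t : Num.sqrt n%:R * GW p k0 k1 (mu0n n t) (mu1n n t) `^ p =
    Num.sqrt n%:R * GWp p k0 k1 (mu0n n t) (mu1n n t) by rewrite GW_powR.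
have mstat := measurable_stat p k0 k1 mX0 mX1 sX0 sX1.
have rejectE n y : reject_prob n y =
    P [set t | (quantile PZ (L n y) (1 - alpha) <
      (Num.sqrt n%:R * GWp p k0 k1 (mu0n n t) (mu1n n t))%:E)%E].
  by rewrite /reject_prob; under eq_set do rewrite statE.
have mL n y t : measurable [set z | (L n y z <= t%:E)%E].
  exact: (measurable_Lhat (fun=> uhat n y : 'rV[R]_(N0 * N0)) (fun=> mZ n y) 0 t).
have mreject n y : measurable [set t | (quantile PZ (L n y) (1 - alpha) <
      (Num.sqrt n%:R * GWp p k0 k1 (mu0n n t) (mu1n n t))%:E)%E].
  exact: measurable_gt_cst.
have u_vecE (l : 'I_(N0 * N0)) : u_vec p k0 mu0 0 l = cost p k0 mu0 (idx_i l) (idx_j l).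
  by rewrite mxE.
split.
- move=> h0; have [S [T [nS ST TS]]] := null_iso_exists p0 smu0 smu1 fmu0 fmu1 inj0 inj1 h0.
  have gG := A1 h0; have iS := A2 h0 S nS; have mH := measurable_permute S mG1.
  apply: filterS2 A3 A4 => t [VSigma uu0] Zsum0.
  apply: limn_esup_le => e e0; have e3 : 0 < e / 3 by rewrite divr_gt0.
  have mpsi : measurable_fun setT
      (fun g => support_fun i0 (cost p k0 mu0) (Num.sqrt 2 *: G0 g)).
    apply: continuous_rV_measurable; first exact: measurable_scale.
    exact: support_fun_continuous.
  have Fc := limit_cdf_continuous i0 c0 c_gt0 sq Sq0 mG0 gG.
  have F0 : limit_cdf PG i0 (cost p k0 mu0) G0 0 = 0.
    rewrite /limit_cdf (_ : mkset _ = [set g | support_fun i0 (cost p k0 mu0)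
      (Num.sqrt 2 *: G0 g) = 0]) ?(limit_level i0 c0 c_gt0 sq Sq0 mG0 gG)//.
    apply/seteqP; split=> g /=; last by move=> ->.
    by move=> g0; apply/eqP; rewrite eq_le g0 support_fun_ge0.
  (* The quantiles are eventually at least [s], so rejection implies that the statistic exceeds [s].
     The thirds of [e] pay for the gap between F s and 1 - alpha, for the passage from s to s - del,
     and for [stat_upper_tail]. *)
  have [||s s0 [sb bs]] := @subcritical_level R _ (1 - alpha) (e / 3)
    (limit_cdf_mono PG i0 c0 c_gt0 mG0) F0 Fc (limit_cdf_cvg1 PG i0 c0 c_gt0 mG0).
  - by rewrite subr_gt0 al1/= ltrBlDr ltrDl.
  - exact: e3.
  have [del del0 Fdel] := Fc _ _ s0 e3.
  have Fn := bootstrap_cdf_cvg (i0 := i0) c0 c_gt0 (fun n => mZ n (sample Y n t))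
    (fun n => gZ n (sample Y n t)) VSigma uu0 u_vecE Zsum0 sq Sq0 mG0 gG s0.
  have Fs : limit_cdf PG i0 (cost p k0 mu0) G0 s <=
      limit_cdf PG i0 (cost p k0 mu0) G0 (s + del) by apply: limit_cdf_mono => //; lra.
  have Fsd := difference_cdf_ge i0 c0 c_gt0 sq Sq0 mG0 gG mH iS (s - del).
  have tail := stat_upper_tail mX0 mX1 mG0 mG1 sX0 sX1 XG p0 Dsym fmu0 inj0 ST TS nS i0
    s del0 e3.
  near=> n; rewrite rejectE -[leLHS]fineK ?fin_num_measure// lee_fin.
  have Fns : fine (PZ [set z | (L n (sample Y n t) z <= s%:E)%E]) < 1 - alpha.
    by near: n; exact: (cvgr_lt _ Fn).
  have tailn : fine (P [set x | s <
      Num.sqrt n%:R * GWp p k0 k1 (mu0n n x) (mu1n n x)]) <=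
      1 - fine (PG [set x | support_fun i0 (cost p k0 mu0)
        (G0 x - permute S (G1 x)) <= s - del]) + e / 3 by near: n.
  have : fine (P [set x | (quantile PZ (L n (sample Y n t)) (1 - alpha) <
      (Num.sqrt n%:R * GWp p k0 k1 (mu0n n x) (mu1n n x))%:E)%E]) <=
      fine (P [set x | s < Num.sqrt n%:R * GWp p k0 k1 (mu0n n x) (mu1n n x)]).
    apply: (prob_le_almost_surely (mreject _ _) _ measurableT (probability_setT P)).
      by apply: measurable_lt_fun => //; exact: measurable_cst.
    by move=> x [/= qx _]; rewrite -lte_fin (le_lt_trans (quantile_ge (mL _ _) Fns)).
  lra.
- move=> h0 [S nSE].
  have nS : null_isos k0 k1 mu0 mu1 S by rewrite nSE.
  have [[[T ST TS] _] _] := nS.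
  have gG := A1 h0; have iS := A2 h0 S nS; have mH := measurable_permute S mG1.
  have mW := measurable_sub mG0 mH.
  apply: filterS2 A3 A4 => t [VSigma uu0] Zsum0.
  pose Fn n s := fine (PZ [set z | (L n (sample Y n t) z <= s%:E)%E]).
  pose F := limit_cdf PG i0 (cost p k0 mu0) G0.
  have mLstar s : measurable [set g | (Lstar p k0 k1 mu0 mu1 (G0 g) (G1 g) <= s%:E)%E].
    rewrite (_ : mkset _ = (fun g => G0 g - permute S (G1 g)) @^-1` [set w |
        forall h, potential (cost p k0 mu0) h -> dot h w <= s]).
      by have := @mW measurableT _ (closed_measurable_rV (@potential_bound_closed R p N0 k0 mu0 s));
        rewrite setTI.
    by apply/seteqP; split=> g /=; rewrite (Lstar_le p ST TS _ _ _ nSE).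
  (* [Lstar] agrees with psi(W) on the almost sure event that W sums to zero, where normalizing a
     potential does not change its pairing with W. *)
  have LstarE s : 0 <= s ->
      PG [set g | (Lstar p k0 k1 mu0 mu1 (G0 g) (G1 g) <= s%:E)%E] = (F s)%:E.
    move=> s0; rewrite -[LHS]fineK ?fin_num_measure//; congr EFin.
    rewrite /F -(difference_cdf i0 c0 c_gt0 sq Sq0 mG0 gG mH iS s0).
    apply: (prob_eq_almost_surely (mLstar s) _ (measurable_sum_coord mW)
      (difference_sum0 sq mG0 gG mH iS)).
      apply: measurable_sublevel; apply: continuous_rV_measurable => //.
      exact: support_fun_continuous.
    move=> g /= Wg; rewrite (Lstar_le p ST TS _ _ _ nSE); split=> [H|psiW h hP].
      by apply: support_fun_le => // h [_ hP]; exact: H.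
    exact: le_trans (potential_le_support i0 c0 c_gt0 Wg hP) psiW.
  have distE n s : 0 <= s -> `|PZ [set z | (L n (sample Y n t) z <= s%:E)%E]
      - PG [set g | (Lstar p k0 k1 mu0 mu1 (G0 g) (G1 g) <= s%:E)%E]|%E = `|Fn n s - F s|%:E.
    by move=> s0; rewrite LstarE// -[X in (X - _)%E]fineK ?fin_num_measure.
  apply: cvge_to0 => [n|e e0].
    apply: le_trans (ereal_sup_ubound _); last by exists 0 => //=.
    exact: abse_ge0.
  have Fn01 n s : 0 <= Fn n s <= 1 by exact: fine_prob_itv.
  have Fn_mono n s s' : s <= s' -> Fn n s <= Fn n s'.
    move=> ss; apply: (prob_le_almost_surely _ _ measurableT (probability_setT PZ)) => //.
    by move=> z [/= /le_trans Lz _]; apply: Lz; rewrite lee_fin.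
  have Fcvg s : 0 <= s -> Fn n s @[n --> \oo] --> F s.
    exact: (bootstrap_cdf_cvg (i0 := i0) c0 c_gt0 (fun n => mZ n (sample Y n t))
      (fun n => gZ n (sample Y n t)) VSigma uu0 u_vecE Zsum0 sq Sq0 mG0 gG).
  have := polya (limit_cdf_mono PG i0 c0 c_gt0 mG0) Fn_mono
    (limit_cdf_le1 PG i0 c0 c_gt0 mG0) Fn01 (limit_cdf_lt0 PG i0 c0 c_gt0 G0) Fcvg
    (limit_cdf_continuous i0 c0 c_gt0 sq Sq0 mG0 gG) (limit_cdf_cvg1 PG i0 c0 c_gt0 mG0) e0.
  apply: filterS => n H; apply: ge_ereal_sup => _ [s /= s0 <-].
  by rewrite distE// lee_fin H.
- move=> gw0; have gwp0 : 0 < GWp p k0 k1 mu0 mu1 by rewrite -(GW_powR k0 k1 p0)// powR_gt0.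
  apply: filterS2 A3 A4 => t [VSigma uu0] Zsum0.
  (* Tightness at tolerance alpha: once the conditional distribution function at [B] reaches 1 -
     alpha, the quantile is at most [B], and the statistic outgrows it. *)
  have [B BP] := Lhat_tight i0 c0 c_gt0 (fun n => mZ n (sample Y n t))
    (fun n => gZ n (sample Y n t)) VSigma uu0 u_vecE Zsum0 al0.
  apply: cvge_to1 => [n|e e0]; first by rewrite rejectE measure_ge0 probability_le1.
  have tail := stat_unbounded mX0 mX1 mG0 mG1 smu0 smu1 sX0 sX1 XG gwp0 B e0.
  near=> n; rewrite rejectE.
  have h1 : 1 - alpha <= fine (PZ [set z | (L n (sample Y n t) z <= B%:E)%E]) by near: n.
  have h2 : 1 - e <= fine (P [set x | B <
      Num.sqrt n%:R * GWp p k0 k1 (mu0n n x) (mu1n n x)]) by near: n.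
  apply: (le_trans h2).
  apply: (prob_le_almost_surely _ (mreject _ _) measurableT (probability_setT P)).
    by apply: measurable_lt_fun => //; exact: measurable_cst.
  move=> x [/= Bx _]; apply: (le_lt_trans (quantile_le (mL _ _) h1)) => //.
Unshelve. all: by end_near. Qed.
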